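(* Let $p,k\ge 1$ and $n_1,\dots,n_k\ge p$ be integers. For $j=1,\dots,k$ let $B_j>O$ be a constant $n_j\times n_j$ Hermitian positive definite matrix. Let $\alpha_1,\dots,\alpha_{k+1},\gamma_1,\dots,\gamma_k\in\mathbb{C}$ satisfy $\Re(\alpha_j+n_j)>p-1$ and $\Re(\alpha_j+n_j+\gamma_j)>p-1$ for $j=1,\dots,k$, $\Re(\alpha_{k+1})>p-1$, and $\Re(\alpha_{k+1}-\gamma_1-\cdots-\gamma_k)>p-1$. Let $E[\cdot]$ denote the average over the rectangular complex matrix-variate type-2 Dirichlet measure with these parameters, and let $$\phi_7(\tilde X_1,\dots,\tilde X_k)=|\det(\tilde X_1^{*}B_1\tilde X_1)|^{\gamma_1}\cdots|\det(\tilde X_k^{*}B_k\tilde X_k)|^{\gamma_k}.$$ Then $$E[\phi_7]=\left\{\prod_{j=1}^k\frac{\tilde\Gamma_p(\alpha_j+n_j+\gamma_j)}{\tilde\Gamma_p(\alpha_j+n_j)}\right\}\frac{\tilde\Gamma_p(\alpha_{k+1}-\gamma_1-\cdots-\gamma_k)}{\tilde\Gamma_p(\alpha_{k+1})}.$$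
   Context: For Hermitian matrices, $A>O$ means $A$ is positive definite; $I$ is the $p\times p$ identity; $\tilde X^{*}$ is the conjugate transpose. For an $n\times p$ complex matrix variable $\tilde X=(x_{ij}+\mathrm{i}\,y_{ij})$ with distinct entries, $d\tilde X=\prod_{i,j}dx_{ij}\,dy_{ij}$ (Lebesgue measure on $\mathbb{R}^{2np}$). $|\det(\cdot)|$ is the absolute value of the determinant. The complex matrix-variate gamma function is $\tilde\Gamma_p(\alpha)=\pi^{p(p-1)/2}\,\Gamma(\alpha)\Gamma(\alpha-1)\cdots\Gamma(\alpha-(p-1))$ for $\Re(\alpha)>p-1$. The rectangular complex matrix-variate type-2 Dirichlet measure, with parameters $\Re(\alpha_j+n_j)>p-1$ ($j=1,\dots,k$), $\Re(\alpha_{k+1})>p-1$, has density $$f_4(\tilde X_1,\dots,\tilde X_k)=\tilde G_k\left(\prod_{j=1}^k|\det(\tilde X_j^{*}B_j\tilde X_j)|^{\alpha_j}\right)|\det(I+\tilde X_1^{*}B_1\tilde X_1+\cdots+\tilde X_k^{*}B_k\tilde X_k)|^{-(\alpha_1+\cdots+\alpha_{k+1}+n_1+\cdots+n_k)}$$ on the set of tuples with $\tilde X_j$ a complex $n_j\times p$ matrix of full rank $p$, where $$\tilde G_k=\left\{\prod_{j=1}^k|\det(B_j)|^{p}\,\frac{\tilde\Gamma_p(n_j)}{\pi^{n_jp}\,\tilde\Gamma_p(\alpha_j+n_j)}\right\}\frac{\tilde\Gamma_p(\alpha_1+\cdots+\alpha_{k+1}+n_1+\cdots+n_k)}{\tilde\Gamma_p(\alpha_{k+1})}.$$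 The Dirichlet average of $\phi$ is $E[\phi]=\int\phi\,f_4\,d\tilde X_1\cdots d\tilde X_k$. *)

(* Defs.v *)
From HB Require Import structures.
From mathcomp Require Import all_boot all_order all_algebra.
From mathcomp Require Import all_classical all_reals all_analysis.
From mathcomp Require Export complex.

Set Implicit Arguments.
Unset Strict Implicit.
Unset Printing Implicit Defensive.

Import Order.TTheory GRing.Theory Num.Theory.
Import numFieldNormedType.Exports.

Local Open Scope classical_set_scope.
Local Open Scope ring_scope.
Local Open Scope sesquilinear_scope.
Local Open Scope complex_scope.

Section measure_tuple.
Context d (T : measurableType d) (R : realType).
Variable nu : {sigma_finite_measure set T -> \bar R}.

Definition tuple_cons m (x : T * m.-tuple T) : m.+1.-tuple T :=
  [the m.+1.-tuple T of x.1 :: x.2].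

Lemma measurable_tuple_cons m : measurable_fun [set: _] (@tuple_cons m).
Proof. by apply: measurable_cons; [exact: measurable_fst|exact: measurable_snd]. Qed.

Let preimage_cons m (A : set (m.+1.-tuple T)) :
  measurable A -> measurable (@tuple_cons m @^-1` A).
Proof. by move=> mA; rewrite -[X in measurable X]setTI; exact: measurable_tuple_cons. Qed.

Section step.
Variables (m : nat) (mu : {sigma_finite_measure set (m.-tuple T) -> \bar R}).

Definition measure_cons : set (m.+1.-tuple T) -> \bar R :=
  pushforward (nu \x mu)%E (@tuple_cons m).

Let measure_cons0 : measure_cons set0 = 0%E.
Proof. by rewrite /measure_cons /pushforward preimage_set0 measure0. Qed.

Let measure_cons_ge0 A : (0 <= measure_cons A)%E.
Proof. by rewrite /measure_cons /pushforward; exact: measure_ge0. Qed.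

Let measure_cons_sigma_additive : semi_sigma_additive measure_cons.
Proof.
move=> F mF tF mUF; rewrite /measure_cons /pushforward preimage_bigcup.
apply: measure_semi_sigma_additive => [i| |]; first exact: preimage_cons.
- apply/trivIsetP => /= i j _ _ ij; rewrite -preimage_setI.
  by move/trivIsetP : tF => /(_ _ _ _ _ ij) ->//; rewrite preimage_set0.
- by rewrite -preimage_bigcup; exact: preimage_cons.
Qed.

HB.instance Definition _ := isMeasure.Build _ _ _ measure_cons
  measure_cons0 measure_cons_ge0 measure_cons_sigma_additive.

Let measure_cons_sigma_finite : sigma_finite [set: _] measure_cons.
Proof.
have /sigma_finiteP[F [TF ndF Foo]] := sigma_finiteT nu.
have /sigma_finiteP[G [TG ndG Goo]] := sigma_finiteT mu.
pose g (v : m.+1.-tuple T) : T * m.-tuple T := (thead v, [tuple of behead v]).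
have gK : cancel (@tuple_cons m) g.
  by move=> [x v]; congr pair; apply: val_inj.
have mg : measurable_fun [set: _] g.
  apply: measurable_fun_pair => /=; last exact: measurable_behead.
  exact: measurable_tnth.
exists (fun i => g @^-1` (F i `*` G i)).
  rewrite -preimage_bigcup (_ : \bigcup_i _ = setT) ?preimage_setT //.
  apply/seteqP; split=> // -[x y] _.
  have : [set: T] x by []. rewrite TF => -[a _ Fax].
  have : [set: m.-tuple T] y by []. rewrite TG => -[b _ Gby].
  exists (maxn a b) => //; split => /=.
    by move: x Fax; exact/subsetPset/ndF/leq_maxl.
  by move: y Gby; exact/subsetPset/ndG/leq_maxr.
move=> i; have [mF Fi] := Foo i; have [mG Gi] := Goo i; split.
  by rewrite -[X in measurable X]setTI; apply: mg => //; exact: measurableX.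
rewrite /measure_cons /pushforward -comp_preimage.
rewrite (_ : g \o @tuple_cons m = id); last by apply/funext => x; exact: gK.
by rewrite preimage_id product_measure1E// lte_mul_pinfty// ge0_fin_numE.
Qed.

HB.instance Definition _ := Measure_isSigmaFinite.Build _ _ _
  measure_cons measure_cons_sigma_finite.

End step.

Fixpoint measure_tuple m : {sigma_finite_measure set (m.-tuple T) -> \bar R} :=
  match m with
  | 0 => @dirac _ (0.-tuple T) [tuple] R
  | m'.+1 => measure_cons (measure_tuple m')
  end.

Lemma measure_tuple_box m (A : 'I_m -> set T) :
  (forall i, measurable (A i)) ->
  measure_tuple m [set v | forall i, A i (tnth v i)] = (\prod_(i < m) nu (A i))%E.
Proof.
elim: m A => [|m IH] A mA.
  by rewrite big_ord0 /= diracE mem_set // => -[].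
rewrite big_ord_recl /= /measure_cons /pushforward.
rewrite -(IH (fun i => A (lift ord0 i))) // -product_measure1E //; last first.
  rewrite (_ : [set _ | _] = \bigcap_(i in [set: 'I_m])
      ((fun v : m.-tuple T => tnth v i) @^-1` A (lift ord0 i))).
    apply: fin_bigcap_measurable => // i _; rewrite -[X in measurable X]setTI.
    exact: measurable_tnth.
  by apply/seteqP; split => v /= Hv i; [move=> _|]; apply: Hv.
congr (_ _); apply/seteqP; split => -[x v] /=.
  move=> H; split => /=; first by have := H ord0.
  by move=> i; have := H (lift ord0 i); rewrite tnthS.
by move=> [Ax Av] i; case: (unliftP ord0 i) => [j|] ->; rewrite ?tnthS //; apply: Av.
Qed.

End measure_tuple.

Definition lebesgue_tuple (R : realType) (m : nat) :=
  measure_tuple (@lebesgue_measure R) m.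

Section cintegral.
Context d (T : measurableType d) (R : realType).
Variables (mu : {measure set T -> \bar R}) (D : set T) (f : T -> R[i]).

Definition cintegrable : Prop :=
  mu.-integrable D (fun x => (complex.Re (f x))%:E) /\
  mu.-integrable D (fun x => (complex.Im (f x))%:E).

Definition cintegral : R[i] :=
  (\int[mu]_(x in D) complex.Re (f x)) +i* (\int[mu]_(x in D) complex.Im (f x)).

End cintegral.

Section gamma.
Variable R : realType.

Definition cexp (z : R[i]) : R[i] :=
  (expR (complex.Re z))%:C * (cos (complex.Im z) +i* sin (complex.Im z)).

(* [x ^ a], only meaningful for [0 < x] *)
Definition cpow (x : R) (a : R[i]) : R[i] := cexp (a * (ln x)%:C).

(* Euler's integral, only meaningful for [0 < Re z] *)
Definition cGamma (z : R[i]) : R[i] :=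
  cintegral (@lebesgue_measure R) `]0, +oo[
    (fun t : R => cpow t (z - 1) * (expR (- t))%:C).

(* Only meaningful for [p%:R - 1 < Re a] *)
Definition mxGamma (p : nat) (a : R[i]) : R[i] :=
  (pi ^+ ((p * p.-1)./2))%:C * \prod_(i < p) cGamma (a - i%:R).

End gamma.

Section matrix.
Variable R : realType.

Definition absdet m (A : 'M[R[i]]_m) : R := complex.Re `|\det A|.

(* In [R[i]], [0 < z] says that [z] is real and positive. *)
Definition herm_posdef m (A : 'M[R[i]]_m) : Prop :=
  A \is hermsymmx /\
  forall v : 'cV[R[i]]_m, v != 0 -> 0 < (v^t* *m A *m v) 0 0.

End matrix.

Section dirichlet.
Variables (R : realType) (p k : nat) (n : 'I_k -> nat).

(* Index set of the [2 p (n_1 + ... + n_k)] real coordinates: the block, the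
   entry in that block, and the choice between real ([false]) and imaginary
   ([true]) part. *)
Definition coord : finType := {j : 'I_k & ('I_(n j) * 'I_p * bool)%type}.

Local Notation coordT := (#|coord|.-tuple (measurableTypeR R)).

Definition blocks (u : coordT) (j : 'I_k) :
    'M[R[i]]_(n j, p) :=
  let x (a : 'I_(n j)) (b : 'I_p) (im : bool) : R :=
    tnth u (enum_rank (Tagged (fun j => ('I_(n j) * 'I_p * bool)%type) (a, b, im)
                       : coord)) in
  \matrix_(a, b) (x a b false +i* x a b true).

Variables (B : forall j, 'M[R[i]]_(n j)) (alpha : 'I_k -> R[i])
  (alpha_last : R[i]).

Definition gram (X : forall j, 'M[R[i]]_(n j, p)) (j : 'I_k) : 'M[R[i]]_p :=
  (X j)^t* *m B j *m X j.

Definition total : R[i] :=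
  \sum_j alpha j + alpha_last + \sum_j (n j)%:R.

Definition dirichlet2_const : R[i] :=
  (\prod_j ((absdet (B j) ^+ p)%:C *
      (mxGamma p (n j)%:R /
       ((pi ^+ (n j * p))%:C * mxGamma p (alpha j + (n j)%:R))))) *
  (mxGamma p total / mxGamma p alpha_last).

Definition dirichlet2_density (X : forall j, 'M[R[i]]_(n j, p)) : R[i] :=
  dirichlet2_const * (\prod_j cpow (absdet (gram X j)) (alpha j)) *
  cpow (absdet (1%:M + \sum_j gram X j)) (- total).

Definition fullrank : set coordT :=
  [set u | forall j, \rank (blocks u j) = p].

(* [dirichlet2_avg] is the average when this holds, and has no meaning when it
   does not. *)
Definition dirichlet2_avg_exists
    (phi : (forall j, 'M[R[i]]_(n j, p)) -> R[i]) : Prop :=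
  cintegrable (lebesgue_tuple R #|coord|) fullrank
    (fun u => phi (blocks u) * dirichlet2_density (blocks u)).

Definition dirichlet2_avg
    (phi : (forall j, 'M[R[i]]_(n j, p)) -> R[i]) : R[i] :=
  cintegral (lebesgue_tuple R #|coord|) fullrank
    (fun u => phi (blocks u) * dirichlet2_density (blocks u)).

Definition det_power (gamma : 'I_k -> R[i])
    (X : forall j, 'M[R[i]]_(n j, p)) : R[i] :=
  \prod_j cpow (absdet (gram X j)) (gamma j).

End dirichlet.

(* Main.v *)
From HB Require Import structures.
Require Import Defs.
From mathcomp Require Import all_boot all_order all_algebra.
From mathcomp Require Import all_classical all_reals all_analysis.
From mathcomp Require Import fingroup perm spectral measurable_realfun ring lra.
Set Implicit Arguments.
Unset Strict Implicit.
Unset Printing Implicit Defensive.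
Import Order.TTheory GRing.Theory Num.Theory.
Import numFieldNormedType.Exports.
Local Open Scope classical_set_scope.
Local Open Scope ring_scope.
Local Open Scope sesquilinear_scope.
Local Open Scope complex_scope.

(* The power [|det (I + S)| ^ (- total)], with [S] the sum of the Gram matrices,
   is up to a constant the Gaussian integral over an auxiliary complex [p * p]
   matrix [Z] of [|det (Z^* Z)| ^ (total - p) exp (- tr (Z (I + S) Z^* ))]. After
   exchanging the integrals, the linear substitution [X_j -> L_j X_j Z^* ], where
   [B_j = L_j^* L_j], separates the variables: what remains is a product of
   Gaussian moments of [|det (X^* X)|]. A unitary rotation that maps the first
   column of [X] onto a basis vector peels off one row and one column, so these
   moments are products of gamma integrals. Since [phi_7] shifts [alpha_j] by
   [gamma_j] and [alpha_{k+1}] by [- \sum_j gamma_j] without changing [total],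
   the average is a ratio of two such integrals. *)

(** * Lebesgue measure on finite families of coordinates *)

(** Two constraints shape the proof. Changes of variables are established for nonnegative
    integrands, where they say that two measures agree on boxes or half-lines; complex integrands
    inherit them through [same_law], by splitting into components and then into positive and
    negative parts. Since [|x ^ a| = x ^ (Re a)], the modulus of the double integrand belongs to the
    same family with real parameters, so the formula for one order of integration also yields, by
    Tonelli, the absolute convergence that Fubini requires. Secondly, nothing is known here about
    zeros of the gamma function at complex arguments. Hence the moments are stated as products
    rather than quotients, and the Gaussian moment in [Z] is carried along as a factor. It is
    divided out only for real parameters, where gamma is positive, and only to obtain integrability.
    This suffices because the gamma value at [total] stands in the numerator of the Dirichlet
    constant. *)

Section box_uniqueness.
Variables (R : realType) (m : nat).
Local Notation T := (m.-tuple (measurableTypeR R)).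

Let box (A : 'I_m -> set R) : set T := [set v | forall i, A i (tnth v i)].

(** Boxes are closed under intersection and generate the sigma-algebra of the coordinates, and the
    cubes built on an exhaustion of the line by sets of finite measure cover the space, so the
    uniqueness theorem for measures applies. *)
Lemma lebesgue_tuple_unique (mu : {measure set T -> \bar R}) :
  (forall A : 'I_m -> set (measurableTypeR R), (forall i, measurable (A i)) ->
    mu (box A) = \prod_(i < m) lebesgue_measure (A i))%E ->
  forall X : set T, measurable X -> lebesgue_tuple R m X = mu X.
Proof.
move=> muE.
pose G : set (set T) :=
  [set X | exists2 A : 'I_m -> set (measurableTypeR R),
     (forall i, measurable (A i)) & X = box A].
have mbox (A : 'I_m -> set (measurableTypeR R)) :
    (forall i, measurable (A i)) -> measurable (box A).
  move=> mA; rewrite (_ : box A = \bigcap_(i in [set: 'I_m])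
      ((fun v : T => tnth v i) @^-1` A i)).
    apply: fin_bigcap_measurable => // i _; rewrite -[X in measurable X]setTI.
    exact: measurable_tnth.
  by apply/seteqP; split => v /= Hv i; [move=> _|]; apply: Hv.
have /sigma_finiteP[g [gT gnd goo]] := sigma_finiteT (@lebesgue_measure R).
apply: (measure_unique G (fun n => box (fun=> g n))).
- apply/seteqP; split; last first.
    apply: smallest_sub; first exact: sigma_algebra_measurable.
    by move=> _ [A mA ->]; exact: mbox.
  rewrite [X in X `<=` _](_ : _ = g_sigma_preimage
    (fun (i : 'I_m) (x : T) => tnth x i))//.
  apply: sub_sigma_algebra2; rewrite -bigcup_seq /= => X [i _] [A mA <-].
  exists (fun j => if j == i then A else setT).
    by move=> j; case: ifP.
  rewrite setTI; apply/seteqP; split => v /=.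
    by move=> Av j; case: eqVneq => [->|].
  by move=> /(_ i); rewrite eqxx.
- move=> _ _ [A mA ->] [B mB ->]; exists (fun i => A i `&` B i).
    by move=> i; exact: measurableI.
  apply/seteqP; split => v /=; first by move=> [HA HB] i; split.
  by move=> H; split => i; have [] := H i.
- by move=> n; exists (fun=> g n) => // i; have [] := goo n.
- apply/seteqP; split => // v _.
  have Hn (i : 'I_m) : exists n, g n (tnth v i).
    have : [set: measurableTypeR R] (tnth v i) by [].
    by rewrite gT => -[n _ Hn]; exists n.
  (* The exhaustion [g] is nondecreasing, so the largest of the finitely many indices serves all
     coordinates at once. *)
  pose N (i : 'I_m) := sval (cid (Hn i)).
  exists (\max_i N i)%N => // i /=.
  have := svalP (cid (Hn i)); rewrite -/(N i).
  by apply/subsetPset; apply: gnd; exact: leq_bigmax.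
- by move=> _ [A mA ->]; rewrite muE //; exact: measure_tuple_box.
- move=> n; have [mgn Hn] := goo n.
  rewrite [X in (X < _)%E](_ : _ = \prod_(i < m) lebesgue_measure (g n))%E;
    last by apply: measure_tuple_box.
  elim: m => [|m' IH]; first by rewrite big_ord0 ltry.
  by rewrite big_ord_recl lte_mul_pinfty// ge0_fin_numE.
Qed.

End box_uniqueness.

Notation cspace R I := (#|(I : finType)|.-tuple (measurableTypeR R)).
Notation leb R I := (lebesgue_tuple R #|(I : finType)|).

Section scaled_pushforward.
Context d1 d2 (T1 : measurableType d1) (T2 : measurableType d2) (R : realType).
Variables (mu : {measure set T1 -> \bar R}) (c : R) (phi : T1 -> T2).

Lemma scaled_pushforward : 0 <= c -> measurable_fun [set: T1] phi ->
  exists nu : {measure set T2 -> \bar R},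
    forall A, nu A = (c%:E * mu (phi @^-1` A))%E.
Proof.
move=> c0 mphi.
pose nu0 : {measure set T2 -> \bar R} :=
  measure_function_pushforward__canonical__measure_function_Measure mu mphi.
by exists (mscale (NngNum c0) nu0).
Qed.

End scaled_pushforward.

Section coordinates.
Variable R : realType.

(** Coordinates are addressed by elements of a finite type instead of ordinals, so that transposing,
    permuting and splitting matrices become maps between index types. *)
Definition cd (I : finType) (u : cspace R I) (i : I) : R := tnth u (enum_rank i).

Definition vec (I : finType) (x : I -> R) : cspace R I :=
  [tuple x (enum_val i) | i < #|I|].

Lemma cd_vec (I : finType) (x : I -> R) i : cd (vec x) i = x i.
Proof. by rewrite /cd /vec tnth_mktuple enum_rankK. Qed.

Lemma vec_cd (I : finType) (u : cspace R I) : vec (cd u) = u.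
Proof. by apply: eq_from_tnth => i; rewrite tnth_mktuple /cd enum_valK. Qed.

Lemma measurable_cd (I : finType) (i : I) :
  measurable_fun [set: cspace R I] (fun u => cd u i).
Proof. exact: measurable_tnth. Qed.

Lemma measurable_fun_vec d (T : measurableType d) (I : finType)
    (f : T -> I -> R) :
  (forall i, measurable_fun [set: T] (fun t => f t i)) ->
  measurable_fun [set: T] (fun t => vec (f t)).
Proof.
move=> mf; apply/measurable_fun_tnthP => i.
rewrite (_ : _ \o _ = fun t => f t (enum_val i)); first exact: mf.
by apply/funext => t /=; rewrite tnth_mktuple.
Qed.

Definition cbox (I : finType) (A : I -> set (measurableTypeR R)) : set (cspace R I) :=
  [set u | forall i, A i (cd u i)].

Lemma leb_cbox (I : finType) (A : I -> set (measurableTypeR R)) :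
  (forall i, measurable (A i)) ->
  leb R I (cbox A) = (\prod_i lebesgue_measure (A i))%E.
Proof.
move=> mA.
have -> : cbox A = [set v | forall i, A (enum_val i) (tnth v i)].
  apply/seteqP; split => v /= H i.
    by have := H (enum_val i); rewrite /cd enum_valK.
  by have := H (enum_rank i); rewrite enum_rankK.
rewrite [LHS](_ : _ = \prod_(i < #|I|) lebesgue_measure (A (enum_val i)))%E;
  last by apply: (measure_tuple_box lebesgue_measure).
rewrite [LHS](reindex (@enum_rank I)) /=; last first.
  by exists (@enum_val I I) => x _; rewrite ?enum_rankK ?enum_valK.
by apply: eq_bigr => i _; rewrite enum_rankK.
Qed.

Lemma measurable_cbox (I : finType) (A : I -> set (measurableTypeR R)) :
  (forall i, measurable (A i)) -> measurable (cbox A).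
Proof.
move=> mA; rewrite (_ : cbox A = \bigcap_(i in [set: I])
    ((fun u : cspace R I => cd u i) @^-1` A i)).
  apply: fin_bigcap_measurable => // i _; rewrite -[X in measurable X]setTI.
  by apply: (@measurable_cd I i); [exact: measurableT|exact: mA].
by apply/seteqP; split => v /= Hv i; [move=> _|]; apply: Hv.
Qed.

Lemma leb_unique (I : finType) (mu : {measure set (cspace R I) -> \bar R}) :
  (forall A : I -> set (measurableTypeR R), (forall i, measurable (A i)) ->
    mu (cbox A) = \prod_i lebesgue_measure (A i))%E ->
  forall X, measurable X -> leb R I X = mu X.
Proof.
move=> muE; apply: lebesgue_tuple_unique => A mA.
have := muE (fun i => A (enum_rank i)) (fun i => mA _).
have -> : cbox (fun i => A (enum_rank i)) = [set v | forall i, A i (tnth v i)].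
  apply/seteqP; split => v /= H i; last exact: H.
  by have := H (enum_val i); rewrite /cd enum_valK.
move=> ->; rewrite [RHS](reindex (@enum_rank I)) //=.
by exists (@enum_val I I) => x _; rewrite ?enum_rankK ?enum_valK.
Qed.

(** Every change of coordinates below passes through this reduction: a pushforward with the right
    values on boxes is Lebesgue measure. *)
Lemma leb_pushforward d (T : measurableType d) (mu : {measure set T -> \bar R})
    (I : finType) (phi : T -> cspace R I) (mphi : measurable_fun [set: T] phi) :
  (forall A : I -> set (measurableTypeR R), (forall i, measurable (A i)) ->
    mu (phi @^-1` cbox A) = \prod_i lebesgue_measure (A i))%E ->
  forall F : cspace R I -> \bar R, measurable_fun [set: cspace R I] F ->
    (forall u, 0 <= F u)%E ->
    (\int[leb R I]_u F u = \int[mu]_t F (phi t))%E.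
Proof.
move=> muE F mF F0.
rewrite -(@ge0_integral_pushforward _ _ _ _ _ _ mphi mu setT F) //.
apply: eq_measure_integral => X mX _.
by apply: leb_unique => // A mA; rewrite -muE.
Qed.

(** Lebesgue measure is determined by intervals open on the left and closed on the right. The sign
    of [a] decides at which end the preimage of such an interval is open, hence two cases. *)
Lemma lebesgue_measure_affine (a b : R) (A : set (measurableTypeR R)) :
  a != 0 -> measurable A ->
  (`|a|%:E * lebesgue_measure ((fun t : R => a * t + b)%R @^-1` A) = lebesgue_measure A)%E.
Proof.
move=> a0 mA.
have mf : measurable_fun [set: measurableTypeR R]
    (fun t : R => (a * t + b)%R : measurableTypeR R).
  by apply: measurable_funD => //; apply: measurable_funM.
have [nu nuE] := scaled_pushforward (@lebesgue_measure R) (normr_ge0 a) mf.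
rewrite -nuE; apply/esym.
have [a_gt0|a_lt0|a0'] := ltrgtP 0 a; last by rewrite -a0' eqxx in a0.
- apply: lebesgue_measure_unique => //= _ [[x y]] _ <-; rewrite nuE.
  rewrite (_ : _ @^-1` _ = `](x - b) / a, (y - b) / a]%classic); last first.
    apply/seteqP; split => t /=; rewrite !in_itv /= ltr_pdivrMr // ler_pdivlMr // [t * a]mulrC;
      lra.
  apply: (etrans _ (congr1 (mule _) (esym (lebesgue_measure_itv `](x - b) / a, (y - b) / a])))).
  rewrite lebesgue_measure_itv /= !lte_fin  ltr_pM2r ?invr_gt0 // ltrD2r.
  case: ifPn => // xy; last by rewrite mule0.
  rewrite -EFinD -EFinM gtr0_norm //; congr (_%:E); field.
  by rewrite gt_eqF.
- apply: lebesgue_measure_unique => //= _ [[x y]] _ <-; rewrite nuE.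
  rewrite (_ : _ @^-1` _ = `[(y - b) / a, (x - b) / a[%classic); last first.
    apply/seteqP; split => t /=; rewrite !in_itv /= ler_ndivrMr // ltr_ndivlMr // [t * a]mulrC;
      lra.
  apply: (etrans _ (congr1 (mule _) (esym (lebesgue_measure_itv `[(y - b) / a, (x - b) / a[)))).
  rewrite lebesgue_measure_itv /= !lte_fin ltr_nM2r ?invr_lt0 // ltrD2r.
  case: ifPn => // xy; last by rewrite mule0.
  rewrite -EFinD -EFinM ltr0_norm //; congr (_%:E); field.
  by rewrite lt_eqF.
Qed.

Lemma leb_affine (I : finType) (a b : I -> R) (F : cspace R I -> \bar R) :
  (forall i, a i != 0) -> measurable_fun [set: cspace R I] F -> (forall u, 0 <= F u)%E ->
  (\int[leb R I]_u F u = (\prod_i `|a i|)%:E *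
    \int[leb R I]_u F (vec (fun i => a i * cd u i + b i)%R))%E.
Proof.
move=> a0 mF F0.
have mphi : measurable_fun setT
    (fun u : cspace R I => vec (fun i => a i * cd u i + b i)).
  apply: measurable_fun_vec => i; apply: measurable_funD => //.
  by apply: measurable_funM => //; exact: measurable_cd.
have p0 : 0 <= \prod_i `|a i| by apply: prodr_ge0.
pose mu := mscale (NngNum p0) (leb R I).
rewrite (@leb_pushforward _ _ [the measure _ _ of mu] _ _ mphi) //; last first.
  move=> A mA; rewrite [LHS](_ : _ = (\prod_i `|a i|)%:E *
      leb R I (cbox (fun i => (fun t => a i * t + b i)%R @^-1` A i)))%E; last first.
    congr (_ * leb R I _)%E.
    by apply/seteqP; split => u /= H i; have := H i; rewrite cd_vec.
  rewrite leb_cbox; last first.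
    move=> i; rewrite -[X in measurable X]setTI.
    suff : measurable_fun [set: measurableTypeR R]
       (fun t : R => (a i * t + b i)%R : measurableTypeR R) by apply.
    by apply: measurable_funD => //; apply: measurable_funM.
  rewrite -prodEFin -big_split /=; apply: eq_bigr => i _.
  exact: lebesgue_measure_affine.
rewrite ge0_integral_mscale //=.
exact: measurableT_comp.
Qed.

(** [h] says from which of two families each coordinate is read. Splitting by rows, into real and
    imaginary parts, and into blocks are all instances. *)
Definition join_cd (I J K : finType) (h : I -> J + K) (z : cspace R J * cspace R K) :
  cspace R I :=
  vec (fun i => match h i with inl j => cd z.1 j | inr k => cd z.2 k end).

Lemma measurable_join_cd (I J K : finType) (h : I -> J + K) :
  measurable_fun setT (join_cd h).
Proof.
apply: measurable_fun_vec => i; case: (h i) => j.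
  exact: (measurableT_comp (@measurable_cd J j)).
exact: (measurableT_comp (@measurable_cd K j)).
Qed.

Lemma leb_join (I J K : finType) (h : I -> J + K) (F : cspace R I -> \bar R) :
  bijective h -> measurable_fun [set: cspace R I] F -> (forall u, 0 <= F u)%E ->
  (\int[leb R I]_u F u = \int[leb R J \x leb R K]_z F (join_cd h z))%E.
Proof.
move=> [g hK gK] mF F0; rewrite (@leb_pushforward _ _ (leb R J \x leb R K)%E _ _ (measurable_join_cd h)) // => A mA.
rewrite (_ : _ @^-1` _ = cbox (A \o g \o inl) `*` cbox (A \o g \o inr)).
  rewrite [LHS](_ : _ = leb R J (cbox (A \o g \o inl)) *
      leb R K (cbox (A \o g \o inr)))%E; last first.
    by apply: product_measure1E; apply: measurable_cbox => i; exact: mA.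
  rewrite !leb_cbox //= [RHS](reindex g) /=; last first.
    by exists h => x _.
  by rewrite big_sumType.
apply/seteqP; split => -[u v]; rewrite /join_cd /cbox /=.
  move=> H; split => i /=.
    by have := H (g (inl i)); rewrite cd_vec gK.
  by have := H (g (inr i)); rewrite cd_vec gK.
move=> [/= H1 H2] i; rewrite cd_vec; case E : (h i) => [j|k].
  by have := H1 j; rewrite /= -E hK.
by have := H2 k; rewrite /= -E hK.
Qed.

Lemma leb_reindex (I J : finType) (h : I -> J) (F : cspace R I -> \bar R) :
  bijective h -> measurable_fun [set: cspace R I] F -> (forall u, 0 <= F u)%E ->
  (\int[leb R I]_u F u = \int[leb R J]_u F (vec (fun i => cd u (h i))))%E.
Proof.
move=> [g hK gK] mF F0.
apply: leb_pushforward => // [|A mA].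
  by apply: measurable_fun_vec => i; exact: measurable_cd.
rewrite (_ : _ @^-1` _ = cbox (A \o g)).
  rewrite [LHS](_ : _ = \prod_j lebesgue_measure ((A \o g) j))%E; last first.
    by apply: leb_cbox => j; exact: mA.
  rewrite [RHS](reindex g) //=.
  by exists h => x _.
apply/seteqP; split => u /= H i; last by have := H (h i); rewrite cd_vec /= hK.
by have := H (g i); rewrite cd_vec gK.
Qed.

Lemma leb_join_iter (I J K : finType) (h : I -> J + K) (F : cspace R I -> \bar R) :
  bijective h -> measurable_fun [set: cspace R I] F -> (forall u, 0 <= F u)%E ->
  (\int[leb R I]_u F u = \int[leb R J]_x \int[leb R K]_y F (join_cd h (x, y)))%E.
Proof.
move=> bh mF F0; rewrite (leb_join bh) // fubini_tonelli1 //.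
by apply: measurableT_comp => //; exact: measurable_join_cd.
Qed.

End coordinates.

(** * Matrix spaces and linear changes of variables *)

Section complex_modulus.
Variable R : realType.
Implicit Types z w : R[i].

Definition cabs z : R := complex.Re `|z|.

Lemma cabsE z : `|z| = (cabs z)%:C.
Proof. by rewrite /cabs normc_def. Qed.

Lemma cabsM z w : cabs (z * w) = cabs z * cabs w.
Proof. by apply: complexI; rewrite -cabsE normrM !cabsE -rmorphM. Qed.

Lemma cabs_sqr z : cabs z ^+ 2 = complex.Re z ^+ 2 + complex.Im z ^+ 2.
Proof. by rewrite /cabs normc_def /= sqr_sqrtr // addr_ge0 ?sqr_ge0. Qed.

Lemma cabs_ge0 z : 0 <= cabs z.
Proof. by rewrite /cabs normc_def /= sqrtr_ge0. Qed.

Lemma cabs_eq0 z : (cabs z == 0) = (z == 0).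
Proof.
rewrite -[RHS]normr_eq0 cabsE.
by apply/eqP/eqP => [->//|]; exact: (@complexI _ _ 0).
Qed.

Lemma cabs0 : cabs 0 = 0. Proof. by apply/eqP; rewrite cabs_eq0. Qed.

Lemma cabs1 : cabs 1 = 1. Proof. by rewrite /cabs normr1. Qed.

Lemma cabsX z n : cabs (z ^+ n) = cabs z ^+ n.
Proof. by elim: n => [|n IH]; rewrite ?cabs1 // !exprS cabsM IH. Qed.

Lemma absdetE n (A : 'M[R[i]]_n) : absdet A = cabs (\det A). Proof. by []. Qed.

Lemma absdet_ge0 n (A : 'M[R[i]]_n) : 0 <= absdet A. Proof. exact: cabs_ge0. Qed.

Lemma absdetM n (A B : 'M[R[i]]_n) : absdet (A *m B) = absdet A * absdet B.
Proof. by rewrite !absdetE det_mulmx cabsM. Qed.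

Lemma absdet_tr n (A : 'M[R[i]]_n) : absdet A^T = absdet A.
Proof. by rewrite !absdetE det_tr. Qed.

Lemma cabs_conj z : cabs z^*%C = cabs z.
Proof. by rewrite /cabs normcJ. Qed.

Lemma absdet_ct n (A : 'M[R[i]]_n) : absdet (A^t*) = absdet A.
Proof.
rewrite !absdetE -(cabs_conj (\det A)); congr cabs.
by rewrite -map_trmx det_tr det_map_mx.
Qed.

Lemma absdet1 n : absdet (1%:M : 'M[R[i]]_n) = 1.
Proof. by rewrite absdetE det1 cabs1. Qed.

Lemma absdet_gt0 n (A : 'M[R[i]]_n) : (0 < absdet A) = (A \in unitmx).
Proof. by rewrite lt_neqAle absdet_ge0 andbT eq_sym cabs_eq0 unitmxE unitfE. Qed.

End complex_modulus.

(** * Measurability of complex and matrix-valued functions *)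

Section complex_measurability.
Context d (T : measurableType d) (R : realType).
Implicit Types f g : T -> R[i].

Definition cmeas f :=
  measurable_fun [set: T] (fun x => complex.Re (f x)) /\
  measurable_fun [set: T] (fun x => complex.Im (f x)).

Lemma cmeas_cst z : cmeas (fun=> z).
Proof. by split; exact: measurable_cst. Qed.

Lemma cmeasD f g : cmeas f -> cmeas g -> cmeas (fun x => f x + g x).
Proof.
move=> [f1 f2] [g1 g2]; split.
  apply: (eq_measurable_fun (fun x => complex.Re (f x) + complex.Re (g x))).
    by move=> x _; case: (f x); case: (g x).
  exact: measurable_funD.
apply: (eq_measurable_fun (fun x => complex.Im (f x) + complex.Im (g x))).
  by move=> x _; case: (f x); case: (g x).
exact: measurable_funD.
Qed.

Lemma cmeasM f g : cmeas f -> cmeas g -> cmeas (fun x => f x * g x).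
Proof.
move=> [f1 f2] [g1 g2]; split.
  apply: (eq_measurable_fun (fun x => complex.Re (f x) * complex.Re (g x) - complex.Im (f x) * complex.Im (g x))).
    by move=> x _; case: (f x); case: (g x).
  by apply: measurable_funB; apply: measurable_funM.
apply: (eq_measurable_fun (fun x => complex.Re (f x) * complex.Im (g x) + complex.Im (f x) * complex.Re (g x))).
  by move=> x _; case: (f x); case: (g x).
by apply: measurable_funD; apply: measurable_funM.
Qed.

Lemma cmeas_sum (I : Type) (r : seq I) (P : pred I) (f : I -> T -> R[i]) :
  (forall i, cmeas (f i)) -> cmeas (fun x => \sum_(i <- r | P i) f i x).
Proof.
move=> mf; elim: r => [|i r IH].
  by under eq_fun do rewrite big_nil; exact: cmeas_cst.
under eq_fun do rewrite big_cons; case: (P i) => //.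
exact: cmeasD.
Qed.

Lemma cmeas_prod (I : Type) (r : seq I) (P : pred I) (f : I -> T -> R[i]) :
  (forall i, cmeas (f i)) -> cmeas (fun x => \prod_(i <- r | P i) f i x).
Proof.
move=> mf; elim: r => [|i r IH].
  by under eq_fun do rewrite big_nil; exact: cmeas_cst.
under eq_fun do rewrite big_cons; case: (P i) => //.
exact: cmeasM.
Qed.

Lemma cmeas_real (u : T -> R) :
  measurable_fun [set: T] u -> cmeas (fun x => (u x)%:C).
Proof. by move=> mu; split => //=; exact: measurable_cst. Qed.

Lemma cmeas_pair (u v : T -> R) : measurable_fun [set: T] u ->
  measurable_fun [set: T] v -> cmeas (fun x => u x +i* v x).
Proof. by move=> mu mv; split. Qed.

Lemma cmeas_conj f : cmeas f -> cmeas (fun x => (f x)^*%C).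
Proof.
move=> [f1 f2]; split.
  by apply: eq_measurable_fun f1 => x _; case: (f x).
apply: (eq_measurable_fun (fun x => - complex.Im (f x))).
  by move=> x _; case: (f x).
exact: measurableT_comp.
Qed.

Lemma measurable_cabs f : cmeas f -> measurable_fun [set: T] (fun x => cabs (f x)).
Proof.
move=> [f1 f2]; rewrite /cabs; under eq_fun do rewrite normc_def /=.
apply: measurableT_comp; first exact: continuous_measurable_fun (@sqrt_continuous R).
by apply: measurable_funD; apply: measurable_funX.
Qed.

Definition mmeas n p (X : T -> 'M[R[i]]_(n, p)) :=
  forall a b, cmeas (fun x => X x a b).

Lemma mmeas_cst n p (A : 'M[R[i]]_(n, p)) : mmeas (fun=> A).
Proof. by move=> a b; exact: cmeas_cst. Qed.

Lemma mmeasD n p (X Y : T -> 'M[R[i]]_(n, p)) :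
  mmeas X -> mmeas Y -> mmeas (fun x => X x + Y x).
Proof.
by move=> mX mY a b; under eq_fun do rewrite mxE; apply: cmeasD.
Qed.

Lemma mmeas_sum (I : Type) (r : seq I) n p (X : I -> T -> 'M[R[i]]_(n, p)) :
  (forall i, mmeas (X i)) -> mmeas (fun x => \sum_(i <- r) X i x).
Proof.
by move=> mX a b; under eq_fun do rewrite summxE; apply: cmeas_sum => i; exact: mX.
Qed.

Lemma mmeasM m n p (X : T -> 'M[R[i]]_(m, n)) (Y : T -> 'M[R[i]]_(n, p)) :
  mmeas X -> mmeas Y -> mmeas (fun x => X x *m Y x).
Proof.
move=> mX mY a b; under eq_fun do rewrite mxE.
by apply: cmeas_sum => j; apply: cmeasM.
Qed.

Lemma mmeas_tr n p (X : T -> 'M[R[i]]_(n, p)) :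
  mmeas X -> mmeas (fun x => (X x)^T).
Proof. by move=> mX a b; under eq_fun do rewrite mxE. Qed.

Lemma mmeas_ct n p (X : T -> 'M[R[i]]_(n, p)) :
  mmeas X -> mmeas (fun x => (X x)^t*).
Proof. by move=> mX a b; under eq_fun do rewrite !mxE; apply: cmeas_conj. Qed.

Lemma mmeas_col n1 n2 p (X : T -> 'M[R[i]]_(n1, p)) (Y : T -> 'M[R[i]]_(n2, p)) :
  mmeas X -> mmeas Y -> mmeas (fun x => col_mx (X x) (Y x)).
Proof.
move=> mX mY a b; under eq_fun do rewrite mxE.
by case: (fintype.split a).
Qed.

Lemma mmeas_row n p1 p2 (X : T -> 'M[R[i]]_(n, p1)) (Y : T -> 'M[R[i]]_(n, p2)) :
  mmeas X -> mmeas Y -> mmeas (fun x => row_mx (X x) (Y x)).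
Proof.
move=> mX mY a b; under eq_fun do rewrite mxE.
by case: (fintype.split b).
Qed.

Lemma cmeas_det n (X : T -> 'M[R[i]]_n) : mmeas X -> cmeas (fun x => \det (X x)).
Proof.
move=> mX; apply: cmeas_sum => s; apply: cmeasM; first exact: cmeas_cst.
by apply: cmeas_prod => i; exact: mX.
Qed.

Lemma measurable_absdet n (X : T -> 'M[R[i]]_n) :
  mmeas X -> measurable_fun [set: T] (fun x => absdet (X x)).
Proof. by move=> /cmeas_det/measurable_cabs. Qed.

End complex_measurability.

Lemma cmeas_comp d1 d2 (T1 : measurableType d1) (T2 : measurableType d2)
    (R : realType) (f : T2 -> R[i]) (phi : T1 -> T2) :
  cmeas f -> measurable_fun [set: T1] phi -> cmeas (fun x => f (phi x)).
Proof.
move=> [f1 f2] mphi; split.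
  exact: (measurableT_comp f1).
exact: (measurableT_comp f2).
Qed.

Lemma mmeas_comp d1 d2 (T1 : measurableType d1) (T2 : measurableType d2)
    (R : realType) n p (f : T2 -> 'M[R[i]]_(n, p)) (phi : T1 -> T2) :
  mmeas f -> measurable_fun [set: T1] phi -> mmeas (fun x => f (phi x)).
Proof. by move=> mf mphi a b; exact: (cmeas_comp (mf a b)). Qed.

Notation mcoord n p := ('I_n * 'I_p * bool)%type.

Section matrix_space.
Variable R : realType.

Definition mat n p (u : cspace R (mcoord n p)) : 'M[R[i]]_(n, p) :=
  \matrix_(a, b) (cd u (a, b, false) +i* cd u (a, b, true)).

Definition unmat n p (X : 'M[R[i]]_(n, p)) : cspace R (mcoord n p) :=
  vec (fun c => let: (a, b, im) := c in
    if im then complex.Im (X a b) else complex.Re (X a b)).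

Lemma unmatK n p : cancel (@unmat n p) (@mat n p).
Proof. by move=> X; apply/matrixP => a b; rewrite mxE !cd_vec; case: (X a b). Qed.

Lemma matK n p : cancel (@mat n p) (@unmat n p).
Proof.
move=> u; rewrite -[RHS]vec_cd; congr vec; apply/funext => -[[a b] []];
by rewrite mxE.
Qed.

Lemma mmeas_mat n p : mmeas (@mat n p).
Proof.
move=> a b; under eq_fun do rewrite mxE.
by apply: cmeas_pair; exact: measurable_cd.
Qed.

Lemma measurable_unmat d (T : measurableType d) n p (X : T -> 'M[R[i]]_(n, p)) :
  mmeas X -> measurable_fun [set: T] (fun x => unmat (X x)).
Proof.
move=> mX; apply: measurable_fun_vec => -[[a b] im].
by have [m1 m2] := mX a b; case: im.
Qed.

(** Measurability and integrals on matrices are transported from the space of real coordinates. *)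
Definition mfun_mx n p (F : 'M[R[i]]_(n, p) -> \bar R) :=
  measurable_fun [set: cspace R (mcoord n p)] (fun u => F (mat u)).

Lemma measurable_mfun_mx d (T : measurableType d) n p
    (F : 'M[R[i]]_(n, p) -> \bar R) (X : T -> 'M[R[i]]_(n, p)) :
  mfun_mx F -> mmeas X -> measurable_fun [set: T] (fun x => F (X x)).
Proof.
move=> mF mX.
apply: (eq_measurable_fun (fun x => F (mat (unmat (X x))))).
  by move=> x _; rewrite unmatK.
apply: (measurableT_comp mF); exact: measurable_unmat.
Qed.

Definition mint n p (F : 'M[R[i]]_(n, p) -> \bar R) : \bar R :=
  (\int[leb R (mcoord n p)]_u F (mat u))%E.

Lemma mint_reindex n p n' p' (h : mcoord n p -> mcoord n' p')
    (G : 'M[R[i]]_(n', p') -> 'M[R[i]]_(n, p)) (F : 'M[R[i]]_(n, p) -> \bar R) :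
  bijective h ->
  (forall u, mat (vec (fun i => cd u (h i))) = G (mat u)) ->
  mfun_mx F -> (forall X, 0 <= F X)%E ->
  mint F = mint (fun X => F (G X)).
Proof.
move=> bh hG mF F0; rewrite /mint (leb_reindex bh) //.
by apply: eq_integral => u _; rewrite hG.
Qed.

Lemma mint_join n p n1 p1 n2 p2 (h : mcoord n p -> mcoord n1 p1 + mcoord n2 p2)
    (G : 'M[R[i]]_(n1, p1) -> 'M[R[i]]_(n2, p2) -> 'M[R[i]]_(n, p))
    (F : 'M[R[i]]_(n, p) -> \bar R) :
  bijective h ->
  (forall u v, mat (join_cd h (u, v)) = G (mat u) (mat v)) ->
  mfun_mx F -> (forall X, 0 <= F X)%E ->
  mint F = mint (fun X => mint (fun Y => F (G X Y))).
Proof.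
move=> bh hG mF F0; rewrite /mint (leb_join_iter bh) //.
apply: eq_integral => u _; apply: eq_integral => v _.
by rewrite hG.
Qed.

Lemma mfun_mint n p n1 p1 (F : 'M[R[i]]_(n, p) -> 'M[R[i]]_(n1, p1) -> \bar R) :
  measurable_fun [set: cspace R (mcoord n p) * cspace R (mcoord n1 p1)]
    (fun z => F (mat z.1) (mat z.2)) ->
  (forall X Y, 0 <= F X Y)%E ->
  mfun_mx (fun X => mint (F X)).
Proof.
move=> mF F0.
exact: (measurable_fun_fubini_tonelli_F (m2 := leb R (mcoord n1 p1)) _ mF (fun z => F0 _ _)).
Qed.

Lemma mint_swap n p n1 p1 (F : 'M[R[i]]_(n, p) -> 'M[R[i]]_(n1, p1) -> \bar R) :
  measurable_fun [set: cspace R (mcoord n p) * cspace R (mcoord n1 p1)]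
    (fun z => F (mat z.1) (mat z.2)) ->
  (forall X Y, 0 <= F X Y)%E ->
  mint (fun X => mint (F X)) = mint (fun Y => mint (F ^~ Y)).
Proof.
move=> mF F0.
exact: (fubini_tonelli (m1 := leb R (mcoord n p)) (m2 := leb R (mcoord n1 p1)) _ mF (fun z => F0 _ _)).
Qed.

Lemma mmeas_fst d (T : measurableType d) n p :
  mmeas (fun z : cspace R (mcoord n p) * T => mat z.1).
Proof. exact: (mmeas_comp (@mmeas_mat n p)). Qed.

Lemma mmeas_snd d (T : measurableType d) n p :
  mmeas (fun z : T * cspace R (mcoord n p) => mat z.2).
Proof. exact: (mmeas_comp (@mmeas_mat n p)). Qed.

Lemma eq_mint n p (F G : 'M[R[i]]_(n, p) -> \bar R) : F =1 G -> mint F = mint G.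
Proof. by move=> FG; apply: eq_integral => u _; rewrite FG. Qed.

Lemma mint_ge0 n p (F : 'M[R[i]]_(n, p) -> \bar R) :
  (forall X, 0 <= F X)%E -> (0 <= mint F)%E.
Proof. by move=> F0; apply: integral_ge0. Qed.

Lemma mintZl n p (F : 'M[R[i]]_(n, p) -> \bar R) (c : \bar R) : (0 <= c)%E ->
  mfun_mx F -> (forall X, 0 <= F X)%E -> (mint (fun X => c * F X) = c * mint F)%E.
Proof. by move=> c0 mF F0; rewrite /mint ge0_integralZl. Qed.

Definition row_split n1 n2 p (c : mcoord (n1 + n2) p) :
    mcoord n1 p + mcoord n2 p :=
  let: (a, b, im) := c in
  match fintype.split a with inl i => inl (i, b, im) | inr i => inr (i, b, im) end.

Lemma row_split_bij n1 n2 p : bijective (@row_split n1 n2 p).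
Proof.
exists (fun s => match s with
  | inl c => let: (i, b, im) := c in (lshift n2 i, b, im)
  | inr c => let: (i, b, im) := c in (rshift n1 i, b, im) end).
- by move=> [[a b] im]; rewrite /row_split; case: splitP => j aj;
    congr (_, _, _); apply: val_inj.
- move=> [] [[i b] im]; rewrite /row_split.
  + by rewrite (unsplitK (inl i) : fintype.split (lshift n2 i) = inl i).
  + by rewrite (unsplitK (inr i) : fintype.split (rshift n1 i) = inr i).
Qed.

Lemma mint_col_mx n1 n2 p (F : 'M[R[i]]_(n1 + n2, p) -> \bar R) :
  mfun_mx F -> (forall X, 0 <= F X)%E ->
  mint F = mint (fun X : 'M[R[i]]_(n1, p) => mint (fun Y : 'M[R[i]]_(n2, p) => F (col_mx X Y))).
Proof.
apply: (mint_join (@row_split_bij n1 n2 p)) => u v.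
apply/matrixP => a b; rewrite !mxE /join_cd !cd_vec /row_split.
by case: (fintype.split a) => i; rewrite !mxE.
Qed.

Lemma mint_tr n p (F : 'M[R[i]]_(n, p) -> \bar R) :
  mfun_mx F -> (forall X, 0 <= F X)%E ->
  mint F = mint (fun X : 'M[R[i]]_(p, n) => F X^T).
Proof.
apply: (@mint_reindex _ _ _ _ (fun c => let: (a, b, im) := c in (b, a, im))).
  by exists (fun c => let: (a, b, im) := c in (b, a, im)) => -[[a b] im].
by move=> u; apply/matrixP => a b; rewrite !mxE !cd_vec.
Qed.

Lemma mint_perm n p (s : 'S_n) (F : 'M[R[i]]_(n, p) -> \bar R) :
  mfun_mx F -> (forall X, 0 <= F X)%E ->
  mint F = mint (fun X => F (row_perm s X)).
Proof.
apply: (@mint_reindex _ _ _ _ (fun c => let: (a, b, im) := c in (s a, b, im))).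
  exists (fun c => let: (a, b, im) := c in ((s^-1)%g a, b, im)) => -[[a b] im].
    by rewrite permK.
  by rewrite permKV.
by move=> u; apply/matrixP => a b; rewrite !mxE !cd_vec.
Qed.

Lemma mint_translate n p (M : 'M[R[i]]_(n, p)) (F : 'M[R[i]]_(n, p) -> \bar R) :
  mfun_mx F -> (forall X, 0 <= F X)%E ->
  mint F = mint (fun X => F (X + M)).
Proof.
move=> mF F0.
rewrite /mint (@leb_affine _ _ (fun=> 1) (cd (unmat M))) //.
rewrite big1 ?mul1e => [|i _]; last exact: normr1.
apply: eq_integral => u _; congr F; apply/matrixP => a b.
rewrite !mxE !cd_vec !mul1r.
by case: (M a b).
Qed.

End matrix_space.

Section linear_change_of_variables.
Variable R : realType.
Local Notation C := R[i].

(** [L] acts on each of the [p] columns, and a complex linear map has real Jacobian [|det L| ^ 2],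
    whence the exponent [2 * p]. Quantifying over all [p] and [F] makes the property stable under
    products, so that it can be proved on elementary factors. *)
Definition rows_cov n (L : 'M[C]_n) := forall p (F : 'M[C]_(n, p) -> \bar R),
  mfun_mx F -> (forall X, 0 <= F X)%E ->
  mint F = ((absdet L ^+ (2 * p))%:E * mint (fun X => F (L *m X)%R))%E.

Lemma mfun_mulmxl n m p (L : 'M[C]_(m, n)) (F : 'M[C]_(m, p) -> \bar R) :
  mfun_mx F -> mfun_mx (fun X => F (L *m X)).
Proof.
move=> mF; apply: (measurable_mfun_mx mF).
by apply: mmeasM; [exact: mmeas_cst|exact: mmeas_mat].
Qed.

Lemma absdetX_ge0 n (L : 'M[C]_n) k : (0 <= (absdet L ^+ k)%:E)%E.
Proof. by rewrite lee_fin exprn_ge0 // absdet_ge0. Qed.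

Lemma rows_covM n (L M : 'M[C]_n) : rows_cov L -> rows_cov M ->
  rows_cov (L *m M).
Proof.
move=> PL PM p F mF F0; rewrite PL // PM //; last exact: mfun_mulmxl.
rewrite muleA -EFinM absdetM exprMn; congr (_ * _)%E.
by apply: eq_mint => X; rewrite mulmxA.
Qed.

Lemma rows_cov_perm n (s : 'S_n) : rows_cov (perm_mx s : 'M[C]_n).
Proof.
move=> p F mF F0; rewrite (mint_perm s) //.
rewrite absdetE det_perm cabsX /cabs normrN1 /= !expr1n mul1e.
by apply: eq_mint => X; rewrite row_permE.
Qed.

Lemma mmeas_pair_col n1 n2 p :
  mmeas (fun z : cspace R (mcoord n1 p) * cspace R (mcoord n2 p) =>
    col_mx (mat z.1) (mat z.2)).
Proof. by apply: mmeas_col; [exact: mmeas_fst|exact: mmeas_snd]. Qed.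

Lemma mint_shear n p (M : 'M[C]_(n, p)) (F : 'M[C]_(n, p) -> \bar R) (L : 'M[C]_n) :
  rows_cov L -> mfun_mx F -> (forall Y, 0 <= F Y)%E ->
  (mint F = (absdet L ^+ (2 * p))%:E * mint (fun Y => F (L *m Y + M)%R))%E.
Proof.
move=> PL mF F0; rewrite [LHS](mint_translate M) // PL //.
apply: (measurable_mfun_mx mF).
by apply: mmeasD; [exact: mmeas_mat|exact: mmeas_cst].
Qed.

Lemma mint_col_mx_swap n1 n2 p (F : 'M[C]_(n1 + n2, p) -> \bar R) :
  mfun_mx F -> (forall X, 0 <= F X)%E ->
  mint F = mint (fun Y : 'M[C]_(n2, p) => mint (fun X : 'M[C]_(n1, p) => F (col_mx X Y))).
Proof.
move=> mF F0; rewrite mint_col_mx //; apply: mint_swap => //.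
by apply: (measurable_mfun_mx mF); exact: mmeas_pair_col.
Qed.

(** For a fixed upper block [X] the lower one undergoes the affine map [Y -> D Y + B X]; the shift
    costs nothing, and Tonelli separates the factors of [A] and [D]. *)
Lemma rows_cov_lblock n1 n2 (A : 'M[C]_n1) (B : 'M[C]_(n2, n1)) (D : 'M[C]_n2) :
  rows_cov A -> rows_cov D -> rows_cov (block_mx A 0 B D).
Proof.
move=> PA PD p F mF F0.
have mF1 : mfun_mx (fun X : 'M[C]_(n1, p) =>
    mint (fun Y : 'M[C]_(n2, p) => F (col_mx X Y))).
  apply: mfun_mint => //.
  by apply: (measurable_mfun_mx mF); exact: mmeas_pair_col.
have mF2 (X : 'M[C]_(n1, p)) : mfun_mx (fun Y : 'M[C]_(n2, p) => F (col_mx X Y)).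
  by apply: (measurable_mfun_mx mF); apply: mmeas_col; [exact: mmeas_cst|exact: mmeas_mat].
rewrite mint_col_mx // PA //; last by move=> X; exact: mint_ge0.
rewrite [absdet (block_mx _ _ _ _)]absdetE det_lblock cabsM -!absdetE exprMn EFinM -muleA; congr (_ * _)%E.
rewrite [in RHS]mint_col_mx //; last exact: mfun_mulmxl.
rewrite -mintZl ?absdetX_ge0 //; last 2 first.
- apply: (mfun_mint (F := fun X Y => F (block_mx A 0 B D *m col_mx X Y))) => //.
  apply: (measurable_mfun_mx mF); apply: mmeasM; first exact: mmeas_cst.
  exact: mmeas_pair_col.
- by move=> X; exact: mint_ge0.
apply: eq_mint => X; rewrite (mint_shear (B *m X) PD) //.
congr (_ * _)%E; apply: eq_mint => Y.
by rewrite mul_block_col mul0mx addr0 addrC.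
Qed.

(** Here the upper block is the one that is shifted, by [B Y], so the lower block has to be the
    outer variable. *)
Lemma rows_cov_ublock n1 n2 (A : 'M[C]_n1) (B : 'M[C]_(n1, n2)) (D : 'M[C]_n2) :
  rows_cov A -> rows_cov D -> rows_cov (block_mx A B 0 D).
Proof.
move=> PA PD p F mF F0.
have m_swap (X : 'M[C]_(n1 + n2, n1 + n2)) : measurable_fun
    [set: cspace R (mcoord n2 p) * cspace R (mcoord n1 p)]
    (fun z => F (X *m col_mx (mat z.2) (mat z.1))).
  apply: (measurable_mfun_mx mF); apply: mmeasM; first exact: mmeas_cst.
  by apply: mmeas_col; [exact: mmeas_snd|exact: mmeas_fst].
have mF1 : mfun_mx (fun Y : 'M[C]_(n2, p) =>
    mint (fun X : 'M[C]_(n1, p) => F (col_mx X Y))).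
  apply: mfun_mint => //.
  by have := m_swap 1%:M; under eq_fun do rewrite mul1mx.
have mF2 (Y : 'M[C]_(n2, p)) : mfun_mx (fun X : 'M[C]_(n1, p) => F (col_mx X Y)).
  by apply: (measurable_mfun_mx mF); apply: mmeas_col; [exact: mmeas_mat|exact: mmeas_cst].
rewrite mint_col_mx_swap // PD //; last by move=> X; exact: mint_ge0.
rewrite [absdet (block_mx _ _ _ _)]absdetE det_ublock mulrC cabsM -!absdetE exprMn EFinM -muleA; congr (_ * _)%E.
rewrite [in RHS]mint_col_mx_swap //; last exact: mfun_mulmxl.
rewrite -mintZl ?absdetX_ge0 //; last 2 first.
- exact: (mfun_mint (F := fun Y X => F (block_mx A B 0 D *m col_mx X Y))).
- by move=> X; exact: mint_ge0.
apply: eq_mint => Y; rewrite (mint_shear (B *m Y) PA) //.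
congr (_ * _)%E; apply: eq_mint => X.
by rewrite mul_block_col mul0mx add0r.
Qed.

Lemma rows_cov1 n : rows_cov (1%:M : 'M[C]_n).
Proof.
move=> p F mF F0; rewrite absdet1 expr1n mul1e.
by apply: eq_mint => X; rewrite mul1mx.
Qed.

Section complex_scaling.
Variables (n p : nat).
Local Notation I := ('I_n * 'I_p)%type.
Implicit Types u v : cspace R I.

Let reim u v : 'M[C]_(n, p) := \matrix_(a, b) (cd u (a, b) +i* cd v (a, b)).

Let reim_split (c : mcoord n p) : I + I :=
  let: (a, b, im) := c in if im then inr (a, b) else inl (a, b).

Lemma reim_split_bij : bijective reim_split.
Proof.
exists (fun s => match s with inl i => (i, false) | inr i => (i, true) end).
  by move=> [[a b] []].
by move=> [] [a b].
Qed.

Let mint_reim F : mfun_mx F -> (forall X, 0 <= F X)%E ->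
  (mint F = \int[leb R I]_u \int[leb R I]_v F (reim u v))%E.
Proof.
move=> mF F0; rewrite /mint (leb_join_iter reim_split_bij) //.
apply: eq_integral => u _; apply: eq_integral => v _; congr F.
by apply/matrixP => a b; rewrite !mxE /join_cd !cd_vec.
Qed.

(** With [c = a + i b], multiplication sends [(x, y)] to [(a x - b y, b x + a y)]. Writing
    [x' = a x - b y], the second entry is [k y + (b / a) x'] with [k = (a ^ 2 + b ^ 2) / a]. The map
    is thus a succession of two affine maps in one variable each, with factors [a] and [k] whose
    product is [|c| ^ 2]; the division explains the condition on the real part. *)
Lemma rows_cov_scalar_Re (c : C) (F : 'M[C]_(n, p) -> \bar R) :
  complex.Re c != 0 -> mfun_mx F -> (forall X, 0 <= F X)%E ->
  mint F = ((absdet (c%:M : 'M[C]_n) ^+ (2 * p))%:E *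
    mint (fun X => F (c%:M *m X)%R))%E.
Proof.
case: c => a b /= a0 mF F0.
have cardI (r : R) : r ^+ #|{: I}| = r ^+ (n * p) by rewrite card_prod !card_ord.
pose k := (a ^+ 2 + b ^+ 2) / a.
have k0 : k != 0.
  rewrite mulf_neq0 ?invr_neq0 // gt_eqF // ltr_wpDr ?sqr_ge0 //.
  by rewrite lt_neqAle eq_sym sqrf_eq0 a0 sqr_ge0.
pose G u v := vec (fun i => k * cd v i + b / a * cd u i).
have mreim d (T : measurableType d) (f g : T -> cspace R I) :
    measurable_fun setT f -> measurable_fun setT g ->
    measurable_fun setT (fun x => F (reim (f x) (g x))).
  move=> mf mg; apply: (measurable_mfun_mx mF) => i j.
  under eq_fun do rewrite mxE.
  by apply: cmeas_pair; apply: (measurableT_comp (@measurable_cd R _ _)).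
have mlin d (T : measurableType d) (f g : T -> cspace R I) (x y : R) :
    measurable_fun setT f -> measurable_fun setT g ->
    measurable_fun setT (fun t => vec (fun i => x * cd (f t) i + y * cd (g t) i)).
  move=> mf mg; apply: measurable_fun_vec => i.
  by apply: measurable_funD; apply: measurable_funM => //;
    apply: (measurableT_comp (@measurable_cd R _ _)).
have mG : measurable_fun [set: cspace R I * cspace R I]
    (fun z => F (reim z.1 (G z.1 z.2))).
  by apply: (mreim) => //; exact: mlin.
rewrite mint_reim //.
transitivity ((`|k| ^+ (n * p))%:E *
   \int[leb R I]_u \int[leb R I]_v F (reim u (G u v)))%E.
  rewrite -ge0_integralZl //; last 2 first.
  - exact: (measurable_fun_fubini_tonelli_F (m2 := leb R I) _ mG (fun z => F0 _)).
  - by move=> u _; apply: integral_ge0.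
  apply: eq_integral => u _.
  rewrite [LHS](@leb_affine _ _ (fun=> k) (fun i => b / a * cd u i)) //; last first.
    by apply: (mreim) => //; exact: measurable_cst.
  by rewrite prodr_const cardI.
rewrite (fubini_tonelli (m1 := leb R I) (m2 := leb R I) _ mG (fun z => F0 _)).
pose H u v := vec (fun i => a * cd u i + - b * cd v i).
have mH : measurable_fun [set: cspace R I * cspace R I]
    (fun z => F (reim (H z.2 z.1) (G (H z.2 z.1) z.1))).
  by apply: (mreim); [exact: mlin|apply: (mlin) => //; exact: mlin].
transitivity ((`|k| ^+ (n * p))%:E * ((`|a| ^+ (n * p))%:E *
   \int[leb R I]_v \int[leb R I]_u F (reim (H u v) (G (H u v) v))))%E.
  congr (_ * _)%E; rewrite -ge0_integralZl //; last 2 first.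
  - exact: (measurable_fun_fubini_tonelli_F (m2 := leb R I) _ mH (fun z => F0 _)).
  - by move=> u _; apply: integral_ge0.
  apply: eq_integral => v _ /=.
  rewrite [LHS](@leb_affine _ _ (fun=> a) (fun i => - b * cd v i)) //; last first.
    by apply: (mreim) => //; apply: (mlin) => //; exact: measurable_cst.
  by rewrite prodr_const cardI.
rewrite muleA -EFinM; congr (_%:E * _)%E.
  rewrite -exprMn -normrM absdetE det_scalar cabsX -exprM mulnCA [RHS]exprM.
  by rewrite cabs_sqr /= divfK // ger0_norm // addr_ge0 ?sqr_ge0.
rewrite [RHS]mint_reim //; last exact: mfun_mulmxl.
have mcF : measurable_fun [set: cspace R I * cspace R I]
    (fun z => F ((a +i* b)%:M *m reim z.1 z.2)).
  apply: (measurable_mfun_mx (mfun_mulmxl _ mF)) => i j.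
  under eq_fun do rewrite mxE.
  by apply: cmeas_pair; apply: (measurableT_comp (@measurable_cd R _ _)).
rewrite [RHS](fubini_tonelli (m1 := leb R I) (m2 := leb R I) _ mcF (fun z => F0 _)).
apply: eq_integral => v _; apply: eq_integral => u _; congr F.
apply/matrixP => i j; rewrite mul_scalar_mx !mxE !cd_vec.
congr (_ +i* _); first by rewrite mulNr.
by rewrite /k; field.
Qed.

End complex_scaling.

Lemma rows_cov_scalar n (c : C) : c != 0 -> rows_cov (c%:M : 'M[C]_n).
Proof.
case: c => a b c0.
have [a0|a0] := eqVneq a 0; last by move=> p F; exact: rows_cov_scalar_Re.
have b0 : b != 0 by apply: contra_neq c0 => b0; rewrite a0 b0.
(* A purely imaginary [i b] equals [(1 + i) (b / 2 + i b / 2)], and both factors have nonzero real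
   part. *)
rewrite (_ : _%:M = ((1 +i* 1)%:M : 'M[C]_n) *m ((b / 2) +i* (b / 2))%:M); last first.
  rewrite -scalar_mxM; congr (_%:M); rewrite a0.
  by apply/eqP; rewrite eq_complex /= !mul1r subrr -splitr !eqxx.
apply: rows_covM => p F; apply: rows_cov_scalar_Re => /=; first exact: oner_neq0.
by rewrite mulf_neq0 // invr_neq0.
Qed.

(** Block Gaussian elimination: a row permutation brings a nonzero pivot to the corner; the matrix
    is then the product of a lower block triangular factor, carrying the Schur complement [S] of the
    pivot, and an upper one carrying the pivot itself. The induction hypothesis handles [S]. *)
Lemma rows_cov_unit n (L : 'M[C]_n) : L \in unitmx -> rows_cov L.
Proof.
elim: n L => [|n IH] L uL.
  by rewrite (flatmx0 L) -(flatmx0 1%:M); exact: rows_cov1.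
have [s sL] : exists s : 'S_n.+1, row_perm s L ord0 ord0 != 0.
  have [i Li] : exists i, L i ord0 != 0.
    apply/existsP; apply: contraTT uL; rewrite negb_exists => /forallP L0.
    rewrite unitmxE unitfE negbK (expand_det_col _ ord0) big1 // => i _.
    by have := L0 i; rewrite negbK => /eqP ->; rewrite mul0r.
  by exists (tperm ord0 i); rewrite mxE tpermL.
have -> : L = perm_mx (s^-1)%g *m row_perm s L.
  by rewrite -row_permE -row_permM mulVg row_perm1.
apply: rows_covM; first exact: rows_cov_perm.
have uM : row_perm s L \in unitmx by rewrite row_permE unitmx_mul unitmx_perm.
move: (row_perm s L) sL uM => M; rewrite -[n.+1]/(1 + n)%N in M *.
have {1}-> : ord0 = lshift n (0 : 'I_1) by apply: val_inj.
have -> : ord0 = lshift n (0 : 'I_1) by apply: val_inj.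
rewrite -(submxK M) block_mxEul; set a := ulsubmx M; set b := ursubmx M.
set c := dlsubmx M; set d := drsubmx M => M00 uM.
have Ea : a = (a 0 0)%:M by rewrite -mx11_scalar.
set S := d - (a 0 0)^-1 *: c *m b.
have E : block_mx a b c d = block_mx 1%:M 0 ((a 0 0)^-1 *: c) S *m block_mx a b 0 1%:M.
  rewrite mulmx_block !mul1mx !mul0mx !mulmx0 !mulmx1 !addr0.
  rewrite /S addrC subrK; congr block_mx.
  by rewrite {2}Ea mul_mx_scalar scalerA mulfV // scale1r.
have uS : S \in unitmx.
  move: uM; rewrite E unitmx_mul => /andP[+ _].
  by rewrite !unitmxE det_lblock det1 mul1r.
rewrite E; apply: rows_covM.
  by apply: rows_cov_lblock; [exact: rows_cov1|exact: IH].
by apply: rows_cov_ublock; [rewrite Ea; exact: rows_cov_scalar|exact: rows_cov1].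
Qed.

Lemma mint_mulmxl n p (L : 'M[C]_n) (F : 'M[C]_(n, p) -> \bar R) :
  L \in unitmx -> mfun_mx F -> (forall X, 0 <= F X)%E ->
  mint F = ((absdet L ^+ (2 * p))%:E * mint (fun X => F (L *m X)%R))%E.
Proof. by move=> uL; exact: rows_cov_unit. Qed.

Lemma mint_mulmxr n p (A : 'M[C]_p) (F : 'M[C]_(n, p) -> \bar R) :
  A \in unitmx -> mfun_mx F -> (forall X, 0 <= F X)%E ->
  mint F = ((absdet A ^+ (2 * n))%:E * mint (fun X => F (X *m A)%R))%E.
Proof.
move=> uA mF F0.
have mT (M : 'M[C]_p) : mfun_mx (fun X => F ((M *m X)^T)).
  apply: (measurable_mfun_mx mF); apply: mmeas_tr.
  by apply: mmeasM; [exact: mmeas_cst|exact: mmeas_mat].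
rewrite [in LHS]mint_tr // (mint_mulmxl (L := A^T)) ?unitmx_tr //; last first.
  by have := mT 1%:M; rewrite /mfun_mx; under eq_fun do rewrite mul1mx.
rewrite absdet_tr; congr (_ * _)%E; rewrite [RHS]mint_tr //.
  by apply: eq_mint => X; rewrite trmx_mul trmxK.
apply: (measurable_mfun_mx mF).
by apply: mmeasM; [exact: mmeas_mat|exact: mmeas_cst].
Qed.

End linear_change_of_variables.

(** * The law of the Frobenius norm *)

Section density.
Context d (T : measurableType d) (R : realType).
Variables (mu : {sigma_finite_measure set T -> \bar R}) (g : T -> R).

(* The measure with density [g] is the image, under the first projection, of
   the restriction of the product measure to the region below the graph. *)
Lemma density_measure : measurable_fun [set: T] g -> (forall x, 0 <= g x) ->
  exists nu : {measure set T -> \bar R},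
    forall F : T -> \bar R, measurable_fun [set: T] F -> (forall x, 0 <= F x)%E ->
      (\int[nu]_x F x = \int[mu]_x (F x * (g x)%:E))%E.
Proof.
move=> mg g0.
pose S : set (T * measurableTypeR R) := [set z | 0 < z.2 <= g z.1].
have mS : measurable S.
  rewrite (_ : S = [set z | (0 : R) < z.2] `&` [set z | (z.2 : R) <= g z.1]).
    have m1 : measurable_fun [set: T * measurableTypeR R] (fun z => (0 : R) < z.2).
      by apply: measurable_fun_ltr.
    have m2 : measurable_fun [set: T * measurableTypeR R] (fun z => (z.2 : R) <= g z.1).
      by apply: measurable_fun_ler => //; exact: measurableT_comp.
    apply: measurableI.
      by rewrite -[X in measurable X]setTI; exact: (m1 measurableT [set true]).
    by rewrite -[X in measurable X]setTI; exact: (m2 measurableT [set true]).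
  by apply/seteqP; split => z /= => [/andP[]//|[z1 z2]]; apply/andP.
pose m := (mu \x @lebesgue_measure R)%E.
pose r := mrestr m mS.
pose nu : {measure set T -> \bar R} :=
  measure_function_pushforward__canonical__measure_function_Measure r
    (@measurable_fst _ _ T (measurableTypeR R)).
exists nu => F mF F0.
have mF1 : measurable_fun [set: T * measurableTypeR R] (fun z => F z.1).
  exact: measurableT_comp.
rewrite [LHS](ge0_integral_pushforward (phi := fst)) //= preimage_setT.
have -> : (\int[r]_z (F \o fst) z = \int[r]_(z in S) (F z.1))%E.
  rewrite -(setUv S) ge0_integral_setU //=; last 3 first.
  - exact: measurableC.
  - by rewrite setUv.
  - exact/disj_setPCl.
  rewrite [X in (_ + X)%E](eq_measure_integral mzero); last first.
    move=> A mA AS; rewrite /= /r /mrestr /mzero (_ : A `&` S = set0) ?measure0 //.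
    by apply/seteqP; split => // z [/AS].
  by rewrite integral_measure_zero adde0.
rewrite (eq_measure_integral m); last first.
  by move=> A mA AS; rewrite /= /r /mrestr setIidl.
rewrite integral_mkcond /m fubini_tonelli1 //; last 2 first.
- have [H _] := measurable_restrictT (fun z : T * measurableTypeR R => F z.1) mS; apply: H; exact: (measurable_funS measurableT (@subsetT _ _) mF1). 
- by move=> z; exact: erestrict_ge0.
apply: eq_integral => x _; rewrite /fubini_F.
transitivity (\int[lebesgue_measure]_(y in `]0%R, g x]) F x)%E.
  rewrite [RHS]integral_mkcond; apply: eq_integral => y _; rewrite !patchE.
  have -> // : ((x, y) \in S) = ((y : R) \in [set` `]0%R, g x]]).
  by apply/idP/idP => [/set_mem H|/set_mem H]; apply/mem_set; move: H; rewrite /= in_itv.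
rewrite integral_cst //; congr (_ * _)%E.
apply: (etrans (lebesgue_measure_itv `]0%R, g x])); rewrite /= lte_fin.
case: ifPn => [gx|]; first by rewrite sube0.
by rewrite -leNgt => gx; have /eqP -> : g x == 0 by rewrite eq_le gx g0.
Qed.

End density.

Lemma measurable_expR_comp d (T : measurableType d) (R : realType) (f : T -> R) :
  measurable_fun [set: T] f -> measurable_fun [set: T] (fun x => expR (f x)).
Proof. by move=> mf; apply: (measurableT_comp (@measurable_expR R)). Qed.

Section frobenius.
Variable R : realType.
Local Notation C := R[i].

(** The square of the Frobenius norm: this is the form that equals the trace of [X^t* *m X] and adds
    up over juxtaposed blocks. *)
Definition frob n p (X : 'M[C]_(n, p)) : R := \sum_a \sum_b cabs (X a b) ^+ 2.

Lemma frob_ge0 n p (X : 'M[C]_(n, p)) : 0 <= frob X.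
Proof. by apply: sumr_ge0 => a _; apply: sumr_ge0 => b _; exact: sqr_ge0. Qed.

Lemma frob_mat n p (u : cspace R (mcoord n p)) :
  frob (mat u) = \sum_c cd u c ^+ 2.
Proof.
rewrite /frob pair_big /=.
transitivity (\sum_(ab : 'I_n * 'I_p) \sum_im cd u (ab, im) ^+ 2).
  by apply: eq_bigr => -[a b] _; rewrite mxE cabs_sqr /= big_bool addrC.
by rewrite pair_big /=; apply: eq_bigr => -[].
Qed.

Lemma measurable_frob d (T : measurableType d) n p (X : T -> 'M[C]_(n, p)) :
  mmeas X -> measurable_fun [set: T] (fun x => frob (X x)).
Proof.
move=> mX; apply: measurable_sum => a; apply: measurable_sum => b.
by apply: measurable_funX; exact: measurable_cabs.
Qed.

Lemma measurable_mfrob n p : measurable_fun [set: cspace R (mcoord n p)]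
  (fun u => frob (mat u)).
Proof. by apply: measurable_frob; exact: mmeas_mat. Qed.

Lemma gauss_tuple m :
  (\int[lebesgue_tuple R m]_u (expR (- \sum_i tnth u i ^+ 2))%:E =
   (Num.sqrt pi ^+ m)%:E)%E.
Proof.
elim: m => [|m IH].
  transitivity (\int[@dirac _ (0.-tuple (measurableTypeR R)) [tuple] R]_u (cst 1%E u))%E.
    by apply: eq_integral => u _; rewrite big_ord0 oppr0 expR0.
  by rewrite integral_dirac //= diracE in_setT mul1e expr0.
have ms k : measurable_fun [set: k.-tuple (measurableTypeR R)]
    (fun u => (expR (- \sum_i tnth u i ^+ 2))%:E).
  apply/measurable_EFinP; apply: measurable_expR_comp.
  apply: measurable_funN; apply: measurable_sum => i.
  by apply: measurable_funX; exact: measurable_tnth.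
have -> : (\int[lebesgue_tuple R m.+1]_u (expR (- \sum_i tnth u i ^+ 2))%:E =
  \int[lebesgue_measure \x lebesgue_tuple R m]_z
    ((gauss_fun z.1)%:E * (expR (- \sum_i tnth z.2 i ^+ 2))%:E))%E.
  rewrite [LHS](ge0_integral_pushforward (phi := @tuple_cons _ _ m)) //=; last 2 first.
  - exact: measurable_tuple_cons.
  - exact: ms.
  rewrite preimage_setT; apply: eq_integral => -[x v] _ /=.
  rewrite -EFinM /gauss_fun -expRD big_ord_recl opprD; congr (expR (_ - _))%:E.
  by apply: eq_bigr => i _; rewrite tnthS.
have mg : measurable_fun [set: measurableTypeR R] (fun x => (gauss_fun x)%:E).
  by apply/measurable_EFinP; exact: measurable_gauss_fun.
rewrite fubini_tonelli1; last 2 first.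
- apply: emeasurable_funM; first exact: (measurableT_comp mg).
  exact: (measurableT_comp (ms m)).
- by move=> z; rewrite -EFinM lee_fin mulr_ge0 ?expR_ge0.
transitivity (\int[lebesgue_measure]_x
   ((gauss_fun x)%:E * (Num.sqrt (pi : R) ^+ m)%:E))%E.
  apply: eq_integral => x _; rewrite /fubini_F /= ge0_integralZl //.
  - by rewrite IH.
  - exact: ms.
  - by rewrite lee_fin expR_ge0.
rewrite ge0_integralZr //.
  by rewrite integralT_gauss exprS EFinM.
by move=> x _; rewrite lee_fin gauss_fun_ge0.
Qed.

Lemma expr_card_mcoord n p (x : R) :
  x ^+ #|{: mcoord n p}| = (x ^+ 2) ^+ (n * p).
Proof. by rewrite !card_prod !card_ord card_bool mulnC exprM. Qed.

Lemma mint_gauss n p :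
  mint (fun X : 'M[C]_(n, p) => (expR (- frob X))%:E) = (pi ^+ (n * p))%:E.
Proof.
rewrite /mint; under eq_integral do rewrite frob_mat.
rewrite -[in RHS](@sqr_sqrtr _ (pi : R)) ?pi_ge0 // -expr_card_mcoord -gauss_tuple.
apply: eq_integral => u _; congr (expR (- _))%:E.
rewrite (reindex (@enum_val _ {: mcoord n p})) /=; last first.
  by exists enum_rank => x _; rewrite ?enum_valK ?enum_rankK.
by apply: eq_bigr => i _; rewrite /cd enum_valK.
Qed.

Let mfrob_lt n p (r : R) : measurable [set u : cspace R (mcoord n p) | frob (mat u) < r].
Proof.
have m1 : measurable_fun [set: cspace R (mcoord n p)] (fun u => frob (mat u) < r).
  by apply: measurable_fun_ltr => //; exact: measurable_mfrob.
by rewrite -[X in measurable X]setTI; exact: (m1 measurableT [set true]).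
Qed.

(** As [frob] is quadratic, the ball is the unit ball scaled by [sqrt r] in each of [2 * n * p] real
    coordinates. *)
Lemma leb_frob_ball n p (r : R) : 0 < r ->
  leb R (mcoord n p) [set u | frob (mat u) < r] =
  ((r ^+ (n * p))%:E * leb R (mcoord n p) [set u | (frob (mat u) < 1)%R])%E.
Proof.
move=> r0.
have sr0 : Num.sqrt r != 0 by rewrite sqrtr_eq0 -ltNge.
pose mu := leb R (mcoord n p).
have muE (S : set (cspace R (mcoord n p))) : measurable S ->
    mu S = (\int[mu]_u (\1_S u)%:E)%E.
  by move=> mS; rewrite integral_indic // setIT.
have mindic (S : set (cspace R (mcoord n p))) : measurable S ->
    measurable_fun [set: cspace R (mcoord n p)] (fun u => (\1_S u : R)%:E).
  by move=> mS; apply/measurable_EFinP; exact: measurable_indic.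
rewrite [LHS](muE _ (mfrob_lt _)) [X in (_ * X)%E](muE _ (mfrob_lt _)).
rewrite [LHS](@leb_affine _ _ (fun=> Num.sqrt r) (fun=> 0)) //; last first.
  exact: mindic.
rewrite prodr_const expr_card_mcoord ger0_norm ?sqrtr_ge0 // sqr_sqrtr ?(ltW r0) //.
congr (_ * _)%E; apply: eq_integral => u _; rewrite !indicE; congr (_%:R%:E).
have fr : frob (mat (vec (fun i => Num.sqrt r * cd u i + 0) : cspace R (mcoord n p))) =
    r * frob (mat u).
  rewrite !frob_mat mulr_sumr; apply: eq_bigr => i _.
  by rewrite cd_vec addr0 exprMn sqr_sqrtr ?(ltW r0).
by congr nat_of_bool; apply/idP/idP => /set_mem /= H; apply/mem_set; move: H;
  rewrite /= fr gtr_pMr.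
Qed.

Lemma leb_frob_ball_fin n p :
  (leb R (mcoord n p) [set u | (frob (mat u) < 1)%R] < +oo)%E.
Proof.
pose B : set (measurableTypeR R) := `[-1, 1]%classic.
have h1 : measurable B by exact: measurable_itv.
apply: (@le_lt_trans _ _ (leb R (mcoord n p) (cbox (fun=> B)))).
  apply: le_measure; [apply: mem_set; exact: mfrob_lt|apply: mem_set; exact: measurable_cbox|].
  move=> u /=; rewrite frob_mat => u1 c /=; rewrite /B /= in_itv /= -ler_norml.
  rewrite -(@ler_pXn2r _ 2) ?nnegrE // expr1n real_normK ?num_real //.
  apply: le_trans (ltW u1); rewrite (bigD1 c) //= lerDl.
  by apply: sumr_ge0 => i _; exact: sqr_ge0.
rewrite [X in (X < _)%E](_ : _ = \prod_(c : mcoord n p) lebesgue_measure B)%E; last first.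
  by apply: leb_cbox => i.
rewrite (eq_bigr (fun=> 2%:E)) => [|i _].
  by rewrite prodEFin ltry.
apply: (etrans (lebesgue_measure_itv `[-1, 1])).
rewrite /= lte_fin ifT; first by rewrite -EFinB opprK.
by rewrite gtrN.
Qed.

End frobenius.

Lemma measurable_patch d (T : measurableType d) (R : realType) (D : set T)
    (f : T -> \bar R) :
  measurable D -> measurable_fun [set: T] f -> measurable_fun [set: T] (f \_ D).
Proof.
move=> mD mf; have [H _] := measurable_restrictT f mD; apply: H.
exact: (measurable_funS measurableT (@subsetT _ _) mf).
Qed.

(** * The distribution of the squared norm *)

Section radial.
Variable R : realType.
Local Notation C := R[i].

Lemma lt_measure_unique (m1 m2 : {measure set (measurableTypeR R) -> \bar R}) :
  (forall x : R, m1 `]-oo, x[%classic = m2 `]-oo, x[%classic) ->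
  (forall x : R, (m1 `]-oo, x[%classic < +oo)%E) ->
  forall A, measurable A -> m1 A = m2 A.
Proof.
move=> m12 m1oo.
apply: (@measure_unique _ _ (measurableTypeR R) (@RGenInftyO.G R)
  (fun n => `]-oo, n%:R[%classic)) => //.
- exact: RGenInftyO.measurableE.
- move=> _ _ [x ->] [y ->]; exists (Num.min x y).
  by apply/seteqP; split => z /=; rewrite !in_itv /= lt_min => /andP.
- by move=> n; exists n%:R.
- apply/seteqP; split => // x _; exists (Num.truncn `|x|).+1 => //=.
  by rewrite in_itv /=; apply: le_lt_trans (ler_norm x) _; exact: Num.Theory.truncnS_gt.
- by move=> _ [x ->].
Qed.

Lemma integral_power (n : nat) (x : R) : 0 <= x ->
  (\int[lebesgue_measure]_(t in `[0%R, x]) (n.+1%:R * t ^+ n)%:E = (x ^+ n.+1)%:E)%E.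
Proof.
rewrite le_eqVlt => /predU1P[<-|x0]; first by rewrite set_itv1 integral_set1 expr0n.
have dX (t : R) : is_derive t (1 : R) (fun t => t ^+ n.+1) (n.+1%:R * t ^+ n).
  have := @is_deriveX R R id n.+1 t 1 1 (is_derive_id _ _).
  rewrite /GRing.scale /= mulr1 (_ : id ^+ n.+1 = fun t : R => t ^+ n.+1) //.
  by apply/funext => s; elim: (n.+1) => [|m IH]; rewrite ?expr0 // !exprS -IH.
have cX : continuous (fun t : R => t ^+ n.+1) by exact: exprn_continuous.
rewrite (@continuous_FTC2 _ _ (fun t => t ^+ n.+1)) //.
- by rewrite expr0n sube0.
- apply: continuous_subspaceT => t.
  by apply: cvgM; [exact: cvg_cst|exact: exprn_continuous].
- split => [t _|//|//].
  + exact: ex_derive.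
  + by apply: cvg_at_right_filter; exact: cX.
  + by apply: cvg_at_left_filter; exact: cX.
- by move=> t _; rewrite derive1E derive_val.
Qed.

(* The law of [frob] is found by scaling: the ball [frob X < r] has volume
   [r ^+ d] times that of the unit ball, where [2 * d] is the real dimension. *)
Lemma mint_frob_density n p : (0 < n * p)%N -> exists2 v : R, 0 <= v &
  forall F : R -> \bar R, measurable_fun [set: R] F -> (forall t, 0 <= F t)%E ->
  (mint (fun X : 'M[C]_(n, p) => F (frob X)) =
   v%:E * \int[lebesgue_measure]_(t in `]0%R, +oo[) (F t * (t ^+ (n * p).-1)%:E))%E.
Proof.
move=> np0.
have := prednK np0; set k := (n * p).-1 => kE.
pose V := fine (leb R (mcoord n p) [set u | frob (mat u) < 1]).
have VE : leb R (mcoord n p) [set u | frob (mat u) < 1] = V%:E.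
  by rewrite fineK // ge0_fin_numE //; exact: leb_frob_ball_fin.
have V0 : 0 <= V by apply: fine_ge0.
(* The derivative of the ball volume [V * t ^ k.+1], where [k.+1 = n * p]. The measure with this
   density and the image of Lebesgue measure under [frob] are compared on half-lines. *)
pose g (t : R) : R := if 0 < t then (V * k.+1%:R) * t ^+ k else 0.
have g0 t : 0 <= g t.
  by rewrite /g; case: ifPn => // t0; rewrite !mulr_ge0 // exprn_ge0 // ltW.
have mg : measurable_fun [set: measurableTypeR R] g.
  apply: measurable_fun_ifT => //.
    exact: measurable_fun_ltr.
  by apply: measurable_funM => //; exact: measurable_funX.
have [nu nuE] := density_measure (@lebesgue_measure R) mg g0.
have mfr : measurable_fun [set: cspace R (mcoord n p)]
  (fun u => frob (mat u) : measurableTypeR R) by exact: measurable_mfrob.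
pose m1 : {measure set (measurableTypeR R) -> \bar R} :=
  measure_function_pushforward__canonical__measure_function_Measure
    (leb R (mcoord n p)) mfr.
have m1E (x : R) : m1 `]-oo, x[%classic = (if 0 < x then (x ^+ k.+1 * V)%:E else 0%E).
  rewrite [LHS](_ : _ = leb R (mcoord n p) [set u | frob (mat u) < x]); last first.
    by congr (leb R _ _); apply/seteqP; split => u /=; rewrite in_itv.
  case: ifPn => x0; first by rewrite leb_frob_ball // kE VE EFinM.
  rewrite (_ : [set u | _] = set0) ?measure0 //.
  apply/seteqP; split => // u /=; rewrite ltNge; apply: contraNP => _.
  by apply: le_trans (frob_ge0 _); rewrite leNgt.
have m1nu A : measurable A -> m1 A = nu A.
  apply: lt_measure_unique => x; last by rewrite m1E; case: ifPn => _; rewrite ltry.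
  have mI : measurable (`]-oo, x[%classic : set (measurableTypeR R)) by exact: measurable_itv.
  rewrite m1E -[RHS]mul1e -integral_cst // integral_mkcond nuE; last 2 first.
  - exact: measurable_patch.
  - by move=> y; apply: erestrict_ge0.
  case: ifPn => [x0|]; last first.
    rewrite -leNgt => x0; rewrite [RHS]integral0_eq // => t _.
    rewrite /g patchE; case: ifPn; last by rewrite mul0e.
    move=> /set_mem /=; rewrite in_itv /= => tx.
    by rewrite ltNge (ltW (lt_le_trans tx x0)) /= mule0.
  rewrite mulrC EFinM -(integral_power k (ltW x0)) -ge0_integralZl //=; last 2 first.
  - by apply/measurable_EFinP; apply: measurable_funTS; apply: measurable_funM => //;
      exact: measurable_funX.
  - move=> t; rewrite in_itv /= => /andP[t0 _].
    by rewrite lee_fin mulr_ge0 // exprn_ge0.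
  have mVk (D : set (measurableTypeR R)) :
      measurable_fun D (fun t : R => (V%:E * (k.+1%:R * t ^+ k)%:E)%E).
    apply: measurable_funTS; apply/measurable_EFinP.
    by do 2 apply: measurable_funM => //; exact: measurable_funX.
  rewrite -integral_itv_obnd_cbnd; last exact: mVk.
  rewrite -integral_itv_bndo_bndc; last exact: mVk.
  rewrite integral_mkcond; apply: eq_integral => t _.
  rewrite !patchE /g; have [t0|t0] := ltP 0 t; last first.
    by rewrite mule0 memNset //= in_itv /= ltNge t0.
  have [tx|tx] := ltP t x; last first.
    by rewrite !memNset ?mul0e //= in_itv /= [t < x]ltNge tx ?andbF.
  by rewrite !mem_set /= ?in_itv /= ?t0 ?tx // mul1e -EFinM mulrA.
exists (V * k.+1%:R) => [|F mF F0]; first by rewrite mulr_ge0.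
transitivity (\int[nu]_t F t)%E.
  transitivity (\int[m1]_t F t)%E; last first.
    by apply: eq_measure_integral => A mA _; exact: m1nu.
  by rewrite [RHS](ge0_integral_pushforward (phi := fun u => frob (mat u) : measurableTypeR R)).
rewrite nuE // -ge0_integralZl //; last 3 first.
- apply: emeasurable_funM; first exact: measurable_funTS.
  by apply: measurable_funTS; apply/measurable_EFinP; exact: measurable_funX.
- move=> t; rewrite /= in_itv /= andbT => t0.
  by rewrite mule_ge0 // lee_fin exprn_ge0 // ltW.
- by rewrite lee_fin mulr_ge0.
rewrite [RHS]integral_mkcond; apply: eq_integral => t _; rewrite patchE /g.
have [t0|t0] := ltP 0 t; last by rewrite mule0 memNset //= in_itv /= andbT ltNge t0.
by rewrite mem_set /= ?in_itv /= ?t0 // EFinM muleCA.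
Qed.

End radial.

(** * Integrals of complex functions *)

Section real_transfer.
Context d1 d2 d3 (T : measurableType d1) (U : measurableType d2)
  (V : measurableType d3) (R : realType).
Variables (mu : {measure set T -> \bar R}) (nu : {measure set U -> \bar R}).
Variables (phi : T -> V) (psi : U -> V) (w : T -> R) (v : U -> R).
Hypotheses (mphi : measurable_fun [set: T] phi) (mpsi : measurable_fun [set: U] psi).
Hypotheses (mw : measurable_fun [set: T] w) (mv : measurable_fun [set: U] v).
Hypotheses (w0 : forall x, 0 <= w x) (v0 : forall y, 0 <= v y).

(** The image of [w mu] under [phi] and that of [v nu] under [psi] coincide. Testing on nonnegative
    functions alone lets Tonelli prove it without any integrability. *)
Definition same_law := forall F : V -> R, measurable_fun [set: V] F -> (forall z, 0 <= F z) ->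
  (\int[mu]_x (F (phi x) * w x)%:E = \int[nu]_y (F (psi y) * v y)%:E)%E.

(** Applied to [|G|] the law gives integrability, applied to the positive and negative parts of [G]
    it gives the value; the nonnegative weights commute with all three operations. *)
Lemma real_transfer (G : V -> R) : same_law -> measurable_fun [set: V] G ->
  nu.-integrable setT (fun y => (G (psi y) * v y)%:E) ->
  mu.-integrable setT (fun x => (G (phi x) * w x)%:E) /\
  (\int[mu]_x (G (phi x) * w x)%:E = \int[nu]_y (G (psi y) * v y)%:E)%E.
Proof.
move=> law mG /integrableP[mGv Gv].
split.
  apply/integrableP; split.
    by apply/measurable_EFinP; apply: measurable_funM => //; exact: measurableT_comp.
  move: Gv; under eq_integral do rewrite /= normrM (ger0_norm (v0 _)).
  under [in X in _ -> X]eq_integral do rewrite /= normrM (ger0_norm (w0 _)).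
  by rewrite -(law (fun z => `|G z|)) //; exact: measurableT_comp.
rewrite integralE [RHS]integralE; congr (_ - _)%E.
  transitivity (\int[mu]_x (Num.max (G (phi x)) 0 * w x)%:E)%E.
    apply: eq_integral => x _; rewrite funeposE -EFin_max.
    by rewrite maxr_pMl // mul0r.
  rewrite (law (fun z => Num.max (G z) 0)) //; last 2 first.
  - by apply: measurable_maxr.
  - by move=> z; rewrite le_max lexx orbT.
  apply: eq_integral => x _; rewrite funeposE -EFin_max.
  by rewrite maxr_pMl // mul0r.
transitivity (\int[mu]_x (Num.max (- G (phi x)) 0 * w x)%:E)%E.
  apply: eq_integral => x _; rewrite funenegE -EFinN -EFin_max.
  by rewrite maxr_pMl // mul0r mulNr.
rewrite (law (fun z => Num.max (- G z) 0)) //; last 2 first.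
- by apply: measurable_maxr => //; exact: measurableT_comp.
- by move=> z; rewrite le_max lexx orbT.
apply: eq_integral => x _; rewrite funenegE -EFinN -EFin_max.
by rewrite maxr_pMl // mul0r mulNr.
Qed.

Lemma complex_transfer (G : V -> R[i]) : same_law -> cmeas G ->
  cintegrable nu setT (fun y => G (psi y) * (v y)%:C) ->
  cintegrable mu setT (fun x => G (phi x) * (w x)%:C) /\
  cintegral mu setT (fun x => G (phi x) * (w x)%:C) =
  cintegral nu setT (fun y => G (psi y) * (v y)%:C).
Proof.
have ReM (z : R[i]) (r : R) : complex.Re (z * r%:C) = complex.Re z * r.
  by case: z => a b /=; rewrite mulr0 subr0.
have ImM (z : R[i]) (r : R) : complex.Im (z * r%:C) = complex.Im z * r.
  by case: z => a b /=; rewrite mulr0 add0r.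
move=> law [mG1 mG2] []; under eq_fun do rewrite ReM.
under [in X in _ -> X -> _]eq_fun do rewrite ImM.
move=> /(real_transfer law mG1)[i1 e1] /(real_transfer law mG2)[i2 e2].
split.
  split; first by under eq_fun do rewrite ReM.
  by under eq_fun do rewrite ImM.
rewrite /cintegral; congr (_ +i* _).
  under eq_Rintegral do rewrite ReM; under [RHS]eq_Rintegral do rewrite ReM.
  by rewrite /Rintegral e1.
under eq_Rintegral do rewrite ImM; under [RHS]eq_Rintegral do rewrite ImM.
by rewrite /Rintegral e2.
Qed.

End real_transfer.

Section cintegral_theory.
Context d (T : measurableType d) (R : realType) (mu : {measure set T -> \bar R}).
Implicit Types f g : T -> R[i].

Lemma cintegrable_cmeas f : cintegrable mu setT f -> cmeas f.
Proof.
by move=> [/measurable_int/measurable_EFinP m1 /measurable_int/measurable_EFinP m2].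
Qed.

Lemma normr_Re_le (z : R[i]) : `|complex.Re z| <= cabs z.
Proof.
rewrite -(@ler_pXn2r _ 2) ?nnegrE ?cabs_ge0 // cabs_sqr real_normK ?num_real //.
by rewrite lerDl sqr_ge0.
Qed.

Lemma normr_Im_le (z : R[i]) : `|complex.Im z| <= cabs z.
Proof.
rewrite -(@ler_pXn2r _ 2) ?nnegrE ?cabs_ge0 // cabs_sqr real_normK ?num_real //.
by rewrite lerDr sqr_ge0.
Qed.

Lemma cabs_le_ReIm (z : R[i]) : cabs z <= `|complex.Re z| + `|complex.Im z|.
Proof.
rewrite -(@ler_pXn2r _ 2) ?nnegrE ?cabs_ge0 ?addr_ge0 // cabs_sqr.
rewrite sqrrD !real_normK ?num_real // -addrA lerD2l lerDr.
by rewrite mulrn_wge0 // mulr_ge0.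
Qed.

Lemma cintegrableP f : cintegrable mu setT f <->
  cmeas f /\ mu.-integrable setT (fun x => (cabs (f x))%:E).
Proof.
split=> [fi|[mf fi]].
  have mf := cintegrable_cmeas fi; split=> //; case: fi => f1 f2.
  apply: le_integrable (integrableD measurableT (integrable_norm f1) (integrable_norm f2)) => //.
    by apply/measurable_EFinP; exact: measurable_cabs.
  move=> x _ /=; rewrite lee_fin [leRHS]ger0_norm ?addr_ge0 // ger0_norm ?cabs_ge0 //.
  exact: cabs_le_ReIm.
have [m1 m2] := mf; split; apply: le_integrable fi => //; try exact/measurable_EFinP.
- by move=> x _ /=; rewrite lee_fin [leRHS]ger0_norm ?cabs_ge0 // normr_Re_le.
- by move=> x _ /=; rewrite lee_fin [leRHS]ger0_norm ?cabs_ge0 // normr_Im_le.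
Qed.

Lemma cintegrable_le f g : cmeas f -> cintegrable mu setT g ->
  (forall x, cabs (f x) <= cabs (g x)) -> cintegrable mu setT f.
Proof.
move=> mf /cintegrableP[mg gi] fg; apply/cintegrableP; split=> //.
apply: le_integrable gi => //.
  by apply/measurable_EFinP; exact: measurable_cabs.
by move=> x _ /=; rewrite lee_fin !ger0_norm ?cabs_ge0.
Qed.

Lemma cintegralZl (c : R[i]) f : cintegrable mu setT f ->
  cintegrable mu setT (fun x => c * f x) /\
  cintegral mu setT (fun x => c * f x) = c * cintegral mu setT f.
Proof.
case: c => a b [f1 f2].
have ReE x : complex.Re ((a +i* b) * f x) = a * complex.Re (f x) - b * complex.Im (f x).
  by case: (f x).
have ImE x : complex.Im ((a +i* b) * f x) = a * complex.Im (f x) + b * complex.Re (f x).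
  by case: (f x) => c e /=; rewrite addrC.
have iZ (r : R) (h : T -> R) : mu.-integrable setT (EFin \o h) ->
    mu.-integrable setT (fun x => (r * h x)%:E).
  by move=> hi; apply: (eq_integrable measurableT) (integrableZl measurableT r hi).
have i1 := iZ a _ f1; have i2 := iZ b _ f2; have i3 := iZ a _ f2; have i4 := iZ b _ f1.
split.
  split.
    under eq_fun do rewrite ReE.
    exact: (integrableB measurableT i1 i2).
  under eq_fun do rewrite ImE.
  exact: (integrableD measurableT i3 i4).
rewrite /cintegral; apply/eqP; rewrite eq_complex /=.
under eq_Rintegral do rewrite ReE.
under [X in _ && (X == _)]eq_Rintegral do rewrite ImE.
rewrite RintegralB // RintegralD // !RintegralZl //.
by rewrite [_ + b * _]addrC !eqxx.
Qed.

Lemma eq_cintegral f g : f =1 g -> cintegral mu setT f = cintegral mu setT g.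
Proof. by move=> /funext ->. Qed.

Lemma cintegral_mkcond (D : set T) f : measurable D ->
  (cintegrable mu D f <-> cintegrable mu setT (fun x => if x \in D then f x else 0)) /\
  cintegral mu D f = cintegral mu setT (fun x => if x \in D then f x else 0).
Proof.
move=> mD; split.
  rewrite /cintegrable (integrable_mkcond _ mD).
  rewrite [X in _ /\ X <-> _](integrable_mkcond _ mD).
  rewrite (_ : (_ \_ D) = (fun x => (complex.Re (if x \in D then f x else 0))%:E)); last first.
    by apply/funext => x; rewrite patchE; case: ifP.
  rewrite (_ : ((fun x => (complex.Im (f x))%:E) \_ D) = (fun x => (complex.Im (if x \in D then f x else 0))%:E)) //.
  by apply/funext => x; rewrite patchE; case: ifP.
rewrite /cintegral !(Rintegral_mkcond mu D); congr (_ +i* _);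
by apply: eq_Rintegral => x _; rewrite patchE; case: ifP.
Qed.

Lemma cintegral_real (u : T -> R) : mu.-integrable setT (EFin \o u) ->
  cintegrable mu setT (fun x => (u x)%:C) /\
  cintegral mu setT (fun x => (u x)%:C) = (\int[mu]_x u x)%R%:C.
Proof.
move=> ui; split; first by split=> //=; exact: integrable0.
by rewrite /cintegral /=; congr (_ +i* _); rewrite /Rintegral integral0.
Qed.

End cintegral_theory.

Section cintegral_product.
Context d1 d2 (T1 : measurableType d1) (T2 : measurableType d2) (R : realType).
Variables (m1 : {sigma_finite_measure set T1 -> \bar R})
  (m2 : {sigma_finite_measure set T2 -> \bar R}).

Lemma integral_prod (u : T1 -> R) (v : T2 -> R) :
  m1.-integrable setT (EFin \o u) -> m2.-integrable setT (EFin \o v) ->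
  (m1 \x m2)%E.-integrable setT (fun z => (u z.1 * v z.2)%:E) /\
  (\int[(m1 \x m2)%E]_z (u z.1 * v z.2) = (\int[m1]_x u x) * (\int[m2]_y v y))%R.
Proof.
move=> iu iv.
have /measurable_EFinP mu := measurable_int _ iu.
have /measurable_EFinP mv := measurable_int _ iv.
have muv : measurable_fun [set: T1 * T2] (fun z => (u z.1 * v z.2)%:E).
  apply/measurable_EFinP; apply: measurable_funM.
    exact: (measurableT_comp mu).
  exact: (measurableT_comp mv).
have iuv : (m1 \x m2)%E.-integrable setT (fun z => (u z.1 * v z.2)%:E).
  apply/(integrable12ltyP m1 m2 muv).
  under eq_integral => x _.
    under eq_integral do rewrite /= normrM EFinM.
    rewrite ge0_integralZl //; last by do 2 apply: measurableT_comp.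
    over.
  rewrite ge0_integralZr //; last 2 first.
  - by do 2 apply: measurableT_comp.
  - by apply: integral_ge0 => y _; rewrite lee_fin.
  move/integrableP : iu => [_ iu]; move/integrableP : iv => [_ iv].
  by rewrite lte_mul_pinfty ?integral_ge0 // ge0_fin_numE ?integral_ge0.
split=> //; rewrite /Rintegral -integral12_prod_meas1 // /fubini_F /=.
have fv := integrable_fin_num measurableT iv.
have fu := integrable_fin_num measurableT iu.
under eq_integral => x _.
  under eq_integral do rewrite EFinM.
  rewrite integralZl //= -(fineK fv); over.
rewrite integralZr // -[in LHS](fineK fu) -EFinM /=.
by [].
Qed.

Lemma cintegral_prod (f : T1 -> R[i]) (g : T2 -> R[i]) :
  cintegrable m1 setT f -> cintegrable m2 setT g ->
  cintegrable (m1 \x m2)%E setT (fun z => f z.1 * g z.2) /\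
  cintegral (m1 \x m2)%E setT (fun z => f z.1 * g z.2) =
  cintegral m1 setT f * cintegral m2 setT g.
Proof.
move=> [f1 f2] [g1 g2].
have [i11 e11] := integral_prod f1 g1; have [i22 e22] := integral_prod f2 g2.
have [i12 e12] := integral_prod f1 g2; have [i21 e21] := integral_prod f2 g1.
have ReE (z : T1 * T2) : complex.Re (f z.1 * g z.2) =
    complex.Re (f z.1) * complex.Re (g z.2) - complex.Im (f z.1) * complex.Im (g z.2).
  by case: (f z.1); case: (g z.2).
have ImE (z : T1 * T2) : complex.Im (f z.1 * g z.2) =
    complex.Re (f z.1) * complex.Im (g z.2) + complex.Im (f z.1) * complex.Re (g z.2).
  by case: (f z.1); case: (g z.2).
split.
  split.
    under eq_fun do rewrite ReE.
    exact: (integrableB measurableT i11 i22).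
  under eq_fun do rewrite ImE.
  exact: (integrableD measurableT i12 i21).
rewrite /cintegral (eq_Rintegral _ (fun z _ => ReE z)) (eq_Rintegral _ (fun z _ => ImE z)).
rewrite RintegralB // RintegralD // e11 e22 e12 e21.
by apply/eqP; rewrite eq_complex /= !eqxx.
Qed.

(** Inner integrals are real numbers obtained by [fine]. Integrability of every section makes them
    agree at each point with the extended real integrals that Fubini speaks of. *)
Lemma cFubini1 (h : T1 * T2 -> R[i]) : cintegrable (m1 \x m2)%E setT h ->
  (forall x, cintegrable m2 setT (fun y => h (x, y))) ->
  cintegrable m1 setT (fun x => cintegral m2 setT (fun y => h (x, y))) /\
  cintegral m1 setT (fun x => cintegral m2 setT (fun y => h (x, y))) =
  cintegral (m1 \x m2)%E setT h.
Proof.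
move=> [h1 h2] hx.
have E1 x : ((\int[m2]_y complex.Re (h (x, y)))%R)%:E = fubini_F m2 (fun z => (complex.Re (h z))%:E) x.
  by rewrite /Rintegral fineK //; have [/(integrable_fin_num measurableT)] := hx x.
have E2 x : ((\int[m2]_y complex.Im (h (x, y)))%R)%:E = fubini_F m2 (fun z => (complex.Im (h z))%:E) x.
  by rewrite /Rintegral fineK //; have [_ /(integrable_fin_num measurableT)] := hx x.
split.
  split => /=.
    by under eq_fun do rewrite E1; exact: integrable_fubini_F.
  by under eq_fun do rewrite E2; exact: integrable_fubini_F.
rewrite /cintegral; congr (_ +i* _); rewrite /Rintegral -integral12_prod_meas1 //;
  congr fine; apply: eq_integral => x _ /=; [exact: E1|exact: E2].
Qed.

Lemma cFubini2 (h : T1 * T2 -> R[i]) : cintegrable (m1 \x m2)%E setT h ->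
  (forall y, cintegrable m1 setT (fun x => h (x, y))) ->
  cintegral m2 setT (fun y => cintegral m1 setT (fun x => h (x, y))) =
  cintegral (m1 \x m2)%E setT h.
Proof.
move=> [h1 h2] hx.
have E1 y : ((\int[m1]_x complex.Re (h (x, y)))%R)%:E = fubini_G m1 (fun z => (complex.Re (h z))%:E) y.
  by rewrite /Rintegral fineK //; have [/(integrable_fin_num measurableT)] := hx y.
have E2 y : ((\int[m1]_x complex.Im (h (x, y)))%R)%:E = fubini_G m1 (fun z => (complex.Im (h z))%:E) y.
  by rewrite /Rintegral fineK //; have [_ /(integrable_fin_num measurableT)] := hx y.
rewrite /cintegral; congr (_ +i* _); rewrite /Rintegral -integral21_prod_meas1 //;
  congr fine; apply: eq_integral => x _ /=; [exact: E1|exact: E2].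
Qed.

End cintegral_product.

(** * Complex powers and the gamma function *)

Section complex_powers.
Variable R : realType.
Implicit Types (x y : R) (a b z : R[i]).

Lemma cexpD z w : cexp (z + w) = cexp z * cexp w :> R[i].
Proof.
case: z => a b; case: w => c e; rewrite /cexp /= expRD cosD sinD.
apply/eqP; rewrite eq_complex /=; apply/andP; split; apply/eqP; ring.
Qed.

Lemma cexp_real x : cexp x%:C = (expR x)%:C.
Proof.
rewrite /cexp /= cos0 sin0; apply/eqP; rewrite eq_complex /=.
by rewrite !mulr1 !mulr0 ?mul0r ?addr0 ?subr0 !eqxx.
Qed.

Lemma cabs_real x : cabs x%:C = `|x|.
Proof. by rewrite /cabs normc_def /= expr0n addr0 sqrtr_sqr. Qed.

Lemma cabs_cexp z : cabs (cexp z) = expR (complex.Re z).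
Proof.
rewrite /cexp cabsM cabs_real ger0_norm ?expR_ge0 //.
by rewrite [X in _ * X](_ : _ = 1) ?mulr1 // /cabs normc_def /= cos2Dsin2 sqrtr1.
Qed.

Lemma cpow_real x (r : R) : cpow x r%:C = (expR (r * ln x))%:C.
Proof. by rewrite /cpow -rmorphM /= cexp_real. Qed.

(* Unlike [cpow], these vanish outside the positive reals, so that the powers
   of a determinant carry the full-rank condition with them. *)
Definition pw x a : R[i] := if 0 < x then cpow x a else 0.

Definition rpw x (r : R) : R := if 0 < x then expR (r * ln x) else 0.

Lemma pwE x a : 0 < x -> pw x a = cpow x a. Proof. by rewrite /pw => ->. Qed.

Lemma pw0 x a : x <= 0 -> pw x a = 0. Proof. by rewrite /pw leNgt => /negbTE ->. Qed.

Lemma cpowD x a b : cpow x (a + b) = cpow x a * cpow x b.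
Proof. by rewrite /cpow mulrDl cexpD. Qed.

Lemma pwD x a b : pw x (a + b) = pw x a * pw x b.
Proof. by rewrite /pw; case: ifP => _; [exact: cpowD|rewrite mul0r]. Qed.

Lemma pwM x y a : 0 <= x -> 0 <= y -> pw (x * y) a = pw x a * pw y a.
Proof.
rewrite !le_eqVlt => /predU1P[<-|x0]; first by rewrite mul0r pw0 // mul0r.
move=> /predU1P[<-|y0]; first by rewrite mulr0 pw0 // mulr0.
rewrite !pwE ?mulr_gt0 // /cpow lnM ?posrE // -cexpD -mulrDr.
by rewrite rmorphD.
Qed.

Lemma pw1 a : pw 1 a = 1.
Proof. by rewrite pwE // /cpow ln1 mulr0 cexp_real expR0. Qed.

Lemma pw_real x (r : R) : pw x r%:C = (rpw x r)%:C.
Proof. by rewrite /pw /rpw; case: ifP => // _; rewrite cpow_real. Qed.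

Lemma pw_nat x n : 0 < x -> pw x n%:R = (x ^+ n)%:C.
Proof.
move=> x0; rewrite -[n%:R](rmorph_nat (real_complex R)) pw_real /rpw x0 expRM_natl.
by rewrite lnK // posrE.
Qed.

Lemma cabs_pw x a : cabs (pw x a) = rpw x (complex.Re a).
Proof.
rewrite /pw /rpw; case: ifP => _; last exact: cabs0.
by rewrite /cpow cabs_cexp; case: a => a b /=; rewrite mulr0 subr0.
Qed.

Lemma rpw_ge0 x (r : R) : 0 <= rpw x r.
Proof. by rewrite /rpw; case: ifP => // _; rewrite expR_ge0. Qed.

Lemma measurable_rpw d (T : measurableType d) (f : T -> R) (r : R) :
  measurable_fun [set: T] f -> measurable_fun [set: T] (fun t => rpw (f t) r).
Proof.
move=> mf; apply: measurable_fun_ifT => //; first exact: measurable_fun_ltr.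
apply: measurable_expR_comp; apply: measurable_funM => //.
exact: (measurableT_comp (@measurable_ln R)).
Qed.

Lemma cmeas_pw d (T : measurableType d) (f : T -> R) a :
  measurable_fun [set: T] f -> cmeas (fun t => pw (f t) a).
Proof.
case: a => a b mf.
have mln (c : R) : measurable_fun [set: T] (fun t => c * ln (f t)).
  by apply: measurable_funM => //; exact: (measurableT_comp (@measurable_ln R)).
have mc : measurable_fun [set: T] (fun t => cos (b * ln (f t))).
  by apply: (measurableT_comp (continuous_measurable_fun (@continuous_cos R))).
have ms : measurable_fun [set: T] (fun t => sin (b * ln (f t))).
  by apply: (measurableT_comp (continuous_measurable_fun (@continuous_sin R))).
have -> : (fun t => pw (f t) (a +i* b)) = (fun t => (rpw (f t) a)%:C *
    (cos (b * ln (f t)) +i* sin (b * ln (f t)))).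
  apply/funext => t; rewrite /pw /rpw; case: ifP => _; last by rewrite mul0r.
  by rewrite /cpow /cexp /= !mulr0 subr0 add0r.
by apply: cmeasM; [exact/cmeas_real/measurable_rpw|exact: cmeas_pair].
Qed.

End complex_powers.

Section gamma_function.
Variable R : realType.
Local Notation mu := (@lebesgue_measure R).

Definition gamma_fun (z : R[i]) (t : R) : R[i] := pw t (z - 1) * (expR (- t))%:C.

Lemma cmeas_gamma_fun z : cmeas (gamma_fun z).
Proof.
apply: cmeasM; first exact: cmeas_pw.
by apply: cmeas_real; apply: measurable_expR_comp; exact: measurable_funN.
Qed.

Lemma cGammaE z : cGamma z = cintegral mu setT (gamma_fun z).
Proof.
rewrite /cGamma (cintegral_mkcond mu _ (measurable_itv `]0, +oo[)).2.
apply: eq_cintegral => t; rewrite /gamma_fun /pw.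
have [t0|t0] := ltP 0 t; first by rewrite mem_set //= in_itv /= t0.
by rewrite memNset ?mul0r //= in_itv /= andbT ltNge t0.
Qed.

Lemma cabs_gamma_fun z t : cabs (gamma_fun z t) = rpw t (complex.Re z - 1) * expR (- t).
Proof.
by rewrite /gamma_fun cabsM cabs_real ger0_norm ?expR_ge0 // cabs_pw; case: z.
Qed.

(** The integrand may blow up at [0], so the antiderivative [t ^ x / x] is used on
    [[1 / (n + 2), 1]] and the bound passes to the monotone limit. The shift by two keeps the left
    end strictly below [1]. *)
Lemma integral_rpw01 (x : R) : 0 < x ->
  (\int[mu]_(t in `]0%R, 1%R]) (rpw t (x - 1))%:E <= (x^-1)%:E)%E.
Proof.
move=> x0.
have mr (D : set (measurableTypeR R)) : measurable_fun D (fun t : R => (rpw t (x - 1))%:E).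
  by apply: measurable_funTS; apply/measurable_EFinP; exact: measurable_rpw.
pose F n : set (measurableTypeR R) := `[n.+2%:R^-1, 1]%classic.
have -> : `]0%R, 1%R]%classic = \bigcup_n F n.
  apply/seteqP; split => t; rewrite /F /= in_itv /=.
    move=> /andP[t0 t1]; exists (Num.truncn t^-1) => //=; rewrite in_itv /= t1 andbT.
    rewrite -[leRHS]invrK lef_pV2 ?posrE ?invr_gt0 //.
    by apply: le_trans (ltW (truncnS_gt _)) _; rewrite ler_nat.
  move=> [n _]; rewrite /= in_itv /= => /andP[nt ->]; rewrite andbT.
  by apply: lt_le_trans nt; rewrite invr_gt0.
have ndF : nondecreasing_seq F.
  apply/nondecreasing_seqP => n; apply/subsetPset => t; rewrite /F /= !in_itv /=.
  move=> /andP[nt ->]; rewrite andbT; apply: le_trans nt.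
  by rewrite lef_pV2 ?posrE // ler_nat.
have cv := ge0_nondecreasing_set_cvg_integral (mu := mu) ndF
  (fun n => measurable_itv `[n.+2%:R^-1, 1]) (fun n => mr (F n)).
have {}cv := cv (fun n t _ => rpw_ge0 t (x - 1)).
rewrite -(cvg_lim _ cv) //; apply: lime_le; first by apply/cvg_ex; eexists; exact: cv.
apply: nearW => n; rewrite /F.
have n0 : 0 < n.+2%:R^-1 :> R by rewrite invr_gt0.
have n1 : n.+2%:R^-1 < 1 :> R by rewrite invf_lt1 // ltr1n.
have E (t : R) : 0 < t -> rpw t (x - 1) = t `^ (x - 1).
  by move=> t0; rewrite /rpw t0 /powR gt_eqF.
rewrite [leLHS](_ : _ = \int[mu]_(t in `[n.+2%:R^-1%R, 1%R]) (t `^ (x - 1))%:E)%E; last first.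
  apply: eq_integral => t /set_mem; rewrite /= in_itv /= => /andP[nt _].
  by rewrite E // (lt_le_trans n0).
have dF (t : R) : 0 < t -> is_derive t (1 : R) (fun t => x^-1 * t `^ x) (t `^ (x - 1)).
  move=> t0; have := is_deriveZ (x^-1) (is_derive1_powR x t0).
  by rewrite /GRing.scale /= mulKf // gt_eqF.
have cpw (y t : R) : 0 < t -> {for t, continuous (fun t => t `^ y)}.
  move=> t0; apply: differentiable_continuous; apply/derivable1_diffP.
  by have [] := is_derive1_powR y t0.
have cF (t : R) : 0 < t -> {for t, continuous (fun t => x^-1 * t `^ x)}.
  by move=> t0; apply: continuousM; [exact: cst_continuous|exact: cpw].
rewrite (@continuous_FTC2 _ _ (fun t => x^-1 * t `^ x)) //.
- rewrite -EFinB lee_fin powR1 mulr1 gerBl mulr_ge0 ?powR_ge0 // invr_ge0 ltW //.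
- apply: continuous_in_subspaceT => t /set_mem; rewrite /= in_itv /= => /andP[nt _].
  by apply: cpw; exact: lt_le_trans nt.
- split.
  + move=> t; rewrite in_itv /= => /andP[nt _].
    by have [] := dF t (lt_trans n0 nt).
  + by apply: cvg_at_right_filter; exact: cF.
  + by apply: cvg_at_left_filter; exact: cF.
- move=> t; rewrite in_itv /= => /andP[nt _].
  by have [_ E1] := dF t (lt_trans n0 nt); rewrite derive1E E1.
Qed.

End gamma_function.

Section gamma_values.
Variable R : realType.
Local Notation C := R[i].
Local Notation mu := (@lebesgue_measure R).

Lemma rpw_nat (t : R) (m : nat) : 0 < t -> rpw t m%:R = t ^+ m.
Proof. by move=> t0; rewrite /rpw t0 expRM_natl lnK // posrE. Qed.

Lemma integral_rpw_nat (F : R -> \bar R) (m : nat) :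
  (\int[mu]_(t in `]0%R, +oo[) (F t * (t ^+ m)%:E) =
   \int[mu]_t (F t * (rpw t m%:R)%:E))%E.
Proof.
rewrite integral_mkcond; apply: eq_integral => t _; rewrite patchE.
have [t0|t0] := ltP 0 t; first by rewrite mem_set /= ?in_itv /= ?t0 // rpw_nat.
by rewrite memNset /= ?in_itv /= ?andbT ?ltNge ?t0 // /rpw ltNge t0 mule0.
Qed.

Let m_pe (r : R) : measurable_fun [set: measurableTypeR R]
  (fun t : R => (expR (- t) * rpw t r)%:E).
Proof.
apply/measurable_EFinP; apply: measurable_funM; last exact: measurable_rpw.
by apply: measurable_expR_comp; exact: measurable_funN.
Qed.

Let pe_ge0 (r : R) (t : R) : 0 <= expR (- t) * rpw t r.
Proof. by rewrite mulr_ge0 ?expR_ge0 ?rpw_ge0. Qed.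

(* The Gaussian integral determines the constant of [mint_frob_density]. *)
Lemma gauss_polar n p : (0 < n * p)%N -> exists2 v : R, 0 < v &
  (forall F : R -> \bar R, measurable_fun [set: R] F -> (forall t, 0 <= F t)%E ->
  (mint (fun X : 'M[C]_(n, p) => F (frob X)) =
   v%:E * \int[mu]_t (F t * (rpw t (n * p).-1%:R)%:E))%E) /\
  ((pi ^+ (n * p))%:E = v%:E * \int[mu]_t (expR (- t) * rpw t (n * p).-1%:R)%:E)%E.
Proof.
move=> np0; have [v v0 vE] := mint_frob_density R np0.
have H := vE (fun t => (expR (- t))%:E).
rewrite mint_gauss integral_rpw_nat in H.
have {}H : ((pi ^+ (n * p))%:E = v%:E *
    \int[mu]_t (expR (- t) * rpw t (n * p).-1%:R)%:E)%E.
  apply: H => [|t]; last by rewrite lee_fin expR_ge0.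
  by apply/measurable_EFinP; apply: measurable_expR_comp; exact: measurable_funN.
have v_gt0 : 0 < v.
  rewrite lt_neqAle v0 andbT; apply/eqP => v00; move: H; rewrite -v00 mul0e.
  by case=> /eqP; rewrite expf_eq0 gt_eqF ?pi_gt0 ?andbF.
exists v => //; split=> // F mF F0.
by rewrite vE // integral_rpw_nat.
Qed.

(** Read off the Gaussian integral over a column of [m.+1] entries: a positive multiple of the
    present integral is the finite number [pi ^ m.+1]. *)
Lemma integral_exp_power_fin (m : nat) :
  (\int[mu]_t (expR (- t) * rpw t m%:R)%:E < +oo)%E.
Proof.
have [|v v0 [_ H]] := @gauss_polar m.+1 1; first by rewrite muln1.
rewrite ltey; apply/eqP => E; move: H.
by rewrite muln1 /= E gt0_muley ?lte_fin.
Qed.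

Lemma integrable_gamma_fun (z : C) : 0 < complex.Re z ->
  cintegrable mu setT (gamma_fun z).
Proof.
move=> z0; apply/cintegrableP; split; first exact: cmeas_gamma_fun.
set x := complex.Re z in z0.
apply/integrableP; split.
  by apply/measurable_EFinP/measurable_cabs/cmeas_gamma_fun.
(* An integer exponent above [x - 1]: the integrand is dominated by [t ^ (x - 1)] on []0, 1]] and by
   [exp (- t) * t ^ m] beyond. *)
pose m := (Num.truncn x).+1.
have xm : x - 1 <= m%:R by rewrite lerBlDr; apply: le_trans (ltW (truncnS_gt x)) _; rewrite lerDl.
pose f1 := (fun t : R => (rpw t (x - 1))%:E) \_ `]0%R, 1%R].
pose f2 := (fun t : R => (expR (- t) * rpw t m%:R)%:E).
have mf1 : measurable_fun [set: measurableTypeR R] f1.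
  apply: measurable_patch => //.
  by apply/measurable_EFinP; exact: measurable_rpw.
have f10 t : (0 <= f1 t)%E by apply: erestrict_ge0 => s _; rewrite lee_fin rpw_ge0.
apply: (@le_lt_trans _ _ (\int[mu]_t (f1 t + f2 t))%E).
  apply: ge0_le_integral => //.
  - apply/measurable_EFinP; apply: measurableT_comp => //.
    exact/measurable_cabs/cmeas_gamma_fun.
  - by apply: emeasurable_funD => //; exact: m_pe.
  - move=> t _; rewrite abse_EFin ger0_norm ?cabs_ge0 // cabs_gamma_fun -/x.
    have [t0|t0] := ltP 0 t; last first.
      rewrite /rpw ltNge t0 /= mul0r adde_ge0 // lee_fin; exact: pe_ge0.
    have [t1|t1] := leP t 1.
      rewrite -[leLHS]adde0; apply: leeD; last by rewrite lee_fin.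
      rewrite /f1 patchE mem_set /= ?in_itv /= ?t0 // lee_fin.
      by rewrite ger_pMr ?expR_le1 ?oppr_le0 ?(ltW t0) // /rpw t0 expR_gt0.
    rewrite -[leLHS]add0e; apply: leeD => //.
    rewrite lee_fin mulrC ler_pM2l ?expR_gt0 // /rpw t0 ler_expR.
    by rewrite ler_wpM2r // ln_ge0 // ltW.
rewrite ge0_integralD //; last 2 first.
- by move=> t _; rewrite lee_fin.
- exact: m_pe.
rewrite lte_add_pinfty ?integral_exp_power_fin // /f1 -integral_mkcond.
by apply: le_lt_trans (integral_rpw01 z0) _; rewrite ltry.
Qed.

Lemma cGamma_real (x : R) : 0 < x ->
  cGamma x%:C = (\int[mu]_t (expR (- t) * rpw t (x - 1)))%R%:C.
Proof.
move=> x0; have E t : gamma_fun x%:C t = (expR (- t) * rpw t (x - 1))%:C.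
  by rewrite /gamma_fun -[1 in LHS](rmorph1 (real_complex R)) -rmorphB pw_real mulrC -rmorphM.
rewrite cGammaE (funext E).
have [] := @integrable_gamma_fun x%:C x0; rewrite (funext E) => fi _.
exact: (cintegral_real fi).2.
Qed.

Lemma cGamma_real_gt0 (x : R) : 0 < x -> 0 < cGamma x%:C.
Proof.
move=> x0; rewrite cGamma_real // ltcR.
have [] := @integrable_gamma_fun x%:C x0.
have E t : complex.Re (gamma_fun x%:C t) = expR (- t) * rpw t (x - 1).
  by rewrite /gamma_fun -[1 in LHS](rmorph1 (real_complex R)) -rmorphB pw_real mulrC -rmorphM.
under eq_fun do rewrite E; move=> fi _.
have fin := integrable_fin_num measurableT fi.
rewrite -lte_fin /Rintegral fineK //.
(* A lower bound of the integrand on [[1, 2]]: there [exp (- t)] is at least [exp (- 2)], and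
   [t ^ (x - 1)] is at least [1] or [2 ^ (x - 1)] according to the sign of [x - 1]. *)
pose c := expR (- 2) * Num.min 1 (expR ((x - 1) * ln 2)).
have c0 : 0 < c by rewrite mulr_gt0 ?expR_gt0 // lt_min ltr01 expR_gt0.
apply: (@lt_le_trans _ _ (\int[mu]_(t in `[1%R, 2%R]) c%:E)%E).
  have l12 : lebesgue_measure (`[1, 2]%classic : set R) = 1%E.
    apply: (etrans (lebesgue_measure_itv `[1, 2])).
    rewrite /= lte_fin ltr1n -EFinB; congr (_%:E); lra.
  rewrite integral_cst // (_ : (_ * _)%E = c%:E) ?lte_fin //.
  by apply: (etrans (congr1 (mule c%:E) l12)); rewrite mule1.
rewrite [leLHS]integral_mkcond; apply: ge0_le_integral => //.
- by move=> t _; apply: erestrict_ge0 => s _; rewrite lee_fin ltW.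
- by apply: measurable_patch => //; exact: measurable_cst.
- move=> t _; rewrite patchE; case: ifPn => [/set_mem|_]; last by rewrite lee_fin.
  rewrite /= in_itv /= => /andP[t1 t2]; rewrite lee_fin /c.
  have t0 : 0 < t by exact: lt_le_trans t1.
  apply: ler_pM; rewrite ?expR_ge0 ?le_min ?ler01 ?expR_ge0 //.
    by rewrite ler_expR lerN2.
  rewrite /rpw t0 ge_min; have [x1|x1] := leP 1 x.
    by rewrite (le_trans _ (expR_ge1Dx _)) // lerDl mulr_ge0 ?ln_ge0 // subr_ge0.
  apply/orP; right; rewrite ler_expR ler_wnM2l ?subr_le0 ?(ltW x1) //.
  by rewrite ler_ln ?posrE.
Qed.

Lemma cGamma_nat_neq0 (m : nat) : cGamma (m.+1%:R : C) != 0.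
Proof.
rewrite -(rmorph_nat (real_complex R)) gt_eqF //.
exact: (@cGamma_real_gt0 m.+1%:R).
Qed.

(** The integral in the identity of [gauss_polar] is Euler's integral at [n * p], which identifies
    [v]: it is half the area of the unit sphere in real dimension [2 * n * p]. *)
Lemma mint_frob n p : (0 < n * p)%N -> exists2 v : R, 0 < v &
  (forall F : R -> \bar R, measurable_fun [set: R] F -> (forall t, 0 <= F t)%E ->
  (mint (fun X : 'M[C]_(n, p) => F (frob X)) =
   v%:E * \int[mu]_t (F t * (rpw t (n * p).-1%:R)%:E))%E) /\
  v%:C = (pi ^+ (n * p))%:C / cGamma ((n * p)%:R : C).
Proof.
move=> np0; have [v v0 [vE piE]] := gauss_polar np0.
exists v => //; split=> //.
have dE : (n * p)%:R = ((n * p)%:R : R)%:C :> C by rewrite rmorph_nat.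
have G0 : cGamma ((n * p)%:R : C) != 0 by rewrite -(prednK np0) cGamma_nat_neq0.
apply: (mulIf G0); rewrite divfK // dE cGamma_real ?ltr0n // -rmorphM /=.
congr (_%:C); apply: EFin_inj; rewrite piE EFinM; congr (_ * _)%E.
have -> : (n * p)%:R - 1 = (n * p).-1%:R :> R.
  by rewrite -{1}(prednK np0) -natr1 addrK.
rewrite /Rintegral fineK // ge0_fin_numE ?integral_exp_power_fin //.
by apply: integral_ge0 => t _; rewrite lee_fin.
Qed.

End gamma_values.

(** * Gaussian moments of Gram determinants *)

Section gram_reduction.
Variable R : realType.
Local Notation C := R[i].

Lemma trmxC_mul m n p (A : 'M[C]_(m, n)) (B : 'M[C]_(n, p)) :
  (A *m B)^t* = B^t* *m A^t*.
Proof. by rewrite trmx_mul map_mxM. Qed.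

Definition gdet n p (X : 'M[C]_(n, p)) : R := absdet (X^t* *m X).

Lemma gdet_ge0 n p (X : 'M[C]_(n, p)) : 0 <= gdet X.
Proof. exact: absdet_ge0. Qed.

Lemma frobE n p (X : 'M[C]_(n, p)) : (frob X)%:C = \tr (X^t* *m X).
Proof.
rewrite /frob exchange_big /= rmorph_sum /=; apply: eq_bigr => b _.
rewrite mxE rmorph_sum /=; apply: eq_bigr => a _.
by rewrite !mxE rmorphXn /= -cabsE normCK mulrC.
Qed.

Lemma frob_unitary n p (W : 'M[C]_n) (X : 'M[C]_(n, p)) : W \is unitarymx ->
  frob (W *m X) = frob X.
Proof.
move=> uW; apply: complexI; rewrite !frobE trmxC_mul mulmxA -(mulmxA (X^t* )).
rewrite (_ : W^t* *m W = 1%:M) ?mulmx1 //.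
by rewrite -(invmx_unitary uW) mulVmx // unitarymx_unit.
Qed.

Lemma gdet_unitary n p (W : 'M[C]_n) (X : 'M[C]_(n, p)) : W \is unitarymx ->
  gdet (W *m X) = gdet X.
Proof.
move=> uW; rewrite /gdet trmxC_mul mulmxA -(mulmxA (X^t* )).
rewrite (_ : W^t* *m W = 1%:M) ?mulmx1 //.
by rewrite -(invmx_unitary uW) mulVmx // unitarymx_unit.
Qed.

Lemma absdet_unitary n (W : 'M[C]_n) : W \is unitarymx -> absdet W = 1.
Proof.
move=> /unitarymxP WW; apply/eqP; rewrite -sqrp_eq1 ?absdet_ge0 // expr2.
by rewrite -{2}(absdet_ct W) -absdetM WW absdet1.
Qed.

Lemma frob_row_mx n p1 p2 (X : 'M[C]_(n, p1)) (Y : 'M[C]_(n, p2)) :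
  frob (row_mx X Y) = frob X + frob Y.
Proof.
rewrite /frob -big_split /=; apply: eq_bigr => a _.
rewrite big_split_ord; congr (_ + _); apply: eq_bigr => b _;
by rewrite ?row_mxEl ?row_mxEr.
Qed.

Lemma frob_col_mx n1 n2 p (X : 'M[C]_(n1, p)) (Y : 'M[C]_(n2, p)) :
  frob (col_mx X Y) = frob X + frob Y.
Proof.
rewrite /frob big_split_ord; congr (_ + _); apply: eq_bigr => a _;
by apply: eq_bigr => b _; rewrite ?col_mxEu ?col_mxEd.
Qed.

Lemma frob0 n p : frob (0 : 'M[C]_(n, p)) = 0.
Proof.
rewrite /frob big1 // => a _; rewrite big1 // => b _.
by rewrite mxE cabs0 expr0n.
Qed.

Lemma frob_eq0 n p (X : 'M[C]_(n, p)) : frob X = 0 -> X = 0.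
Proof.
move=> /eqP; rewrite psumr_eq0; last by move=> a _; apply: sumr_ge0 => b _; exact: sqr_ge0.
move=> /allP X0; apply/matrixP => a b; rewrite mxE.
have := X0 a (mem_index_enum _); rewrite /= psumr_eq0; last by move=> c _; exact: sqr_ge0.
move=> /allP /(_ b (mem_index_enum _)) /=.
by rewrite sqrf_eq0 cabs_eq0 => /eqP.
Qed.

(** [Z] is rectangular, so the determinant of the product cannot be split at once. Moving [Z^t*]
    from the left factor to the right one yields two square block triangular factors. *)
Lemma gdet_block n p (c : 'M[C]_1) (r : 'M[C]_(1, p)) (Z : 'M[C]_(n, p)) :
  gdet (block_mx c r 0 Z) = frob c * gdet Z.
Proof.
rewrite /gdet.
have -> : (block_mx c r 0 Z)^t* *m block_mx c r 0 Z =
    block_mx (c^t* ) 0 (r^t* ) 1%:M *m block_mx c r 0 (Z^t* *m Z).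
  rewrite tr_block_mx map_block_mx !mulmx_block trmx0 map_mx0.
  by rewrite !mul0mx !mulmx0 !addr0 mul1mx.
rewrite absdetM ![absdet (block_mx _ _ _ _)]absdetE det_lblock det_ublock det1 mulr1.
rewrite !cabsM -!absdetE absdet_ct mulrA; congr (_ * _).
by rewrite absdetE det_mx11 -expr2 /frob !big_ord1.
Qed.

(* A unitary [W] that maps the first column onto a multiple of the first basis
   vector reduces the Gram determinant by one row and one column. *)
Lemma gdet_first_column n (x : 'M[C]_(1 + n, 1)) : exists2 W : 'M[C]_(1 + n),
  W \is unitarymx & forall p (Y : 'M[C]_(1 + n, p)),
  gdet (row_mx x Y) = frob x * gdet (dsubmx (W *m Y)).
Proof.
(* Gram-Schmidt applied to a matrix with first row [x^t*] gives a unitary matrix whose first row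
   spans [x^t*]; this covers [x = 0] as well. *)
pose A : 'M[C]_(1 + n) := col_mx (x^t* ) 0.
pose W := schmidt A; have uW : W \is unitarymx by exact: schmidt_unitarymx.
exists W => // p Y.
pose i0 := lshift n (0 : 'I_1).
have /submxP[D DE] : (x^t* <= row i0 W)%MS.
  have -> : x^t* = row i0 A.
    by apply/rowP => j; rewrite [RHS]mxE col_mxEu.
  apply: submx_trans (row_schmidt_sub _ _) _.
  apply/sumsmx_subP => k; rewrite leqn0 => /eqP k0.
  by rewrite genmxE (_ : k = i0) //; apply: val_inj.
have Wx : W *m x = col_mx (D^t* ) 0.
  rewrite -[x]trmxCK DE trmxC_mul mulmxA.
  have -> : W *m (row i0 W)^t* = col_mx 1%:M 0.
    apply/matrixP => i j.
    transitivity ((W *m W^t* ) i i0).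
      by rewrite !mxE; apply: eq_bigr => k _; rewrite !mxE.
    rewrite (unitarymxP uW) !mxE ord1.
    by case: fintype.splitP => k ik; rewrite !mxE -val_eqE /= ik ?ord1.
  by rewrite mul_col_mx mul1mx mul0mx.
rewrite -(gdet_unitary (row_mx x Y) uW) mul_mx_row Wx.
rewrite -{1}(vsubmxK (W *m Y)) -block_mxEh gdet_block; congr (_ * _).
by rewrite -(frob_unitary x uW) Wx frob_col_mx frob0 addr0.
Qed.

End gram_reduction.

Section peeling.
Variable R : realType.
Local Notation C := R[i].
Local Notation mu := (@lebesgue_measure R).

Lemma mint_row_mx n p1 p2 (F : 'M[C]_(n, p1 + p2) -> \bar R) :
  mfun_mx F -> (forall X, 0 <= F X)%E ->
  mint F = mint (fun X : 'M[C]_(n, p1) => mint (fun Y : 'M[C]_(n, p2) => F (row_mx X Y))).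
Proof.
move=> mF F0.
have mFT : mfun_mx (fun Z : 'M[C]_(p1 + p2, n) => F Z^T).
  by apply: (measurable_mfun_mx mF); apply: mmeas_tr; exact: mmeas_mat.
rewrite mint_tr // mint_col_mx //.
rewrite mint_tr; last 2 first.
- apply: (mfun_mint (F := fun A B => F (col_mx A B)^T)) => //.
  by apply: (measurable_mfun_mx mF); apply: mmeas_tr; exact: mmeas_pair_col.
- by move=> X; exact: mint_ge0.
apply: eq_mint => X; rewrite mint_tr //; last first.
  apply: (measurable_mfun_mx mF); apply: mmeas_tr.
  by apply: mmeas_col; [exact: mmeas_cst|exact: mmeas_mat].
by apply: eq_mint => Y; rewrite tr_col_mx !trmxK.
Qed.

Lemma measurable_gdet d (T : measurableType d) n p (X : T -> 'M[C]_(n, p)) :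
  mmeas X -> measurable_fun [set: T] (fun x => gdet (X x)).
Proof. by move=> mX; apply: measurable_absdet; apply: mmeasM => //; exact: mmeas_ct. Qed.

End peeling.

Section wishart.
Variable R : realType.
Local Notation C := R[i].
Local Notation mu := (@lebesgue_measure R).

Let mexpfrob d (T : measurableType d) n p (X : T -> 'M[C]_(n, p)) :
  mmeas X -> measurable_fun [set: T] (fun x => expR (- frob (X x))).
Proof.
by move=> mX; apply: measurable_expR_comp; apply: measurable_funN; exact: measurable_frob.
Qed.

(** The rotation [W] attached to [x] preserves both Lebesgue measure and [frob]. After it the first
    row of [Y] has left the determinant, and its Gaussian integral is [pi ^ p]. *)
Lemma mint_gdet_column n p (x : 'M[C]_(1 + n, 1)) (F : R -> R) :
  measurable_fun [set: R] F -> (forall t, 0 <= F t) ->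
  mint (fun Y : 'M[C]_(1 + n, p) => (F (gdet (row_mx x Y)) * expR (- frob Y))%:E) =
  ((pi ^+ p)%:E * mint (fun Z : 'M[C]_(n, p) => (F (frob x * gdet Z) * expR (- frob Z))%:E))%E.
Proof.
move=> mF F0; have [W uW WE] := gdet_first_column x.
pose H (Y : 'M[C]_(1 + n, p)) := (F (frob x * gdet (dsubmx Y)) * expR (- frob Y))%:E.
have mH d (T : measurableType d) (Y : T -> 'M[C]_(n, p)) : mmeas Y ->
    measurable_fun [set: T] (fun t => F (frob x * gdet (Y t))).
  move=> mY; apply: (measurableT_comp mF); apply: measurable_funM => //.
  exact: measurable_gdet.
have mHH : mfun_mx H.
  apply/measurable_EFinP; apply: measurable_funM.
    apply: mH => a b; under eq_fun do rewrite mxE; exact: mmeas_mat.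
  by apply: mexpfrob; exact: mmeas_mat.
have H0 Y : (0 <= H Y)%E by rewrite lee_fin mulr_ge0 ?expR_ge0.
transitivity (mint H).
  rewrite (mint_mulmxl (unitarymx_unit uW) mHH H0) absdet_unitary // expr1n mul1e.
  by apply: eq_mint => Y; rewrite /H WE (frob_unitary Y uW).
rewrite mint_col_mx //.
have mZ : mfun_mx (fun Z : 'M[C]_(n, p) => (F (frob x * gdet Z) * expR (- frob Z))%:E).
  apply/measurable_EFinP; apply: measurable_funM.
    by apply: mH; exact: mmeas_mat.
  by apply: mexpfrob; exact: mmeas_mat.
have Z0 (Z : 'M[C]_(n, p)) : (0 <= (F (frob x * gdet Z) * expR (- frob Z))%:E)%E.
  by rewrite lee_fin mulr_ge0 ?expR_ge0.
transitivity (mint (fun r : 'M[C]_(1, p) =>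
  mint (fun Z : 'M[C]_(n, p) => (F (frob x * gdet Z) * expR (- frob Z))%:E) * (expR (- frob r))%:E)%E).
  apply: eq_mint => r; rewrite muleC -mintZl ?lee_fin ?expR_ge0 //.
  apply: eq_mint => Z; rewrite /H col_mxKd frob_col_mx opprD expRD -EFinM.
  by congr (_%:E); rewrite mulrCA.
rewrite muleC -[p in pi ^+ p]mul1n -mint_gauss -mintZl ?mint_ge0 //.
- by apply/measurable_EFinP; apply: mexpfrob; exact: mmeas_mat.
Qed.

(* Under the Gaussian weight, [gdet X] is distributed as the product of
   independent variables [frob x] (first column) and [gdet Y]. *)
Lemma gdet_same_law n p : exists v : R, [/\ 0 < v,
  v%:C = (pi ^+ n.+1)%:C / cGamma (n.+1%:R : C) &
  same_law (leb R (mcoord (1 + n) (1 + p))) (mu \x leb R (mcoord n p))%E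
    (fun u => gdet (mat u) : measurableTypeR R) (fun z => z.1 * gdet (mat z.2))
    (fun u => expR (- frob (mat u)))
    (fun z => v * pi ^+ p * (rpw z.1 n%:R * expR (- z.1)) * expR (- frob (mat z.2)))].
Proof.
have np0 : (0 < (1 + n) * 1)%N by rewrite muln1.
have [v v0 [vE vC]] := mint_frob R np0.
exists v; split=> //; first by rewrite vC muln1.
move=> F mF F0.
pose K (t : R) (Z : 'M[C]_(n, p)) := (F (t * gdet Z) * expR (- frob Z))%:E.
have K0 t Z : (0 <= K t Z)%E by rewrite lee_fin mulr_ge0 ?expR_ge0.
have mK : measurable_fun [set: measurableTypeR R * cspace R (mcoord n p)]
    (fun z => K z.1 (mat z.2)).
  apply/measurable_EFinP; apply: measurable_funM.
    apply: (measurableT_comp mF); apply: measurable_funM => //.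
    by apply: measurable_gdet; exact: mmeas_snd.
  by apply: mexpfrob; exact: mmeas_snd.
(* What remains after the last [p] columns are integrated out: a function of the first column
   through its squared norm alone, to which the radial law applies. The first column has [1 + n]
   complex entries, hence the power [n] in the density. *)
pose Phi (t : R) := ((expR (- t))%:E * ((pi ^+ p)%:E * mint (K t)))%E.
have mI : measurable_fun [set: measurableTypeR R] (fun t => mint (K t)).
  exact: (measurable_fun_fubini_tonelli_F (m2 := leb R (mcoord n p)) _ mK (fun z => K0 _ _)).
have mexp : measurable_fun [set: measurableTypeR R] (fun t : R => (expR (- t))%:E).
  by apply/measurable_EFinP; apply: measurable_expR_comp; exact: measurable_funN.
have mPhi : measurable_fun [set: measurableTypeR R] Phi.
  apply: emeasurable_funM => //; apply: emeasurable_funM => //; exact: measurable_cst.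
have I0 t : (0 <= mint (K t))%E by exact: mint_ge0.
have Phi0 t : (0 <= Phi t)%E.
  by rewrite mule_ge0 ?mule_ge0 // lee_fin ?expR_ge0 ?exprn_ge0 ?pi_ge0.
transitivity (mint (fun x : 'M[C]_(1 + n, 1) => Phi (frob x))).
  rewrite (_ : (\int[_]_x _)%E = mint (fun X : 'M[C]_(1 + n, 1 + p) =>
    (F (gdet X) * expR (- frob X))%:E)) // mint_row_mx; last 2 first.
  - apply/measurable_EFinP; apply: measurable_funM.
      by apply: (measurableT_comp mF); apply: measurable_gdet; exact: mmeas_mat.
    by apply: mexpfrob; exact: mmeas_mat.
  - by move=> X; rewrite lee_fin mulr_ge0 ?expR_ge0.
  apply: eq_mint => x; rewrite /Phi /K -mint_gdet_column // -mintZl; last 3 first.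
  - by rewrite lee_fin expR_ge0.
  - apply/measurable_EFinP; apply: measurable_funM.
      apply: (measurableT_comp mF); apply: measurable_gdet.
      by apply: mmeas_row; [exact: mmeas_cst|exact: mmeas_mat].
    by apply: mexpfrob; exact: mmeas_mat.
  - by move=> Y; rewrite lee_fin mulr_ge0 ?expR_ge0.
  apply: eq_mint => Y; rewrite frob_row_mx opprD expRD -EFinM; congr (_%:E).
  by rewrite mulrCA.
rewrite vE // muln1 /= fubini_tonelli1; last 2 first.
- apply/measurable_EFinP; apply: measurable_funM.
    apply: (measurableT_comp mF); apply: measurable_funM => //.
    by apply: measurable_gdet; exact: mmeas_snd.
  apply: measurable_funM; last by apply: mexpfrob; exact: mmeas_snd.
  apply: measurable_funM => //; apply: measurable_funM; first exact: measurable_rpw.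
  by apply: measurable_expR_comp; apply: measurable_funN.
- by move=> z; rewrite lee_fin !mulr_ge0 ?expR_ge0 ?rpw_ge0 ?exprn_ge0 ?pi_ge0 // ltW.
rewrite -ge0_integralZl //; last 3 first.
- apply: emeasurable_funM => //; apply/measurable_EFinP; exact: measurable_rpw.
- by move=> t _; rewrite mule_ge0 // lee_fin rpw_ge0.
- by rewrite lee_fin ltW.
apply: eq_integral => t _; rewrite /fubini_F /Phi.
rewrite [RHS](_ : _ = mint (fun Z => (v * pi ^+ p * (rpw t n%:R * expR (- t)))%:E * K t Z)%E).
  rewrite mintZl //; last 2 first.
  - by rewrite lee_fin !mulr_ge0 ?expR_ge0 ?rpw_ge0 ?exprn_ge0 ?pi_ge0 // ltW.
  - exact: (measurableT_comp mK (pair1_measurable (t : measurableTypeR R))).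
  rewrite !EFinM -!muleA; congr (_ * _)%E.
  rewrite muleCA; congr (_ * _)%E; rewrite [RHS]muleCA; congr (_ * _)%E.
  by rewrite muleC.
by apply: eq_integral => u _; rewrite /K /= -EFinM; congr (_%:E); ring.
Qed.

End wishart.

(** Base case for inductions on the number of columns and of blocks: the space without coordinates
    is a point of mass [1]. *)
Lemma cintegral_leb_empty (R : realType) (I : finType) : (I -> False) ->
  cintegrable (leb R I) setT (fun=> 1) /\ cintegral (leb R I) setT (fun=> 1) = 1.
Proof.
move=> I0; have l1 : leb R I setT = 1%E.
  have H := @leb_cbox R I (fun=> setT) (fun=> measurableT).
  rewrite (_ : cbox _ = setT) in H; last by apply/seteqP; split.
  by rewrite [LHS]H big1 // => i; case: (I0 i).
have i1 : (leb R I).-integrable setT (EFin \o (fun=> 1 : R)).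
  apply/integrableP; split; first exact: measurable_cst.
  under eq_integral do rewrite /= normr1.
  by rewrite integral_cst // mul1e [X in (X < _)%E]l1 ltry.
have [ii ->] := cintegral_real i1; split => //.
by rewrite Rintegral_cst // [X in fine X]l1 mulr1.
Qed.

Section wishart_complex.
Variable R : realType.
Local Notation C := R[i].
Local Notation mu := (@lebesgue_measure R).

Definition gdet_gauss n p (a : C) (X : 'M[C]_(n, p)) : C :=
  pw (gdet X) a * (expR (- frob X))%:C.

Lemma cmeas_gdet_gauss d (T : measurableType d) n p (a : C) (X : T -> 'M[C]_(n, p)) :
  mmeas X -> cmeas (fun t => gdet_gauss a (X t)).
Proof.
move=> mX; apply: cmeasM; first by apply: cmeas_pw; exact: measurable_gdet.
apply: cmeas_real; apply: measurable_expR_comp; apply: measurable_funN.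
exact: measurable_frob.
Qed.

(** The recursion that mirrors the removal of one column: the exponent of [pi] grows by [p] and the
    argument drops by [1]. *)
Lemma mxGammaS p (z : C) :
  mxGamma p.+1 z = (pi ^+ p)%:C * cGamma z * mxGamma p (z - 1).
Proof.
rewrite /mxGamma big_ord_recl subr0.
have -> : ((p.+1 * p.+1.-1)./2 = p + (p * p.-1)./2)%N.
  rewrite -[p.+1.-1]/p (_ : p.+1 * p = p.*2 + p * p.-1)%N.
    by rewrite halfD odd_double /= doubleK.
  by case: p => // q; rewrite -[q.+1.-1]/q -mul2n; ring.
rewrite exprD rmorphM -!mulrA; congr (_ * _); rewrite mulrCA; congr (_ * (_ * _)).
by apply: eq_bigr => i _; rewrite lift0 -addn1 natrD opprD addrA addrAC.
Qed.

(** The normalisation of the complex Wishart density. Removing a row and a column multiplies the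
    moment by [v * pi ^ p] and the gamma value at [a + n.+1], where [v] is [pi ^ n.+1] over the
    gamma value at [n.+1]; both sides obey this recursion. The exponent [a] is unchanged, and so is
    the difference between the numbers of rows and columns. *)
Lemma wishart_integral n p (a : C) : (p <= n)%N ->
  p%:R - 1 < complex.Re (a + n%:R) ->
  cintegrable (leb R (mcoord n p)) setT (fun u => gdet_gauss a (mat u)) /\
  cintegral (leb R (mcoord n p)) setT (fun u => gdet_gauss a (mat u)) * mxGamma p n%:R =
  (pi ^+ (n * p))%:C * mxGamma p (a + n%:R).
Proof.
elim: p n => [|p IH] n.
  move=> _ _; have K1 (u : cspace R (mcoord n 0)) : gdet_gauss a (mat u) = (1 : R)%:C.
    rewrite /gdet_gauss /gdet absdetE det_mx00 cabs1 pw1 mul1r /frob.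
    by rewrite big1 ?oppr0 ?expR0 // => i _; rewrite big_ord0.
  have [i1 e1] := cintegral_leb_empty R (I := mcoord n 0) (fun c => match c with (_, b, _) => notF (ltn_ord b) end).
  rewrite (funext K1); split=> //.
  by rewrite e1 muln0 /mxGamma !big_ord0 mulr1 mul1r.
case: n => // n pn are.
rewrite -[n.+1]/(1 + n)%N -[p.+1]/(1 + p)%N.
have [v [v0 vC law]] := gdet_same_law R n p.
have are' : p%:R - 1 < complex.Re (a + n%:R).
  move: are; rewrite -!natr1 addrA; case: (a + n%:R) => x y /=; lra.
have [iI eI] := IH n pn are'.
have a0 : 0 < complex.Re (a + n.+1%:R).
  by apply: le_lt_trans are; rewrite subr_ge0 ler1n.
have [iG eG] := cintegralZl (v * pi ^+ p)%:C (integrable_gamma_fun a0).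
have [iP eP] := cintegral_prod iG iI.
have E (z : measurableTypeR R * cspace R (mcoord n p)) :
    pw (z.1 * gdet (mat z.2)) a *
    (v * pi ^+ p * (rpw z.1 n%:R * expR (- z.1)) * expR (- frob (mat z.2)))%:C =
    (v * pi ^+ p)%:C * gamma_fun (a + n.+1%:R) z.1 * gdet_gauss a (mat z.2).
  rewrite /gamma_fun /gdet_gauss -natr1 addrA addrK pwD.
  (* For negative [t] both sides vanish by the convention on [pw]; multiplicativity is available for
     nonnegative arguments. *)
  have [t0|t0] := leP 0 z.1; last first.
    by rewrite pw0 ?mulr_le0_ge0 ?gdet_ge0 ?(ltW t0) // pw0 ?(ltW t0) // !(mul0r, mulr0).
  rewrite pwM ?gdet_ge0 // -[n%:R in RHS](rmorph_nat (real_complex R)) pw_real.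
  rewrite !rmorphM /=; ring.
have [i1 e1] : cintegrable (leb R (mcoord (1 + n) (1 + p))) setT
      (fun u => gdet_gauss a (mat u)) /\
    cintegral (leb R (mcoord (1 + n) (1 + p))) setT (fun u => gdet_gauss a (mat u)) =
    cintegral (mu \x leb R (mcoord n p))%E setT (fun z =>
      (v * pi ^+ p)%:C * gamma_fun (a + n.+1%:R) z.1 * gdet_gauss a (mat z.2)).
  rewrite -(funext E).
  apply: (complex_transfer (G := fun t : measurableTypeR R => pw t a) _ _ _ _ law).
  - by apply: measurable_gdet; exact: mmeas_mat.
  - apply: measurable_expR_comp; apply: measurable_funN; exact: measurable_mfrob.
  - by move=> u; exact: expR_ge0.
  - by move=> z; rewrite !mulr_ge0 ?expR_ge0 ?rpw_ge0 ?exprn_ge0 ?pi_ge0 // ltW.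
  - exact: cmeas_pw.
  - by rewrite (funext E).
split=> //; rewrite e1 eP eG -cGammaE.
rewrite -[(1 + p)%N]/p.+1 -[(1 + n)%N]/n.+1 !mxGammaS.
have -> : n.+1%:R - 1 = n%:R :> C by rewrite -natr1 addrK.
have -> : a + n.+1%:R - 1 = a + n%:R by rewrite -natr1 addrA addrK.
rewrite rmorphM /= vC.
have G0 := cGamma_nat_neq0 R n.
rewrite (_ : n.+1 * p.+1 = n.+1 + p + n * p)%N; last by ring.
rewrite !exprD !rmorphM /=; move: eI; set I := cintegral _ _ _ => eI.
transitivity ((pi ^+ n.+1)%:C * (pi ^+ p)%:C * ((pi ^+ p)%:C *
   cGamma (a + n.+1%:R)) * (I * mxGamma p n%:R)); first by field.
by rewrite eI; ring.
Qed.

End wishart_complex.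

(** * The type-2 Dirichlet integral *)

Section posdef.
Variable R : realType.
Local Notation C := R[i].

(** From the spectral decomposition, with [L] the diagonal of square roots times the eigenbasis.
    Eigenvalues are positive by testing the form on the eigenvectors [P^t* e_j]. It serves both for
    the matrices [B_j] and for the identity plus the sum of Gram matrices. *)
Lemma herm_posdef_factor n (B : 'M[C]_n) : herm_posdef B ->
  exists2 L : 'M[C]_n, L \in unitmx & B = L^t* *m L.
Proof.
move=> [hB pB]; have BE := orthomx_spectralP (hermitian_normalmx hB).
set P := spectralmx B in BE; set sp := spectral_diag B in BE.
have uP : P \is unitarymx := spectral_unitarymx B.
have PP := unitarymxP uP.
have PV : invmx P = P^t* := invmx_unitary uP.
have sp_gt0 j : 0 < sp 0 j.
  pose v := P^t* *m (delta_mx j 0 : 'cV[C]_n).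
  have v0 : v != 0.
    apply: contraTneq isT => v0; have := congr1 (mulmx P) v0.
    rewrite /v mulmxA PP mul1mx mulmx0 => /matrixP/(_ j 0)/eqP.
    by rewrite !mxE !eqxx oner_eq0.
  have ej : (delta_mx j 0 : 'cV[C]_n)^t* = delta_mx 0 j.
    by rewrite trmx_delta; apply/matrixP => a b; rewrite !mxE rmorph_nat.
  have E : v^t* *m B *m v = row j (diag_mx sp) *m delta_mx j 0.
    rewrite rowE -ej BE PV /v trmxC_mul trmxCK !mulmxA.
    by rewrite -(mulmxA _ P (P^t* )) PP mulmx1 -(mulmxA _ P (P^t* )) PP mulmx1.
  by have := pB v v0; rewrite E -colE !mxE eqxx mulr1n.
pose L := diag_mx (\row_j sqrtC (sp 0 j)) *m P.
exists L.
  rewrite unitmx_mul spectral_unit andbT unitmxE det_diag unitfE.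
  by apply/prodf_neq0 => j _; rewrite mxE sqrtC_eq0 gt_eqF.
rewrite /L trmxC_mul {1}BE PV mulmxA; congr (_ *m _); rewrite -mulmxA; congr (_ *m _).
rewrite tr_diag_mx map_diag_mx mulmx_diag; congr diag_mx; apply/rowP => j.
by rewrite !mxE mulrC -normCK ger0_norm ?sqrtC_ge0 ?(ltW (sp_gt0 j)) // sqrtCK.
Qed.

Lemma frob_ct n p (X : 'M[C]_(n, p)) : frob (X^t* ) = frob X.
Proof.
rewrite /frob exchange_big; apply: eq_bigr => a _; apply: eq_bigr => b _.
by rewrite !mxE; congr (_ ^+ 2); exact: cabs_conj.
Qed.

Lemma gdetM n p (X : 'M[C]_(n, p)) (A : 'M[C]_p) :
  gdet (X *m A) = absdet A ^+ 2 * gdet X.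
Proof.
by rewrite /gdet trmxC_mul -!mulmxA absdetM absdet_ct !mulmxA absdetM expr2; ring.
Qed.

Lemma gdet_square n (X : 'M[C]_n) : gdet X = absdet X ^+ 2.
Proof. by rewrite /gdet absdetM absdet_ct. Qed.

Lemma pwV (x : R) (a : C) : pw x^-1 a = pw x (- a).
Proof.
rewrite /pw invr_gt0; case: ifP => // x0.
by rewrite /cpow lnV ?posrE // rmorphN mulrN mulNr.
Qed.

(** Substitution of [L X A] for the Gaussian variable. The Jacobian contributes [|det L| ^ (- 2 p)]
    and [|det A| ^ (- 2 n)]. Since [A] occurs in the exponential but not in the Gram determinant, a
    further [|det A| ^ (- 2 a)] appears, which makes the exponent [- (a + n)]. *)
Lemma cintegral_gdet_linear n p (L : 'M[C]_n) (A : 'M[C]_p) (a : C) :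
  L \in unitmx -> A \in unitmx ->
  cintegrable (leb R (mcoord n p)) setT (fun u => gdet_gauss a (mat u)) ->
  cintegrable (leb R (mcoord n p)) setT (fun u =>
    pw (gdet (L *m mat u)) a * (expR (- frob (L *m mat u *m A)))%:C) /\
  cintegral (leb R (mcoord n p)) setT (fun u =>
    pw (gdet (L *m mat u)) a * (expR (- frob (L *m mat u *m A)))%:C) =
  pw (absdet A ^+ 2) (- (a + n%:R)) * ((absdet L ^+ 2) ^- p)%:C *
    cintegral (leb R (mcoord n p)) setT (fun u => gdet_gauss a (mat u)).
Proof.
move=> uL uA iK.
have L0 : 0 < absdet L by rewrite absdet_gt0.
have A0 : 0 < absdet A by rewrite absdet_gt0.
pose s := absdet L ^+ (2 * p) * absdet A ^+ (2 * n).
have s0 : 0 < s by rewrite mulr_gt0 ?exprn_gt0.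
pose phi u := unmat (L *m mat u *m A) : cspace R (mcoord n p).
have mphi : measurable_fun [set: cspace R (mcoord n p)] phi.
  apply: measurable_unmat; apply: mmeasM; last exact: mmeas_cst.
  by apply: mmeasM; [exact: mmeas_cst|exact: mmeas_mat].
have law : same_law (leb R (mcoord n p)) (leb R (mcoord n p)) phi id (fun=> s) (fun=> 1).
  move=> F mF F0.
  have mF' : mfun_mx (fun X : 'M[C]_(n, p) => (F (unmat X))%:E).
    apply/measurable_EFinP; apply: (measurableT_comp mF).
    by apply: measurable_unmat; exact: mmeas_mat.
  have F'0 (X : 'M[C]_(n, p)) : (0 <= (F (unmat X))%:E)%E by rewrite lee_fin.
  transitivity (mint (fun X : 'M[C]_(n, p) => (F (unmat X))%:E)); last first.
    by apply: eq_integral => u _; rewrite matK mulr1.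
  have mFL : mfun_mx (fun X : 'M[C]_(n, p) => (F (unmat (L *m X)))%:E).
    by have := mfun_mulmxl L mF'.
  rewrite (mint_mulmxl uL mF' F'0) (mint_mulmxr uA mFL) // muleA -EFinM -/s.
  rewrite -mintZl ?lee_fin ?(ltW s0) //; last first.
    apply/measurable_EFinP; apply: (measurableT_comp mF); apply: measurable_unmat.
    apply: mmeasM; first exact: mmeas_cst.
    by apply: mmeasM; [exact: mmeas_mat|exact: mmeas_cst].
  by apply: eq_integral => u _; rewrite /phi mulmxA mulrC EFinM.
have iK1 : cintegrable (leb R (mcoord n p)) setT (fun u => gdet_gauss a (mat u) * 1%:C).
  by under eq_fun do rewrite mulr1.
have [i1 e1] := complex_transfer (G := fun u => gdet_gauss a (mat u)) mphi
  (measurable_cst s) (fun=> ltW s0) (fun=> ler01) law (cmeas_gdet_gauss _ (@mmeas_mat R n p)) iK1.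
pose c := pw (absdet A ^+ 2) (- a) * (s^-1)%:C.
have cE u : c * (gdet_gauss a (mat (phi u)) * s%:C) =
    pw (gdet (L *m mat u)) a * (expR (- frob (L *m mat u *m A)))%:C.
  rewrite /c /phi unmatK /gdet_gauss gdetM pwM ?gdet_ge0 ?exprn_ge0 ?(ltW A0) //.
  set g := pw (gdet _) a; set e := (expR _)%:C.
  transitivity (pw (absdet A ^+ 2) (- a + a) * (s^-1 * s)%:C * (g * e)).
    by rewrite pwD [(s^-1 * s)%:C]rmorphM; ring.
  rewrite addNr mulVf ?gt_eqF // mulr1 -[RHS]mul1r; congr (_ * _).
  by rewrite -[0](rmorph0 (real_complex R)) pw_real /rpw exprn_gt0 // mul0r expR0.
have [i2 e2] := cintegralZl c i1.
rewrite (funext cE) in i2 e2; split=> //.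
rewrite e2 e1 /c; under eq_cintegral do rewrite mulr1; congr (_ * _).
rewrite opprD pwD -!mulrA; congr (_ * _).
rewrite -pwV pw_nat ?invr_gt0 ?exprn_gt0 // -rmorphM /=; congr (_%:C).
by rewrite /s invfM mulrC !exprM exprVn.
Qed.

End posdef.

(** * Integrals of products over the blocks *)

Section blocks_product.
Variable R : realType.
Local Notation C := R[i].

Lemma cintegral_join (I J K : finType) (h : I -> J + K) (G : cspace R I -> C) :
  bijective h -> cmeas G ->
  cintegrable (leb R J \x leb R K)%E setT (fun z => G (join_cd h z)) ->
  cintegrable (leb R I) setT G /\
  cintegral (leb R I) setT G =
  cintegral (leb R J \x leb R K)%E setT (fun z => G (join_cd h z)).
Proof.
move=> bh mG iG.
have law : same_law (leb R I) (leb R J \x leb R K)%E (id : cspace R I -> cspace R I)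
    (join_cd h) (fun=> 1) (fun=> 1).
  move=> F mF F0; under eq_integral do rewrite mulr1.
  under [RHS]eq_integral do rewrite mulr1.
  rewrite (leb_join bh (F := fun u => (F u)%:E)) //; first exact/measurable_EFinP.
have := complex_transfer (@measurable_id _ (cspace R I) setT)
  (measurable_cst (1 : R)) (fun=> ler01) (fun=> ler01) law mG.
under eq_fun do rewrite mulr1.
rewrite (_ : (fun x : cspace R I => G x * 1%:C) = G); last first.
  by apply/funext => x; rewrite mulr1.
exact.
Qed.

Lemma blocksE p k (n : 'I_k -> nat) (u : cspace R (Defs.coord p n)) j :
  blocks u j = mat (vec (fun c : mcoord (n j) p =>
    cd u (Tagged (fun j => mcoord (n j) p) c : Defs.coord p n))).
Proof. by apply/matrixP => a b; rewrite !mxE !cd_vec. Qed.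

Lemma mmeas_blocks p k (n : 'I_k -> nat) j :
  mmeas (fun u : cspace R (Defs.coord p n) => blocks u j).
Proof.
under eq_fun do rewrite blocksE.
apply: (mmeas_comp (@mmeas_mat R (n j) p)); apply: measurable_fun_vec => c.
exact: measurable_cd.
Qed.

(** The inverse [g] has a direct definition by matching, and [h] is chosen from its bijectivity. Its
    values on tagged coordinates are all that later arguments use. *)
Lemma coord_split p k (n : 'I_k.+1 -> nat) :
  exists2 h : Defs.coord p n -> mcoord (n ord0) p + Defs.coord p (fun j => n (lift ord0 j)),
  bijective h &
  (forall c : mcoord (n ord0) p,
     h (Tagged (fun j => mcoord (n j) p) c) = inl c) /\
  (forall j (c : mcoord (n (lift ord0 j)) p),
     h (Tagged (fun j => mcoord (n j) p) c) =
     inr (Tagged (fun j => mcoord (n (lift ord0 j)) p) c)).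
Proof.
pose g (s : mcoord (n ord0) p + Defs.coord p (fun j => n (lift ord0 j))) : Defs.coord p n :=
  match s with
  | inl c => Tagged (fun j => mcoord (n j) p) c
  | inr (existT j c) => @Tagged _ (lift ord0 j) (fun j => mcoord (n j) p) c
  end.
have g_surj s : exists t, g t = s.
  case: s => j; case: (unliftP ord0 j) => [j' ->|->] c.
    by exists (inr (Tagged (fun j => mcoord (n (lift ord0 j)) p) c)).
  by exists (inl c).
have g_inj : injective g.
  move=> [c|[j c]] [c'|[j' c']] /= E.
  - by move/eqP: E; rewrite eq_Tagged => /eqP /= ->.
  - by have /= := congr1 tag E.
  - by have /= := congr1 tag E.
  - have /= /lift_inj jj := congr1 tag E; subst j'.
    by move/eqP: E; rewrite eq_Tagged => /eqP /= ->.
pose h s := sval (cid (g_surj s)).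
have hK : cancel h g by move=> s; exact: svalP (cid (g_surj s)).
have gK : cancel g h by move=> t; apply: g_inj; rewrite hK.
exists h; first by exists g.
by split=> [c|j c]; [exact: (gK (inl c))|exact: (gK (inr (Tagged _ c)))].
Qed.

Lemma cintegral_blocks p k (n : 'I_k -> nat) (f : forall j, 'M[C]_(n j, p) -> C) :
  (forall j, cintegrable (leb R (mcoord (n j) p)) setT (fun u => f j (mat u))) ->
  cintegrable (leb R (Defs.coord p n)) setT (fun u => \prod_j f j (blocks u j)) /\
  cintegral (leb R (Defs.coord p n)) setT (fun u => \prod_j f j (blocks u j)) =
  \prod_j cintegral (leb R (mcoord (n j) p)) setT (fun u => f j (mat u)).
Proof.
elim: k n f => [|k IH] n f fi.
  have [i1 e1] := cintegral_leb_empty R (I := Defs.coord p n) (fun c => notF (ltn_ord (tag c))).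
  rewrite big_ord0 (_ : (fun u => _) = (fun=> 1)) //.
  by apply/funext => u; rewrite big_ord0.
have [h bh [h0 hS]] := coord_split p n.
have [iS eS] := IH (fun j => n (lift ord0 j)) (fun j => f (lift ord0 j)) (fun j => fi _).
have [iP eP] := cintegral_prod (fi ord0) iS.
have E z : \prod_j f j (blocks (join_cd h z) j) =
    f ord0 (mat z.1) * \prod_j f (lift ord0 j) (blocks z.2 j).
  rewrite big_ord_recl; congr (_ * _).
    congr (f _ _); rewrite blocksE; congr mat; rewrite -[RHS]vec_cd; congr vec.
    by apply/funext => c; rewrite /join_cd cd_vec h0.
  apply: eq_bigr => j _; congr (f _ _).
  by rewrite !blocksE; congr mat; congr vec; apply/funext => c; rewrite /join_cd cd_vec hS.
have mf : cmeas (fun u : cspace R (Defs.coord p n) => \prod_j f j (blocks u j)).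
  apply: cmeas_prod => j.
  have -> : (fun u : cspace R (Defs.coord p n) => f j (blocks u j)) =
      (fun u => f j (mat (unmat (blocks u j)))).
    by apply/funext => u; rewrite unmatK.
  apply: (cmeas_comp (cintegrable_cmeas (fi j))).
  by apply: measurable_unmat; exact: mmeas_blocks.
have [] := cintegral_join bh mf; first by rewrite (funext E).
move=> i1 ->; split=> //.
by rewrite (funext E) eP eS big_ord_recl.
Qed.

End blocks_product.

(** Positivity matters for the empty sum: [pw x 0] is [1] for positive [x] and [0] otherwise. *)
Lemma pw_sum (R : realType) (x : R) (I : Type) (r : seq I) (b : I -> R[i]) : 0 < x ->
  pw x (\sum_(i <- r) b i) = \prod_(i <- r) pw x (b i).
Proof.
move=> x0; apply: (big_morph (pw x)) => [c e|]; first exact: pwD.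
by rewrite (pw_nat 0 x0) expr0.
Qed.

(** * The joint integrand and its two iterated integrals *)

Section joint_integrand.
Variables (R : realType) (p k : nat) (n : 'I_k -> nat).
Local Notation C := R[i].
Variables (L : forall j, 'M[C]_(n j)).
Hypotheses (n_ge : forall j, (p <= n j)%N) (uL : forall j, L j \in unitmx).
Local Notation X u j := (blocks u j).
Local Notation T := (cspace R (Defs.coord p n)).
Local Notation S := (cspace R (mcoord p p)).

Definition gramsum (u : T) : 'M[C]_p :=
  1%:M + \sum_j (L j *m X u j)^t* *m (L j *m X u j).

(** The identity makes the form positive definite whatever the blocks are. The factor [A] turns the
    trace of [Z (I + S) Z^*] into [frob (Z A)], which a substitution in [Z] can absorb. *)
Lemma gramsum_factor u : exists2 A : 'M[C]_p, A \in unitmx & gramsum u = A *m A^t*.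
Proof.
have [|A uA AE] := @herm_posdef_factor R p (gramsum u).
  have hg : (gramsum u)^t* = gramsum u.
    rewrite /gramsum linearD /= map_mxD trmx1 map_mx1; congr (_ + _).
    rewrite linear_sum /= raddf_sum /=; apply: eq_bigr => j _.
    by rewrite trmxC_mul trmxCK.
  split.
    by apply/is_hermitianmxP; rewrite expr0 scale1r hg.
  move=> v v0.
  have -> : v^t* *m gramsum u *m v =
      v^t* *m v + \sum_j (L j *m X u j *m v)^t* *m (L j *m X u j *m v).
    rewrite /gramsum mulmxDr mulmx1 mulmxDl; congr (_ + _).
    rewrite mulmx_sumr mulmx_suml; apply: eq_bigr => j _.
    by rewrite [((_ *m v) ^t* )]trmxC_mul !mulmxA.
  have tr1 (M : 'M[C]_1) : M 0 0 = \tr M by rewrite /mxtrace big_ord1.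
  rewrite tr1 raddfD raddf_sum /= -frobE.
  apply: ltr_pwDl.
    rewrite ltcR lt_neqAle frob_ge0 andbT eq_sym.
    by apply: contra_neq v0; exact: frob_eq0.
  by apply: sumr_ge0 => j _; rewrite -frobE ler0c frob_ge0.
by exists (A^t* ); rewrite ?trmxCK // unitmxE unitfE -cabs_eq0 -absdetE absdet_ct cabs_eq0
  -unitfE -unitmxE.
Qed.

(** Two readings of one quadratic form: the left side suits the integration over [Z], the right side
    splits over the blocks and suits the integration over the [X_j]. *)
Lemma frob_gramsum u (A Z : 'M[C]_p) : gramsum u = A *m A^t* ->
  frob (Z *m A) = frob Z + \sum_j frob (L j *m X u j *m Z^t* ).
Proof.
move=> AE; apply: complexI; rewrite rmorphD /=.
rewrite -[frob (Z *m A)]frob_ct -[frob Z]frob_ct !frobE !trmxCK trmxC_mul mulmxA.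
rewrite -(mulmxA Z) -AE /gramsum mulmxDr mulmx1 mulmxDl raddfD /=; congr (_ + _).
rewrite mulmx_sumr mulmx_suml raddf_sum rmorph_sum /=; apply: eq_bigr => j _.
by rewrite frobE [((_ *m Z^t* ) ^t* )]trmxC_mul trmxCK !mulmxA.
Qed.

Section complex_parameters.
Variables (a : 'I_k -> C) (al : C).

Definition tot : C := \sum_j (a j + (n j)%:R) + al.

(** The power of [gdet Z] is lowered by [p] because the substitution absorbing [A] has Jacobian
    [|det A| ^ (- 2 p)]; together they leave exactly the exponent [- tot] on [gramsum]. *)
Definition joint (z : T * S) : C :=
  (\prod_j (pw (gdet (L j *m X z.1 j)) (a j) *
            (expR (- frob (L j *m X z.1 j *m (mat z.2)^t* )))%:C)) *
  gdet_gauss (tot - p%:R) (mat z.2).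

Definition marginal (u : T) : C :=
  (\prod_j pw (gdet (L j *m X u j)) (a j)) * pw (absdet (gramsum u)) (- tot).

Definition gauss_int m q (b : C) : C :=
  cintegral (leb R (mcoord m q)) setT (fun u => gdet_gauss b (mat u)).

Definition joint_const : C :=
  \prod_j (((absdet (L j) ^+ 2) ^- p)%:C * gauss_int (n j) p (a j)).

Hypotheses (a_re : forall j, p%:R - 1 < complex.Re (a j + (n j)%:R))
  (al_re : p%:R - 1 < complex.Re al) (p_gt0 : (0 < p)%N).

Let tot_re : p%:R - 1 < complex.Re tot.
Proof.
have ReD (x y : C) : complex.Re (x + y) = complex.Re x + complex.Re y.
  by case: x; case: y.
have p0 : 0 <= p%:R - 1 :> R by rewrite subr_ge0 ler1n.
rewrite /tot ReD; apply: lt_le_trans al_re _; rewrite lerDr.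
elim/big_ind: _ => //.
- by move=> x y x0 y0; rewrite ReD addr_ge0.
- by move=> j _; apply: le_trans p0 (ltW (a_re j)).
Qed.

Let gauss_ii b : p%:R - 1 < complex.Re b ->
  cintegrable (leb R (mcoord p p)) setT (fun u => gdet_gauss (b - p%:R) (mat u)) /\
  gauss_int p p (b - p%:R) * mxGamma p p%:R = (pi ^+ (p * p))%:C * mxGamma p b.
Proof.
move=> b_re; have := @wishart_integral R p p (b - p%:R) (leqnn p).
by rewrite subrK => /(_ b_re).
Qed.

Lemma cmeas_joint : cmeas joint.
Proof.
apply: cmeasM; last first.
  by apply: cmeas_gdet_gauss; exact: mmeas_snd.
have mX j : mmeas (fun z : T * S => L j *m X z.1 j).
  apply: mmeasM; first exact: mmeas_cst.
  by apply: (mmeas_comp (@mmeas_blocks R p k n j)).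
apply: cmeas_prod => j; apply: cmeasM.
  by apply: cmeas_pw; exact: measurable_gdet.
apply: cmeas_real; apply: measurable_expR_comp; apply: measurable_funN.
apply: measurable_frob; apply: mmeasM => //.
by apply: mmeas_ct; exact: mmeas_snd.
Qed.

(** For fixed blocks all exponentials merge into [exp (- frob (Z A))], and the substitution for [A]
    leaves a Gaussian moment that is independent of the blocks. *)
Lemma joint_integral_snd u :
  cintegrable (leb R (mcoord p p)) setT (fun z => joint (u, z)) /\
  cintegral (leb R (mcoord p p)) setT (fun z => joint (u, z)) =
  marginal u * gauss_int p p (tot - p%:R).
Proof.
have [A uA AE] := gramsum_factor u.
have [i0 _] := gauss_ii tot_re.
have [i1 e1] := cintegral_gdet_linear (unitmx1 C p) uA i0.
have [i2 e2] := cintegralZl (\prod_j pw (gdet (L j *m X u j)) (a j)) i1.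
have E z : \prod_j pw (gdet (L j *m X u j)) (a j) *
    (pw (gdet (1%:M *m mat z)) (tot - p%:R) * (expR (- frob (1%:M *m mat z *m A)))%:C) =
    joint (u, z).
  rewrite /joint big_split /= -!mulrA; congr (_ * _).
  rewrite /gdet_gauss mul1mx mulrCA; congr (_ * _).
  rewrite -[RHS]mulrC -rmorph_prod -rmorphM /=; congr (_%:C).
  rewrite -expR_sum -expRD; congr expR; rewrite sumrN -opprD; congr (- _).
  by rewrite (frob_gramsum _ AE) addrC.
rewrite (funext E) in i2 e2; split; first exact: i2.
rewrite e2 e1 /marginal subrK absdet1 !expr1n invr1 mulr1 mulrA; congr (_ * _ * _).
by rewrite AE absdetM absdet_ct.
Qed.

(** For invertible [Z] block [j] contributes [gdet Z] to the power [- (a j + n j)], and subtracting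
    all of these from [tot - p] leaves [al - p]. For singular [Z] both sides vanish, so the identity
    holds at every [Z], as the Fubini lemmas demand. *)
Lemma joint_integral_fst z :
  cintegrable (leb R (Defs.coord p n)) setT (fun u => joint (u, z)) /\
  cintegral (leb R (Defs.coord p n)) setT (fun u => joint (u, z)) =
  joint_const * gdet_gauss (al - p%:R) (mat z).
Proof.
have [uZ|uZ] := boolP (mat z \in unitmx); last first.
  have gZ : gdet (mat z) = 0.
    rewrite gdet_square; move: uZ.
    by rewrite -absdet_gt0 lt_neqAle absdet_ge0 andbT negbK => /eqP <-; rewrite expr0n.
  have g0 b : gdet_gauss b (mat z) = 0 by rewrite /gdet_gauss gZ pw0 // mul0r.
  have j0 u : joint (u, z) = (0 : R)%:C by rewrite /joint g0 mulr0.
  have [i0 e0] := cintegral_real (integrable0 (leb R (Defs.coord p n)) setT).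
  rewrite (funext j0); split; first exact: i0.
  by rewrite e0 g0 mulr0 /Rintegral integral0.
have uZt : (mat z)^t* \in unitmx.
  by rewrite -absdet_gt0 absdet_ct absdet_gt0.
have fi j := cintegral_gdet_linear (uL j) uZt (wishart_integral (n_ge j) (a_re j)).1.
have [i1 e1] := cintegral_blocks (f := fun j Y => pw (gdet (L j *m Y)) (a j) *
  (expR (- frob (L j *m Y *m (mat z)^t* )))%:C) (fun j => (fi j).1).
have [i2 e2] := cintegralZl (gdet_gauss (tot - p%:R) (mat z)) i1.
have E u : gdet_gauss (tot - p%:R) (mat z) * \prod_j (pw (gdet (L j *m X u j)) (a j) *
    (expR (- frob (L j *m X u j *m (mat z)^t* )))%:C) = joint (u, z).
  by rewrite mulrC.
rewrite (funext E) in i2 e2; split; first exact: i2.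
rewrite e2 e1 (eq_bigr _ (fun j _ => (fi j).2)) absdet_ct -gdet_square.
have g0 : 0 < gdet (mat z) by rewrite gdet_square exprn_gt0 // absdet_gt0.
under eq_bigr do rewrite -mulrA.
rewrite big_split /= -/joint_const mulrA mulrC; congr (_ * _).
rewrite /gdet_gauss mulrAC; congr (_ * _).
rewrite -pw_sum // -pwD; congr (pw _ _).
by rewrite /tot sumrN; ring.
Qed.

End complex_parameters.
End joint_integrand.

Lemma mxGamma_real_neq0 (R : realType) p (x : R) :
  p%:R - 1 < x -> mxGamma p (x%:C : R[i]) != 0.
Proof.
move=> px; rewrite mulf_neq0 //.
  rewrite -(rmorph0 (real_complex R)); apply: contra_neq (@complexI R _ _) _.
  by rewrite expf_neq0 // gt_eqF // pi_gt0.
apply/prodf_neq0 => i _.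
rewrite -[i%:R](rmorph_nat (real_complex R)) -rmorphB gt_eqF // cGamma_real_gt0 //.
rewrite subr_gt0; apply: le_lt_trans px.
by rewrite lerBrDr natr1 ler_nat.
Qed.

Section marginal_integral.
Variables (R : realType) (p k : nat) (n : 'I_k -> nat).
Local Notation C := R[i].
Variables (L : forall j, 'M[C]_(n j)).
Hypotheses (p_gt0 : (0 < p)%N) (n_ge : forall j, (p <= n j)%N)
  (uL : forall j, L j \in unitmx).
Local Notation T := (cspace R (Defs.coord p n)).
Local Notation S := (cspace R (mcoord p p)).

Let ReD (x y : C) : complex.Re (x + y) = complex.Re x + complex.Re y.
Proof. by case: x; case: y. Qed.

Let Re_nat (m : nat) : complex.Re (m%:R : C) = m%:R.
Proof. by rewrite -(rmorph_nat (real_complex R)). Qed.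

Let Re_sum (I : Type) (r : seq I) (f : I -> C) :
  complex.Re (\sum_(i <- r) f i) = \sum_(i <- r) complex.Re (f i).
Proof. by apply: (big_morph (@complex.Re R)) => // x y; exact: ReD. Qed.

Let cabs_prod (I : Type) (r : seq I) (f : I -> C) :
  cabs (\prod_(i <- r) f i) = \prod_(i <- r) cabs (f i).
Proof. by apply: (big_morph (@cabs R)) => [x y|]; [exact: cabsM|exact: cabs1]. Qed.

Variables (a : 'I_k -> C) (al : C).
Hypotheses (a_re : forall j, p%:R - 1 < complex.Re (a j + (n j)%:R))
  (al_re : p%:R - 1 < complex.Re al).

Let ra j : C := (complex.Re (a j))%:C.
Let ral : C := (complex.Re al)%:C.

Lemma ra_re j : p%:R - 1 < complex.Re (ra j + (n j)%:R).
Proof. by have := a_re j; rewrite !ReD. Qed.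

Lemma tot_real : tot n ra ral = (complex.Re (tot n a al))%:C.
Proof.
rewrite /tot ReD rmorphD; congr (_ + _); rewrite Re_sum rmorph_sum; apply: eq_bigr => j _.
by rewrite ReD rmorphD /= Re_nat rmorph_nat.
Qed.

Lemma tot_re : p%:R - 1 < complex.Re (tot n a al).
Proof.
have p0 : 0 <= p%:R - 1 :> R by rewrite subr_ge0 ler1n.
rewrite /tot ReD; apply: lt_le_trans al_re _; rewrite lerDr Re_sum.
by apply: sumr_ge0 => j _; apply: le_trans p0 (ltW (a_re j)).
Qed.

Lemma gauss_int_square b : p%:R - 1 < complex.Re b ->
  cintegrable (leb R (mcoord p p)) setT (fun u => gdet_gauss (b - p%:R) (mat u)) /\
  gauss_int p p (b - p%:R) * mxGamma p p%:R = (pi ^+ (p * p))%:C * mxGamma p b.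
Proof.
move=> b_re; have := @wishart_integral R p p (b - p%:R) (leqnn p).
by rewrite subrK => /(_ b_re).
Qed.

(** The modulus of a complex power of a positive number is the power with the real part, so the
    identities already shown for [joint], at real parameters, compute integrals of the modulus. *)
Lemma joint_real (z : T * S) : joint L ra ral z = (cabs (joint L a al z))%:C.
Proof.
rewrite /joint tot_real cabsM cabs_prod rmorphM rmorph_prod /=; congr (_ * _).
  apply: eq_bigr => j _; rewrite cabsM cabs_pw cabs_real ger0_norm ?expR_ge0 //.
  by rewrite pw_real rmorphM.
rewrite /gdet_gauss cabsM cabs_pw cabs_real ger0_norm ?expR_ge0 // rmorphM /=.
congr (_ * _); rewrite -pw_real; congr pw.
by rewrite -(rmorph_nat (real_complex R)) -rmorphB /=; case: (tot n a al).
Qed.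

Lemma marginal_real (u : T) : marginal L ra ral u = (cabs (marginal L a al u))%:C.
Proof.
rewrite /marginal tot_real cabsM cabs_prod rmorphM rmorph_prod /=; congr (_ * _).
  by apply: eq_bigr => j _; rewrite cabs_pw pw_real.
by rewrite cabs_pw -rmorphN pw_real; case: (tot n a al).
Qed.

(** Tonelli, with the blocks integrated first: at real parameters the inner integral is a constant
    times a Gaussian power of [Z], and the condition on [al] makes that integrable. *)
Lemma joint_integrable :
  cintegrable (leb R (Defs.coord p n) \x leb R (mcoord p p))%E setT (joint L a al).
Proof.
apply/cintegrableP; have mj := cmeas_joint p L a al; split=> //.
have mc : measurable_fun [set: T * S] (fun z => (cabs (joint L a al z))%:E).
  by apply/measurable_EFinP; exact: measurable_cabs.
apply/(integrable21ltyP (leb R (Defs.coord p n)) (leb R (mcoord p p)) mc).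
have [iG _] := gauss_int_square (b := ral) al_re.
have [[iV _] _] := cintegralZl (joint_const p L ra) iG.
under eq_integral => z _.
  rewrite (_ : (\int[_]_x _)%E =
    (complex.Re (joint_const p L ra * gdet_gauss (ral - p%:R) (mat z)))%:E); last first.
    have [[i1 _] <-] := joint_integral_fst n_ge uL ral ra_re z.
    rewrite /cintegral /= /Rintegral fineK; last exact: integrable_fin_num.
    by apply: eq_integral => u _; rewrite joint_real /= ger0_norm ?cabs_ge0.
  over.
exact: integrable_lty.
Qed.

End marginal_integral.

Section marginal_value.
Variables (R : realType) (p k : nat) (n : 'I_k -> nat).
Local Notation C := R[i].
Variables (L : forall j, 'M[C]_(n j)).
Hypotheses (p_gt0 : (0 < p)%N) (n_ge : forall j, (p <= n j)%N)
  (uL : forall j, L j \in unitmx).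
Local Notation T := (cspace R (Defs.coord p n)).

(** Equality of the two iterated integrals of [joint]. The factor [c] stays inside because at
    complex parameters it is not known to be nonzero. *)
Let marginal_scaled (a : 'I_k -> C) (al : C) :
  (forall j, p%:R - 1 < complex.Re (a j + (n j)%:R)) -> p%:R - 1 < complex.Re al ->
  let c := gauss_int p p (tot n a al - p%:R) in
  cintegrable (leb R (Defs.coord p n)) setT (fun u => c * marginal L a al u) /\
  cintegral (leb R (Defs.coord p n)) setT (fun u => c * marginal L a al u) =
  joint_const p L a * gauss_int p p (al - p%:R).
Proof.
move=> a_re al_re c.
have iJ := joint_integrable n_ge uL a_re al_re.
have E1 u : cintegral (leb R (mcoord p p)) setT (fun z => joint L a al (u, z)) =
    c * marginal L a al u.
  by rewrite (joint_integral_snd L a_re al_re p_gt0 u).2 mulrC.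
have E2 z : cintegral (leb R (Defs.coord p n)) setT (fun u => joint L a al (u, z)) =
    joint_const p L a * gdet_gauss (al - p%:R) (mat z).
  exact: (joint_integral_fst n_ge uL al a_re z).2.
have [i1 e1] := cFubini1 iJ (fun u => (joint_integral_snd L a_re al_re p_gt0 u).1).
have e2 := cFubini2 iJ (fun z => (joint_integral_fst n_ge uL al a_re z).1).
rewrite (funext E1) in i1 e1; split; first exact: i1.
rewrite e1 -e2 (funext E2).
have iG := (@wishart_integral R p p (al - p%:R) (leqnn p)); rewrite subrK in iG.
exact: (cintegralZl _ (iG al_re).1).2.
Qed.

Lemma marginal_integral (a : 'I_k -> C) (al : C) :
  (forall j, p%:R - 1 < complex.Re (a j + (n j)%:R)) -> p%:R - 1 < complex.Re al ->
  cintegrable (leb R (Defs.coord p n)) setT (marginal L a al) /\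
  cintegral (leb R (Defs.coord p n)) setT (marginal L a al) * mxGamma p (tot n a al) =
  joint_const p L a * mxGamma p al.
Proof.
move=> a_re al_re.
have pi0 : (pi ^+ (p * p))%:C != 0 :> C.
  rewrite -(rmorph0 (real_complex R)); apply: contra_neq (@complexI R _ _) _.
  by rewrite expf_neq0 // gt_eqF // pi_gt0.
have t_re := tot_re p_gt0 a_re al_re.
have [_ tE] := gauss_int_square t_re; have [_ alE] := gauss_int_square al_re.
pose ra j : C := (complex.Re (a j))%:C; pose ral : C := (complex.Re al)%:C.
have iM : cintegrable (leb R (Defs.coord p n)) setT (marginal L a al).
  (* With real parameters [c] is nonzero by positivity of gamma and can be divided out; the
     resulting integrable function is the modulus of the complex one and dominates it. *)
  have [i1 _] := marginal_scaled (ra_re a_re) (al := ral) al_re.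
  set c := gauss_int _ _ _ in i1.
  have c0 : c != 0.
    have [_ rE] := @gauss_int_square R p (tot n ra ral)
      (tot_re p_gt0 (ra_re a_re) (al := ral) al_re).
    apply/eqP => c0; move/eqP: rE; rewrite -/c c0 mul0r eq_sym mulf_eq0 (negbTE pi0) /=.
    by rewrite tot_real (negbTE (mxGamma_real_neq0 t_re)).
  have [i2 _] := cintegralZl c^-1 i1.
  apply: (cintegrable_le _ i2).
    have mX j : mmeas (fun u : T => L j *m blocks u j).
      by apply: mmeasM; [exact: mmeas_cst|exact: mmeas_blocks].
    apply: cmeasM.
      by apply: cmeas_prod => j; apply: cmeas_pw; exact: measurable_gdet.
    apply: cmeas_pw; apply: measurable_absdet; apply: mmeasD; first exact: mmeas_cst.
    by apply: mmeas_sum => j; apply: mmeasM => //; exact: mmeas_ct.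
  by move=> u; rewrite mulKf // marginal_real cabs_real ger0_norm ?cabs_ge0.
split=> //.
have [_ e1] := marginal_scaled a_re al_re.
rewrite (cintegralZl _ iM).2 in e1.
(* Multiplying by [pi ^ (p * p)] lets both Gaussian moments in [Z] be exchanged for gamma values;
   the common factor [mxGamma p p] is absorbed on the way back, without a division by it. *)
apply: (mulfI pi0); rewrite mulrCA -tE mulrA [X in X * _]mulrC e1 -mulrA alE; ring.
Qed.

End marginal_value.

(** A vector in the kernel of the Gram matrix makes the squared norm of [L X v^*] zero, hence lies
    in the kernel of [X]. This identifies the domain of the average with the set where all Gram
    powers are nonzero. *)
Lemma gdet_gt0_rank (R : realType) n p (L : 'M[R[i]]_n) (X : 'M[R[i]]_(n, p)) :
  L \in unitmx -> (0 < gdet (L *m X)) = (\rank X == p).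
Proof.
move=> uL; rewrite absdet_gt0; apply/idP/eqP => [uG|rX].
  apply/eqP; rewrite eqn_leq rank_leq_col /=.
  rewrite -{1}(mxrank_unit uG); apply: leq_trans (mxrankM_maxr _ _) _.
  exact: mxrankM_maxr.
rewrite -row_free_unit; apply: inj_row_free => v vG.
have Mv0 : L *m X *m v^t* = 0.
  apply: frob_eq0; apply: complexI.
  by rewrite frobE trmxC_mul trmxCK mulmxA -[v *m _ *m _]mulmxA vG mul0mx mxtrace0.
have Xv0 : X *m v^t* = 0.
  by rewrite -[LHS]mul1mx -(mulVmx uL) -!mulmxA [L *m _]mulmxA Mv0 mulmx0.
have : (v^t* )^T *m X^T = 0 by rewrite -trmx_mul Xv0 trmx0.
move/eqP; rewrite mulmx_free_eq0; last by rewrite /row_free mxrank_tr rX.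
by move=> /eqP /(congr1 trmx); rewrite trmxK trmx0 => vt; rewrite -[v]trmxCK vt trmx0 map_mx0.
Qed.

(** * From the Dirichlet average to the marginal integral *)

Section dirichlet_integrand.
Variables (R : realType) (p k : nat) (n : 'I_k -> nat).
Local Notation C := R[i].
Variables (B : forall j, 'M[C]_(n j)) (L : forall j, 'M[C]_(n j)).
Hypotheses (uL : forall j, L j \in unitmx) (BL : forall j, B j = (L j)^t* *m L j).
Local Notation T := (cspace R (Defs.coord p n)).
Implicit Type u : T.

Lemma gram_gdet u j : absdet (gram B (blocks u) j) = gdet (L j *m blocks u j).
Proof. by rewrite /gram BL /gdet trmxC_mul !mulmxA. Qed.

Lemma absdet_gramsum u :
  absdet (1%:M + \sum_j gram B (blocks u) j) = absdet (gramsum L u).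
Proof.
rewrite /gramsum; congr (absdet (_ + _)); apply: eq_bigr => j _.
by rewrite /gram BL trmxC_mul !mulmxA.
Qed.

Lemma absdet_gramsum_gt0 u : 0 < absdet (gramsum L u).
Proof.
have [A uA ->] := gramsum_factor L u.
by rewrite absdetM absdet_ct mulr_gt0 // absdet_gt0.
Qed.

Lemma fullrankE : fullrank (R := R) (p := p) (n := n) =
  [set u | forall j, 0 < gdet (L j *m blocks u j)].
Proof.
apply/seteqP; split => u /= H j; have := H j.
  by move=> /eqP; rewrite -(gdet_gt0_rank _ (uL j)).
by rewrite gdet_gt0_rank // => /eqP.
Qed.

Lemma measurable_fullrank : measurable (fullrank (R := R) (p := p) (n := n)).
Proof.
rewrite fullrankE.
rewrite (_ : [set u | _] = \bigcap_(j in [set: 'I_k])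
    [set u : T | 0 < gdet (L j *m blocks u j)]); last first.
  by apply/seteqP; split => u /= H j; [move=> _|]; apply: H.
apply: fin_bigcap_measurable => // j _.
have m1 : measurable_fun [set: T] (fun u => 0 < gdet (L j *m blocks u j)).
  apply: measurable_fun_ltr => //; apply: measurable_gdet.
  by apply: mmeasM; [exact: mmeas_cst|exact: mmeas_blocks].
by rewrite -[X in measurable X]setTI; exact: (m1 measurableT [set true]).
Qed.

Variables (alpha : 'I_k -> C) (alpha_last : C) (gamma : 'I_k -> C).

Lemma total_tot : Defs.total n alpha alpha_last =
  tot n (fun j => alpha j + gamma j) (alpha_last - \sum_j gamma j).
Proof. by rewrite /Defs.total /tot !big_split /=; ring. Qed.

(** Off the full-rank set some Gram determinant is zero and its [pw] annihilates the right side, so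
    the restricted integral becomes one over the whole space. On that set [cpow] and [pw] agree and
    the exponents add. *)
Lemma dirichlet_integrand u :
  (if u \in fullrank (R := R) (p := p) (n := n) then
    det_power B gamma (blocks u) * dirichlet2_density B alpha alpha_last (blocks u)
  else 0) =
  dirichlet2_const p B alpha alpha_last *
  marginal L (fun j => alpha j + gamma j) (alpha_last - \sum_j gamma j) u.
Proof.
rewrite fullrankE /det_power /dirichlet2_density /marginal absdet_gramsum -total_tot.
case: ifPn => [/set_mem /= H|/negP nH]; last first.
  have [j gj] : exists j, gdet (L j *m blocks u j) <= 0.
    apply: contrapT => /forallNP H; apply: nH; apply/mem_set => /= j.
    by have /negP := H j; rewrite -ltNge.
  by rewrite (bigD1 j) //= pw0 // !mul0r mulr0.
rewrite pwE ?absdet_gramsum_gt0 //.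
have -> : \prod_j pw (gdet (L j *m blocks u j)) (alpha j + gamma j) =
    \prod_j cpow (absdet (gram B (blocks u) j)) (gamma j) *
    \prod_j cpow (absdet (gram B (blocks u) j)) (alpha j).
  rewrite -big_split /=; apply: eq_bigr => j _.
  by rewrite gram_gdet pwE // cpowD mulrC.
by ring.
Qed.

End dirichlet_integrand.

Theorem mainTheorem8 (R : realType) (p k : nat) (n : 'I_k -> nat)
    (B : forall j, 'M[R[i]]_(n j))
    (alpha : 'I_k -> R[i]) (alpha_last : R[i]) (gamma : 'I_k -> R[i])
    (p_gt0 : (0 < p)%N) (k_gt0 : (0 < k)%N)
    (n_ge : forall j, (p <= n j)%N)
    (B_posdef : forall j, herm_posdef (B j))
    (alpha_re : forall j, p%:R - 1 < complex.Re (alpha j + (n j)%:R))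
    (alpha_gamma_re : forall j, p%:R - 1 < complex.Re (alpha j + (n j)%:R + gamma j))
    (alpha_last_re : p%:R - 1 < complex.Re alpha_last)
    (alpha_last_gamma_re : p%:R - 1 < complex.Re (alpha_last - \sum_j gamma j)) :
  dirichlet2_avg_exists B alpha alpha_last (det_power (p := p) B gamma) /\
  dirichlet2_avg B alpha alpha_last (det_power (p := p) B gamma) =
    (\prod_j (mxGamma p (alpha j + (n j)%:R + gamma j) /
              mxGamma p (alpha j + (n j)%:R))) *
    (mxGamma p (alpha_last - \sum_j gamma j) / mxGamma p alpha_last).
Proof.
have fac j := cid2 (herm_posdef_factor (B_posdef j)).
pose L j := s2val (fac j).
have uL j : L j \in unitmx := s2valP (fac j).
have BL j : B j = (L j)^t* *m L j := s2valP' (fac j).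
pose a j := alpha j + gamma j; pose al := alpha_last - \sum_j gamma j.
have a_re j : p%:R - 1 < complex.Re (a j + (n j)%:R) by rewrite addrAC.
have mF := measurable_fullrank (p := p) uL.
have integrandE := funext (dirichlet_integrand (p := p) uL BL alpha alpha_last gamma).
have [iM eM] := marginal_integral p_gt0 n_ge uL a_re alpha_last_gamma_re.
have [iZ eZ] := cintegralZl (dirichlet2_const p B alpha alpha_last) iM.
have [mkI mkE] := cintegral_mkcond (leb R (Defs.coord p n))
  (fun u => det_power B gamma (blocks u) *
            dirichlet2_density B alpha alpha_last (blocks u)) mF.
rewrite integrandE in mkI mkE; split; first exact/mkI.
rewrite [LHS]mkE eZ.
have pi0 j : (pi ^+ (n j * p))%:C != 0 :> R[i].
  rewrite -(rmorph0 (real_complex R)); apply: contra_neq (@complexI R _ _) _.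
  by rewrite expf_neq0 // gt_eqF // pi_gt0.
(* One block at a time: [|det B_j| ^ p] is [|det L_j| ^ (2 p)] and cancels the Jacobian, while the
   Wishart moment times the gamma value at [n_j] cancels the power of [pi]. *)
have factor j : (absdet (B j) ^+ p)%:C *
      (mxGamma p (n j)%:R / ((pi ^+ (n j * p))%:C * mxGamma p (alpha j + (n j)%:R))) *
    (((absdet (L j) ^+ 2) ^- p)%:C * gauss_int (n j) p (a j)) =
    mxGamma p (alpha j + (n j)%:R + gamma j) / mxGamma p (alpha j + (n j)%:R).
  have [_ W] := wishart_integral (n_ge j) (a_re j).
  have dL : (absdet (L j) ^+ 2) ^+ p != 0 by rewrite !expf_neq0 // gt_eqF // absdet_gt0.
  rewrite BL absdetM absdet_ct -expr2 invfM -[X in mxGamma p X / _]addrAC.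
  rewrite (_ : _ * _ = ((absdet (L j) ^+ 2) ^+ p * (absdet (L j) ^+ 2) ^- p)%:C *
    (gauss_int (n j) p (a j) * mxGamma p (n j)%:R / (pi ^+ (n j * p))%:C /
     mxGamma p (alpha j + (n j)%:R))); last by rewrite rmorphM /=; ring.
  by rewrite divff // mul1r W [_%:C * _]mulrC mulfK.
rewrite -(eq_bigr _ (fun j _ => factor j)) big_split /=.
(* [M] stands for the gamma value at [total]. It multiplies the integral, so the product form of the
   marginal identity is exactly what is required. *)
have rearrange (P J M G H I : R[i]) :
  I * M = J * H -> P * (M / G) * I = P * J * (H / G).
  by move=> E; rewrite -mulrA mulrAC [M * I]mulrC E !mulrA.
by rewrite /dirichlet2_const (total_tot n alpha alpha_last gamma); exact: rearrange eM.
Qed.
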